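(* Let $M=\Lambda^2_-(T^*\mathcal{S}^4)$, let $M_0=\mathbb{R}^+\times\mathbb{CP}^3=M\setminus\mathcal{S}^4$ (complement of the zero section), and let $\varphi_c$, $c\ge0$, be the Bryant--Salamon $\mathrm{G}_2$-structures (on $M$ for $c>0$, on $M_0$ for $c=0$). Let $\mathrm{SO}(3)$ act on $M$ and $M_0$ through $\mathrm{SO}(3)\times\{1\}\subset\mathrm{SO}(\mathbb{R}^3\oplus\mathbb{R}^2)$. (a) For every $c>0$, there is an $\mathrm{SO}(3)$-invariant projection $\pi_c:M\to\mathbb{R}^3$ such that each fibre $\pi_c^{-1}(x)$ is coassociative in $(M,\varphi_c)$. Moreover, there is a circle $\mathcal{S}^1_c\subseteq\{0\}\times\mathbb{R}^2\subseteq\mathbb{R}^3$ such that the fibres of $\pi_c$ are given by $$\pi_c^{-1}(x)\cong\begin{cases}T^*\mathcal{S}^2, & x\notin\mathcal{S}^1_c,\\ (\mathbb{R}^+\times\mathbb{RP}^3)\cup\{0\}, & x\in\mathcal{S}^1_c.\end{cases}$$ (b) There is an $\mathrm{SO}(3)$-invariant projection $\pi_0:M_0\to\mathbb{R}^3$ such that each $\pi_0^{-1}(x)$ is coassociative in $(M_0,\varphi_0)$. Moreover, the fibres of $\pi_0$ are given by $$\pi_0^{-1}(x)\cong\begin{cases}T^*\mathcal{S}^2, & x\ne0,\\ \mathbb{R}^+\times\mathbb{RP}^3, & x=0.\end{cases}$$ That is, both $(M,\varphi_c)$ and $(M_0,\varphi_0)$ can be realized as $\mathrm{SO}(3)$-invariant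 coassociative fibrations whose fibres are generically smooth and diffeomorphic to $T^*\mathcal{S}^2$, and whose singular fibres consist of a circle of $(\mathbb{R}^+\times\mathbb{RP}^3)\cup\{0\}$ singular fibres in $M$, and a single $\mathbb{R}^+\times\mathbb{RP}^3$ singular fibre in $M_0$.
   Context: Bryant--Salamon structure. Let $\mathcal{S}^4$ carry the round metric of constant curvature $1$. For a local positively oriented orthonormal coframe $b_0,b_1,b_2,b_3$ put $\Omega_1=b_0\wedge b_1-b_2\wedge b_3$, $\Omega_2=b_0\wedge b_2-b_3\wedge b_1$, $\Omega_3=b_0\wedge b_3-b_1\wedge b_2$, a local basis of anti-self-dual 2-forms. The connection induced by the Levi-Civita connection is described by 1-forms $\rho_1,\rho_2,\rho_3$ with $d\Omega_1=2\rho_3\wedge\Omega_2-2\rho_2\wedge\Omega_3$, $d\Omega_2=2\rho_1\wedge\Omega_3-2\rho_3\wedge\Omega_1$, $d\Omega_3=2\rho_2\wedge\Omega_1-2\rho_1\wedge\Omega_2$. Let $(a_1,a_2,a_3)$ be linear fibre coordinates on $\Lambda^2_-(T^*\mathcal{S}^4)$ with respect to $\Omega_1,\Omega_2,\Omega_3$, $r^2=a_1^2+a_2^2+a_3^2$, and $\zeta_1=da_1-2a_2\rho_3+2a_3\rho_2$, $\zeta_2=da_2-2a_3\rho_1+2a_1\rho_3$, $\zeta_3=da_3-2a_1\rho_2+2a_2\rho_1$. Then $$\varphi_c=(c+r^2)^{-3/4}\zeta_1\wedge\zeta_2\wedge\zeta_3+2(c+r^2)^{1/4}(\zeta_1\wedge\Omega_1+\zeta_2\wedge\Omega_2+\zeta_3\wedge\Omega_3),$$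 a globally defined torsion-free $\mathrm{G}_2$-structure on $M$ for $c>0$, and on $M_0$ for $c=0$. Group action. Split $\mathbb{R}^5=\mathbb{R}^3\oplus\mathbb{R}^2$; $\mathrm{SO}(3)$ acts in the standard way on $\mathbb{R}^3$ and trivially on $\mathbb{R}^2$, hence on $\mathcal{S}^4\subset\mathbb{R}^5$ and, by the induced action on forms, on $M$ and $M_0$. Coassociative. An oriented 4-dimensional submanifold $N$ of a $\mathrm{G}_2$ manifold $(M,\varphi)$ is coassociative if $*_\varphi\varphi|_N=\mathrm{vol}_N$; equivalently, up to orientation, $\varphi|_N\equiv0$. Singular fibres are (possibly singular) coassociatives: the condition is imposed at smooth points. Coassociative fibration. A $\mathrm{G}_2$ manifold $M$ admits a coassociative fibration if there is a 3-dimensional space $\mathcal{B}$ parametrizing a family of (not necessarily disjoint, possibly singular) coassociative submanifolds $N_b$, $b\in\mathcal{B}$, such that: every point of $M$ lies in at least one $N_b$, and $N_b$ is smooth for all $b$ in a dense open subset $\mathcal{B}^\circ\subset\mathcal{B}$; and there is a dense open subset $M'\subset M$ and a smooth locally trivial fibration $\pi:M'\to\mathcal{B}'$ onto a submanifold $\mathcal{B}'$ of $\mathcal{B}$ with $\pi^{-1}(b)=N_b\cap M'$ for $b\in\mathcal{B}'$. The set $M\setminus M'$ consists of the points where two members of the family intersect.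
   Formalization: In the definition of coassociative fibration, ''M∖M' consists of the points where two members intersect'' is required only along members over B' (crossing points still lie outside M'); literally it would force M'=M and make all fibres homeomorphic, contradicting the theorem. *)

(* Defs.v *)
From HB Require Import structures.
From mathcomp Require Import all_boot all_order all_algebra.
From mathcomp Require Import all_classical all_reals all_analysis.
Set Implicit Arguments.
Unset Strict Implicit.
Unset Printing Implicit Defensive.
Import Order.TTheory GRing.Theory Num.Theory.
Import numFieldNormedType.Exports.
Local Open Scope classical_set_scope.
Local Open Scope ring_scope.

(* All manifolds are embedded in finite-dimensional normed spaces; smooth maps
   and diffeomorphisms between subsets of such spaces are meant in the sense of
   Milnor (a smooth map is one that extends locally to a smooth map on an open
   subset of the ambient space). *)
Section Smooth.
Variable R : realType.

Fixpoint ck (E F : normedModType R) (k : nat) (V : set E) (f : E -> F) : Prop :=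
  (forall x, V x -> {for x, continuous f}) /\
  if k is k'.+1 then
    (forall x v, V x -> derivable f x v) /\
    (forall v : E, ck k' V (fun x => 'D_v f x))
  else True.

Definition smooth_open (E F : normedModType R) (V : set E) (f : E -> F) : Prop :=
  forall k, ck k V f.

Definition smooth_on (E F : normedModType R) (S : set E) (f : E -> F) : Prop :=
  forall p, S p -> exists (V : set E) (g : E -> F),
    [/\ open V, V p, smooth_open V g & forall x, S x -> V x -> f x = g x].

Definition inverse_between (E F : Type) (S : set E) (T : set F)
    (f : E -> F) (g : F -> E) : Prop :=
  [/\ forall x, S x -> T (f x) /\ g (f x) = x
    & forall y, T y -> S (g y) /\ f (g y) = y].

Definition diffeo (E F : normedModType R) (S : set E) (T : set F)
    (f : E -> F) (g : F -> E) : Prop :=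
  [/\ inverse_between S T f g, smooth_on S f & smooth_on T g].

Definition diffeomorphic (E F : normedModType R) (S : set E) (T : set F) : Prop :=
  exists f g, diffeo S T f g.

Definition submanifold (E : normedModType R) (k : nat) (S : set E) : Prop :=
  forall p, S p -> exists (V : set E) (W : set 'rV[R]_k),
    [/\ open V, V p, open W & diffeomorphic (S `&` V) W].

Definition smooth_points (E : normedModType R) (k : nat) (N : set E) : set E :=
  [set p | N p /\ exists V : set E,
     [/\ open V, V p & submanifold k (N `&` V)]].

(* Velocities at p of smooth curves in S. *)
Definition tangent (E : normedModType R) (S : set E) (p : E) : set E :=
  [set u | exists (I : set R^o) (gam : R^o -> E),
     [/\ open I, I 0, smooth_open I gam, forall t, I t -> S (gam t)
       & gam 0 = p /\ is_derive (0 : R^o) (1 : R^o) gam u]].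

Definition dense_open_in (E : normedModType R) (S S' : set E) : Prop :=
  (exists2 O : set E, open O & S' = S `&` O) /\ S `<=` closure S'.

(* The typical fibre near b is the fibre over b itself. *)
Definition locally_trivial (E F : normedModType R) (S : set E) (B : set F)
    (p : E -> F) : Prop :=
  forall b, B b -> exists2 W : set F, open W /\ W b &
    exists (h : E -> F * E) (h' : F * E -> E),
      diffeo (S `&` p @^-1` W) ((B `&` W) `*` (S `&` p @^-1` [set b])) h h' /\
      forall x, S x -> W (p x) -> (h x).1 = p x.

End Smooth.

Section Models.
Variable R : realType.

(* Covectors on T_xS^2 are extended by zero on the normal line. *)
Definition TstarS2 : set ('rV[R]_3 * 'rV[R]_3) :=
  [set q | q.1 *m q.1^T = 1%:M /\ q.1 *m q.2^T = 0].

(* Lines of R^4, encoded by their orthogonal projections. *)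
Definition RP3 : set 'M[R]_4 :=
  [set P | [/\ P^T = P, P *m P = P & \tr P = 1]].

Definition RpRP3 : set (R^o * 'M[R]_4) := [set q | 0 < q.1 /\ RP3 q.2].

(* The cone (R^+ x RP^3) U {0}: (t, P) is placed at t P, and t = \tr (t P). *)
Definition coneRP3 : set 'M[R]_4 :=
  [set Q | exists t P, [/\ 0 <= t, RP3 P & Q = t *: P]].

(* Homeomorphic to the cone, by a map that is a diffeomorphism away from the
   vertex. *)
Definition iso_coneRP3 (E : normedModType R) (S : set E) : Prop :=
  exists (f : E -> 'M[R]_4) (g : 'M[R]_4 -> E),
    [/\ inverse_between S coneRP3 f g,
        {within S, continuous f}, {within coneRP3, continuous g}
      & diffeo (S `\ g 0) (coneRP3 `\ 0) f g].

(* A round circle in {0} x R^2. *)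
Definition is_circle (C : set 'rV[R]_3) : Prop :=
  exists y0 z0 rad : R, 0 < rad /\
    C = [set x | x 0 0 = 0 /\
                 (x 0 1 - y0) ^+ 2 + (x 0 2%:R - z0) ^+ 2 = rad ^+ 2].

End Models.

(* A point of the ambient space of M = Lambda^2_-(T^*S^4) is a pair (x, A): x is
   a point of R^5 and A is the Gram matrix of the bilinear form
   (u, v) |-> u A v^T on R^5. A 2-form on T_xS^4 is extended to R^5 by zero on
   the normal line. *)
Notation amb R := ('rV[R]_5 * 'M[R]_5)%type.

Section BryantSalamon.
Variable R : realType.

(* The rows of b are b_0, ..., b_3. They are an orthonormal (co)frame of T_xS^4,
   for x in the unit sphere, positive for the orientation of S^4 as the boundary
   of the unit ball. *)
Definition oriented_coframe (x : 'rV[R]_5) (b : 'M[R]_(4, 5)) : Prop :=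
  let B : 'M[R]_5 := col_mx x b in B *m B^T = 1%:M /\ \det B = 1.

Definition wedge_row (b : 'M[R]_(4, 5)) (i j : 'I_4) : 'M[R]_5 :=
  (row i b)^T *m row j b - (row j b)^T *m row i b.

(* Here and below the indices 1, 2, 3 become 0, 1, 2 in 'I_3 = Z/3. *)
Definition Omega (k : 'I_3) (b : 'M[R]_(4, 5)) : 'M[R]_5 :=
  match val k with
  | 0 => wedge_row b 0 1 - wedge_row b 2%:R 3%:R
  | 1 => wedge_row b 0 2%:R - wedge_row b 3%:R 1
  | _ => wedge_row b 0 3%:R - wedge_row b 1 2%:R
  end.

Definition M : set (amb R) :=
  [set p | exists b, oriented_coframe p.1 b /\
     exists a : 'rV[R]_3, p.2 = \sum_k a 0 k *: Omega k b].

(* Complement of the zero section. *)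
Definition M0 : set (amb R) := M `&` [set p | p.2 != 0].

Definition eval1 (r u : 'rV[R]_5) : R := (r *m u^T) 0 0.
Definition eval2 (A : 'M[R]_5) (u v : 'rV[R]_5) : R := (u *m A *m v^T) 0 0.

Definition wedge12 (T : Type) (al : T -> R) (be : T -> T -> R) (u v w : T) : R :=
  al u * be v w - al v * be u w + al w * be u v.

Definition wedge111 (T : Type) (z : 'I_3 -> T -> R) (u : 'I_3 -> T) : R :=
  \det (\matrix_(i < 3, j < 3) z i (u j)).

Definition extd2 (F : 'rV[R]_5 -> 'M[R]_5) (x u v w : 'rV[R]_5) : R :=
  eval2 ('D_u F x) v w - eval2 ('D_v F x) u w + eval2 ('D_w F x) u v.

Definition local_coframe (V : set 'rV[R]_5) (b : 'rV[R]_5 -> 'M[R]_(4, 5)) : Prop :=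
  [/\ open V, smooth_open V b &
      forall x, V x -> x *m x^T = 1%:M -> oriented_coframe x (b x)].

(* The 1-forms rho k are given by covectors on R^5; the equations are between
   forms on S^4, hence only tested on tangent vectors. *)
Definition connection_forms (V : set 'rV[R]_5) (b : 'rV[R]_5 -> 'M[R]_(4, 5))
    (rho : 'I_3 -> 'rV[R]_5 -> 'rV[R]_5) : Prop :=
  forall x, V x -> x *m x^T = 1%:M ->
  forall u v w, x *m u^T = 0 -> x *m v^T = 0 -> x *m w^T = 0 ->
  forall k : 'I_3,
    let Om j := eval2 (Omega j (b x)) in
    extd2 (fun y => Omega k (b y)) x u v w =
      2 * wedge12 (eval1 (rho (k + 2) x)) (Om (k + 1)) u v w
    - 2 * wedge12 (eval1 (rho (k + 1) x)) (Om (k + 2)) u v w.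

(* Omega_1, Omega_2, Omega_3 are orthogonal with Frobenius norm 2, so that
   A = \sum_k a_k Omega_k for (x, A) in M. *)
Definition fibre_coord (b : 'rV[R]_5 -> 'M[R]_(4, 5)) (k : 'I_3) (p : amb R) : R^o :=
  \tr (p.2 *m (Omega k (b p.1))^T) / 4.

Definition zeta (b : 'rV[R]_5 -> 'M[R]_(4, 5)) (rho : 'I_3 -> 'rV[R]_5 -> 'rV[R]_5)
    (p : amb R) (k : 'I_3) (u : amb R) : R :=
  'D_u (fibre_coord b k) p
  - 2 * fibre_coord b (k + 1) p * eval1 (rho (k + 2) p.1) u.1
  + 2 * fibre_coord b (k + 2) p * eval1 (rho (k + 1) p.1) u.1.

Definition local_phi (c : R) (b : 'rV[R]_5 -> 'M[R]_(4, 5))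
    (rho : 'I_3 -> 'rV[R]_5 -> 'rV[R]_5) (p : amb R) (u : 'I_3 -> amb R) : R :=
  let r2 := \sum_k fibre_coord b k p ^+ 2 in
  (c + r2) `^ (- (3 / 4)) * wedge111 (zeta b rho p) u
  + 2 * (c + r2) `^ (1 / 4) *
    \sum_k wedge12 (zeta b rho p k)
             (fun v w => eval2 (Omega k (b p.1)) v.1 w.1) (u 0) (u 1) (u 2%:R).

(* phi p is a 3-form on the tangent space at p: it is only specified, and only
   used, on tangent vectors. *)
Definition bryant_salamon (c : R) (X : set (amb R))
    (phi : amb R -> ('I_3 -> amb R) -> R) : Prop :=
  forall V b rho, local_coframe V b -> connection_forms V b rho ->
  forall p, X p -> V p.1 ->
  forall u, (forall i, tangent X p (u i)) -> phi p u = local_phi c b rho p u.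

Definition SO3 (g : 'M[R]_3) : Prop := g *m g^T = 1%:M /\ \det g = 1.

(* On forms, the action is the pull-back by the inverse. *)
Definition SO3_act (g : 'M[R]_3) (p : amb R) : amb R :=
  let G : 'M[R]_5 := block_mx g 0 0 (1%:M : 'M[R]_2) in
  (p.1 *m G^T, G *m p.2 *m G^T).

Definition SO3_invariant (X : set (amb R)) (T : Type) (f : amb R -> T) : Prop :=
  forall g p, SO3 g -> X p -> f (SO3_act g p) = f p.

End BryantSalamon.

Section Coassociative.
Variables (R : realType) (E : normedModType R).

(* e^{s_1 ... s_k} on the rows of X, for the dual basis e^0, ..., e^6 of R^7. *)
Definition eform (k : nat) (s : seq nat) (X : 'M[R]_(k, 7)) : R :=
  \det (\matrix_(i < k, j < k) X i (inord (nth 0%N s j))).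

Definition phi0 (X : 'M[R]_(3, 7)) : R :=
  let e s := eform s X in
  e [:: 0; 1; 2]%N
  + (e [:: 0; 3; 4]%N - e [:: 0; 5; 6]%N)
  + (e [:: 1; 3; 5]%N - e [:: 1; 6; 4]%N)
  + (e [:: 2; 3; 6]%N - e [:: 2; 4; 5]%N).

(* Hodge dual of phi0 for the Euclidean metric of R^7, which is the metric
   defined by phi0, up to a sign that depends on the orientation. *)
Definition psi0 (X : 'M[R]_(4, 7)) : R :=
  let e s := eform s X in
  e [:: 3; 4; 5; 6]%N
  - (e [:: 1; 2; 3; 4]%N - e [:: 1; 2; 5; 6]%N)
  - (e [:: 2; 0; 3; 5]%N - e [:: 2; 0; 6; 4]%N)
  - (e [:: 0; 1; 3; 6]%N - e [:: 0; 1; 4; 5]%N).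

(* A basis of the tangent space in which phi becomes phi0. It is orthonormal for
   the metric of phi, and *phi becomes psi0 (up to sign) in it. *)
Definition adapted_frame (X : set E) (phi : E -> ('I_3 -> E) -> R) (p : E)
    (e : 'I_7 -> E) : Prop :=
  (forall u, tangent X p u <-> exists y : 'rV[R]_7, u = \sum_j y 0 j *: e j) /\
  (forall Y : 'M[R]_(3, 7),
     phi p (fun i => \sum_j Y i j *: e j) = phi0 Y).

(* At smooth points, *phi|_N = vol_N for one of the two orientations of N: the
   square of vol_N is the Gram determinant. The sign is locally constant, so N
   is oriented by *phi|_N. *)
Definition coassociative (X : set E) (phi : E -> ('I_3 -> E) -> R) (N : set E) : Prop :=
  [/\ N `<=` X, N `<=` closure (smooth_points 4 N) &
      forall p, smooth_points 4 N p ->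
      exists2 e : 'I_7 -> E, adapted_frame X phi p e &
      forall W : 'M[R]_(4, 7),
        (forall i, tangent N p (\sum_j W i j *: e j)) ->
        psi0 W ^+ 2 = \det (W *m W^T)].

(* In the last two clauses: a point that lies on two members of the family is
   not in X', and a point of a member over B' that is not in X' lies on two
   members. Members over B \ B' may be entirely outside X'. *)
Definition coassociative_fibration (F : normedModType R) (X : set E)
    (phi : E -> ('I_3 -> E) -> R) (B : set F) (N : F -> set E) : Prop :=
  let crossing p := exists b1 b2, [/\ B b1, B b2, b1 <> b2, N b1 p & N b2 p] in
  [/\ submanifold 3 B,
      forall b, B b -> coassociative X phi (N b),
      forall p, X p -> exists2 b, B b & N b p,
      exists2 B0 : set F, dense_open_in B B0 &
        forall b, B0 b -> submanifold 4 (N b)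
    & exists (X' : set E) (B' : set F) (p' : E -> F),
        [/\ dense_open_in X X',
            B' `<=` B /\ exists k, submanifold k B',
            [/\ smooth_on X' p', p' @` X' = B' & locally_trivial X' B' p'],
            forall b, B' b -> X' `&` p' @^-1` [set b] = N b `&` X'
          & (forall p, crossing p -> ~ X' p) /\
            (forall b p, B' b -> N b p -> ~ X' p -> crossing p)]].

End Coassociative.

(* Main.v *)
(* Write a point of M as (x, A) with x = (x', x'') in R^3 + R^2, and let r be the
   norm of A. The fibration is pi_c (x, A) = (A_34, (c + r^2)^(1/4) x''), A_34
   being the value of A on the oriented basis of R^2. At x = (C u, S v) with u, v
   unit vectors, there is an adapted coframe of S^4 in which A has three explicit
   components; in the corresponding frame of T_pM the differential of pi_c
   annihilates an explicit 4-plane on which *phi is the volume form. This uses a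
   coframe whose connection forms vanish at the given point.

   On the fibre over (s, y), with y = sg v and V = |y|^2, the function
   g = sqrt (c + r^2) determines |x'|^2 = 1 - V / g. If the fibre contains an
   S^2-orbit on which x' <> 0, at g = g0 > V say, then (u, p) in T*S^2 with
   g = g0 + |p|^2 parametrizes it; g0 is a root of the cubic
   (g^2 - c) (g - V) = s^2 g and depends smoothly on (s, y) where s <> 0. If s = 0
   and V >= sqrt c, then x' is orthogonal to the row of A along the rotated v;
   together they give (q, p) in T*S^2 with g = V + |p|^2. This is the whole of
   T*S^2 for V > sqrt c; for V = sqrt c the zero section collapses to a
   point (or is absent, if c = 0), and T*S^2 minus its zero section is
   R^+ x SO(3) = R^+ x RP^3, by unit quaternions. *)
Require Import Defs.
From HB Require Import structures.
From mathcomp Require Import all_boot all_order all_algebra.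
From mathcomp Require Import all_classical all_reals all_analysis.
From mathcomp Require Import ring lra.
Set Implicit Arguments.
Unset Strict Implicit.
Unset Printing Implicit Defensive.
Import Order.TTheory GRing.Theory Num.Theory.
Import numFieldNormedType.Exports.
Local Open Scope classical_set_scope.
Local Open Scope ring_scope.

(** * Smooth maps and submanifolds *)

(** Smoothness asks only for iterated directional derivatives, so the chain rule has to come from
    the mean value theorem in coordinates. The set [Mc c], where c + r^2 > 0, is M for c > 0 and M_0
    for c = 0; both parts of the theorem are proved for it at once. The cubic comes from a C = s,
    C^2 = 1 - V / g and g^2 = c + a^2 + |w|^2, where a is the first component of A and w holds the
    other two: on the S^2-orbit w = 0. The parametrization by g0 divides by C, which vanishes on
    part of the fibre when s = 0, V > 0 and V >= sqrt c; there the second one relies on a C = 0. The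
    equations of the tangent plane lose rank exactly where x' = 0 and A = 0. Coassociativity is
    imposed at smooth points, so such a point has to be proved singular. For local triviality a
    fibre is identified with T*S^2 by means of y / |y| and g0, hence the dense open part is s != 0,
    y != 0. It misses smooth fibres too, but entirely, and the fibres of a map do not cross. *)

Section Calculus.
Variable R : realType.
Implicit Types E F G : normedModType R.

(** Restriction to a line brings in the one-variable theory: continuity, the chain rule with a
    scalar outer function, and the mean value theorem. *)
Lemma is_derive_line E F (f : E -> F) x v d :
  is_derive x v f d <-> is_derive (0 : R^o) (1 : R^o) (fun t : R^o => f (t *: v + x)) d.
Proof.
have e : (fun h : R => h^-1 *: ((f \o shift x) (h *: v) - f x)) =
   (fun h : R => h^-1 *: (((fun t : R^o => f (t *: v + x)) \o shift (0 : R^o)) (h *: (1 : R^o)) -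
      (fun t : R^o => f (t *: v + x)) 0)).
  apply/funext => h /=; by rewrite addr0 scale0r add0r [_%:A]mulr1.
split=> -[a b]; split.
- by rewrite /derivable -e.
- by rewrite /derive -e.
- by move: a; rewrite /derivable -e.
- by move: b; rewrite /derive -e.
Qed.

Lemma near_is_derive E F (f g : E -> F) (V : set E) x v d : open V -> V x ->
  (forall y, V y -> f y = g y) -> is_derive x v f d -> is_derive x v g d.
Proof.
move=> oV Vx fg; apply: near_eq_is_derive.
by near=> y; apply: fg; near: y; exact: open_nbhs_nbhs.
Unshelve. all: by end_near. Qed.

Lemma derivable_cvg E F (f : E -> F) x v d : is_derive x v f d ->
  (fun h : R => h^-1 *: (f (h *: v + x) - f x)) @ 0^' --> d.
Proof. by case=> df <-; exact: df. Qed.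

Lemma cvg_is_derive E F (f : E -> F) x v d :
  (fun h : R => h^-1 *: (f (h *: v + x) - f x)) @ 0^' --> d -> is_derive x v f d.
Proof.
move=> h; split; first by apply/cvg_ex; exists d.
exact: (@cvg_lim _ _ _ _ _ _ _ h).
Qed.

Lemma is_derive_lin E F G (f : E -> F) (l : {linear F -> G}) x v d :
  continuous l -> is_derive x v f d -> is_derive x v (fun y => l (f y)) (l d).
Proof.
move=> cl /derivable_cvg df; apply: cvg_is_derive.
have := cvg_comp _ _ df (cl d).
by apply: cvg_trans; apply: near_eq_cvg; near=> h; rewrite /= linearZ linearB.
Unshelve. all: by end_near. Qed.

(** Derivability in the one direction [v] does not make [a] continuous at [x], but it does along the
    line through [x], which is all that the difference quotient sees. *)
Lemma is_derive_scale E F (a : E -> R^o) (f : E -> F) x v da df :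
  is_derive x v a da -> is_derive x v f df ->
  is_derive x v (fun y => a y *: f y) (da *: f x + a x *: df).
Proof.
move=> ha hf.
have ca : (fun h : R => a (h *: v + x)) @ 0^' --> a x.
  have /is_derive_line [+ _] := ha.
  move=> /derivable1_diffP/differentiable_continuous/continuous_withinNx.
  by rewrite scale0r add0r.
move: ha hf => /derivable_cvg ha /derivable_cvg hf; apply: cvg_is_derive.
rewrite addrC.
have FF : Filter (0 : R)^' by exact: dnbhs_filter.
have := @cvgD _ _ _ _ FF _ _ _ _ (@cvgZ _ _ _ _ FF _ _ _ _ ca hf)
  (@cvgZ _ _ _ _ FF _ _ _ _ ha (@cvg_cst _ (f x) _ _ FF)).
apply: cvg_trans; apply: near_eq_cvg; near=> h => /=.
rewrite !fctE /=.
have -> : a (h *: v + x) *: f (h *: v + x) - a x *: f x =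
    a (h *: v + x) *: (f (h *: v + x) - f x) + (a (h *: v + x) - a x) *: f x.
  by rewrite scalerBr scalerBl addrA subrK.
rewrite [RHS]scalerDr.
transitivity ((a (h *: v + x) * h^-1) *: (f (h *: v + x) - f x) +
  (h^-1 * (a (h *: v + x) - a x)) *: f x).
  by rewrite -[in RHS]scalerA.
by rewrite [in LHS]mulrC -!scalerA.
Unshelve. all: by end_near. Qed.

Lemma is_derive_comp1 E (h : R -> R) (f : E -> R^o) x v d dh :
  is_derive (f x) 1 h dh -> is_derive x v f d ->
  is_derive x v (fun y => h (f y) : R^o) (dh * d).
Proof.
move=> Hh /is_derive_line Hf; apply/is_derive_line.
have fx : f x = f (0 *: v + x) by rewrite scale0r add0r.
move: Hh; rewrite fx => Hh.
exact: (@is_derive1_comp R h (fun t : R => f (t *: v + x)) 0 dh d Hh Hf).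
Qed.

Lemma for_continuous_lin E F G (f : E -> F) (l : {linear F -> G}) x :
  continuous l -> {for x, continuous f} -> {for x, continuous (fun y => l (f y))}.
Proof. by move=> cl cf; apply: continuous_comp cf _; exact: cl. Qed.

Lemma ckSE E F k (V : set E) (f : E -> F) : ck k.+1 V f <->
  [/\ forall x, V x -> {for x, continuous f}, forall x v, V x -> derivable f x v &
    forall v : E, ck k V (fun x => 'D_v f x)].
Proof. by split=> [[a [b c]]|[a b c]]. Qed.

Lemma ck_derive E F k (V : set E) (f : E -> F) v : ck k.+1 V f -> ck k V (fun x => 'D_v f x).
Proof. by move/ckSE => []. Qed.

Lemma ck_cont E F k (V : set E) (f : E -> F) x : ck k V f -> V x ->
  {for x, continuous f}.
Proof. by case: k => [|k] [h _] Vx; exact: h. Qed.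

Lemma ck_is_derive E F k (V : set E) (f : E -> F) x v : ck k.+1 V f -> V x ->
  is_derive x v f ('D_v f x).
Proof. by case=> _ [h _] Vx; split => //; exact: h. Qed.

Lemma ckS E F k (V : set E) (f : E -> F) : ck k.+1 V f -> ck k V f.
Proof.
elim: k f => [|k IH] f; first by case=> h _.
move=> [h [d g]]; split=> //; split=> // v; exact: IH.
Qed.

Lemma ck_sub E F k (V V' : set E) (f : E -> F) : V' `<=` V -> ck k V f -> ck k V' f.
Proof.
elim: k f => [|k IH] f VV.
  by move=> [h1 h2]; split=> // x /VV; exact: h1.
move=> /ckSE[h1 h2 h3]; apply/ckSE; split=> [x /VV|x v /VV|v].
- exact: h1.
- exact: h2.
- by apply: IH.
Qed.

Lemma near_continuous E F (f g : E -> F) (V : set E) x : open V -> V x ->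
  (forall y, V y -> f y = g y) -> {for x, continuous f} -> {for x, continuous g}.
Proof.
move=> oV Vx fg cf; rewrite /prop_for /continuous_at -fg//.
apply: cvg_trans cf; apply: near_eq_cvg.
by near=> y; apply: fg; near: y; exact: open_nbhs_nbhs.
Unshelve. all: by end_near. Qed.

Lemma ck_ext E F k (V : set E) (f g : E -> F) : open V ->
  (forall x, V x -> f x = g x) -> ck k V f -> ck k V g.
Proof.
move=> oV; elim: k f g => [|k IH] f g fg.
  by move=> [h1 h2]; split=> // x Vx; exact: near_continuous oV Vx fg (h1 _ Vx).
move=> /ckSE[h1 h2 h3]; apply/ckSE; split=> [x Vx|x v Vx|v].
- exact: near_continuous oV Vx fg (h1 _ Vx).
- have [] // : is_derive x v g ('D_v f x).
    by apply: (near_is_derive oV Vx fg); split=> //; exact: h2.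
- apply: IH (h3 v) => x Vx; apply/esym.
  have [] // : is_derive x v g ('D_v f x).
  by apply: (near_is_derive oV Vx fg); split=> //; exact: h2.
Qed.

(* To prove ck k.+1 it suffices to exhibit the directional derivatives. *)
Lemma ck_step E F k (V : set E) (f : E -> F) (df : E -> E -> F) : open V ->
  (forall x, V x -> {for x, continuous f}) ->
  (forall x v, V x -> is_derive x v f (df v x)) ->
  (forall v, ck k V (df v)) -> ck k.+1 V f.
Proof.
move=> oV cf h1 h2; split=> //; split=> [x v /(h1 _ v) []//|v].
apply: ck_ext (h2 v) => // x /(h1 _ v) [_ ->//].
Qed.

Lemma ck_cst E F k (V : set E) (a : F) : ck k V (fun _ => a).
Proof.
have c (b : F) x : V x -> {for x, continuous (fun _ : E => b)}.
  by move=> _; exact: cst_continuous.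
elim: k a => [|k IH] a; split=> //; first exact: c.
  exact: c.
split=> [x v _|v]; first exact: derivable_cst.
have -> : (fun x => 'D_v (fun _ : E => a) x) = (fun _ => 0).
  by apply/funext => x; exact: derive_cst.
exact: IH.
Qed.

Lemma ck_lin E F k (V : set E) (l : {linear E -> F}) : continuous l -> ck k V l.
Proof.
move=> cl; case: k => [|k]; first by split=> // x _; exact: cl.
have d x v : is_derive x v l (l v).
  have := @is_derive_lin E E F id l x v v cl (is_derive_id _ _); exact.
apply/ckSE; split=> [x _|x v _|v]; first exact: cl.
  by have [] := d x v.
have -> : (fun x => 'D_v l x) = (fun _ => l v).
  by apply/funext => x; have [] := d x v.
exact: ck_cst.
Qed.

Lemma ck_comp_lin E F G k (V : set E) (f : E -> F) (l : {linear F -> G}) :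
  open V -> continuous l -> ck k V f -> ck k V (fun x => l (f x)).
Proof.
move=> oV cl; elim: k f => [|k IH] f cf.
  by split=> // x Vx; apply: for_continuous_lin => //; exact: ck_cont cf Vx.
apply: (@ck_step _ _ _ _ _ (fun v x => l ('D_v f x))) => //.
- by move=> x Vx; apply: for_continuous_lin => //; exact: ck_cont cf Vx.
- by move=> x v Vx; apply: is_derive_lin => //; exact: ck_is_derive cf Vx.
- by move=> v; apply: IH; exact: ck_derive.
Qed.

Lemma ckD E F k (V : set E) (f g : E -> F) : open V ->
  ck k V f -> ck k V g -> ck k V (fun x => f x + g x).
Proof.
move=> oV; elim: k f g => [|k IH] f g cf cg.
  by split=> // x Vx; apply: continuousD; [exact: ck_cont cf Vx|exact: ck_cont cg Vx].
apply: (@ck_step _ _ _ _ _ (fun v x => 'D_v f x + 'D_v g x)) => //.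
- by move=> x Vx; apply: continuousD; [exact: ck_cont cf Vx|exact: ck_cont cg Vx].
- by move=> x v Vx; apply: is_deriveD; [exact: ck_is_derive cf Vx|exact: ck_is_derive cg Vx].
- by move=> v; apply: IH; exact: ck_derive.
Qed.

Lemma ckZ E F k (V : set E) (a : E -> R^o) (f : E -> F) : open V ->
  ck k V a -> ck k V f -> ck k V (fun x => a x *: f x).
Proof.
have c x : {for x, continuous a} -> {for x, continuous f} ->
    {for x, continuous (fun x => a x *: f x)}.
  by move=> ca cf; exact: continuousZ ca cf.
move=> oV; elim: k a f c => [|k IH] a f c cf cg.
  by split=> // x Vx; apply: c; [exact: ck_cont cf Vx|exact: ck_cont cg Vx].
apply: (@ck_step _ _ _ _ _ (fun v x => 'D_v a x *: f x + a x *: 'D_v f x)) => //.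
- by move=> x Vx; apply: c; [exact: ck_cont cf Vx|exact: ck_cont cg Vx].
- by move=> x v Vx; apply: is_derive_scale; [exact: ck_is_derive cf Vx|exact: ck_is_derive cg Vx].
- move=> v; apply: ckD => //; apply: IH; try exact: ckS.
  + by move=> x ca cf'; exact: continuousZ ca cf'.
  + exact: ck_derive.
  + by move=> x ca cf'; exact: continuousZ ca cf'.
  + exact: ck_derive.
Qed.

Lemma ckV E k (V : set E) (f : E -> R^o) : open V ->
  (forall x, V x -> f x != 0) -> ck k V f -> ck k V (fun x => (f x)^-1 : R^o).
Proof.
move=> oV f0; elim: k => [|k IH] cf.
  split=> // x Vx; apply: (@continuousV R E f x); [exact: f0|exact: ck_cont cf Vx].
have ciV := IH (ckS cf).
(* The derivative is written in terms of the inverse itself, to which the induction hypothesis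
   applies. *)
apply: (@ck_step _ _ _ _ _ (fun v x => - (f x)^-1 *: ((f x)^-1 *: 'D_v f x) : R^o)) => //.
- move=> x Vx; exact: ck_cont ciV Vx.
- move=> x v Vx.
  have h := @is_derive_comp1 E GRing.inv f x v ('D_v f x) (- (f x)^-2).
  have -> : - (f x)^-1 *: ((f x)^-1 *: 'D_v f x) = - (f x) ^- 2 * 'D_v f x.
    by rewrite /GRing.scale /= expr2 invfM; ring.
  apply: h; last exact: ck_is_derive cf Vx.
  have [d1 d2] := is_derive_id (f x : R^o) (1 : R^o).
  have e : (id : R -> R) (f x) != 0 by exact: f0.
  split; first exact: (@derivableV R R^o id (f x) 1 e d1).
  by rewrite (@deriveV R R^o id (f x) 1 e d1) d2 /GRing.scale /= mulr1.
- move=> v; apply: ckZ => //; last first.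
    by apply: ckZ => //; exact: ck_derive.
  have -> : (fun x => - (f x)^-1 : R^o) = (fun x => (-1) *: (f x)^-1 : R^o).
    by apply/funext=> x; rewrite scaleN1r.
  by apply: ckZ => //; exact: ck_cst.
Qed.

Lemma ck_sqrt E k (V : set E) (f : E -> R^o) : open V ->
  (forall x, V x -> 0 < f x) -> ck k V f -> ck k V (fun x => Num.sqrt (f x) : R^o).
Proof.
move=> oV f0; elim: k => [|k IH] cf.
  split=> // x Vx; apply: continuous_comp; first exact: ck_cont cf Vx.
  exact: sqrt_continuous.
have cs := IH (ckS cf).
apply: (@ck_step _ _ _ _ _ (fun v x => (2 *: (Num.sqrt (f x) : R^o))^-1 *: 'D_v f x : R^o)) => //.
- move=> x Vx; exact: ck_cont cs Vx.
- move=> x v Vx; apply: is_derive_comp1 (ck_is_derive v cf Vx).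
  exact: is_derive1_sqrt (f0 _ Vx).
- move=> v; apply: ckZ => //; last exact: ck_derive.
  apply: ckV => //.
    by move=> x /f0 fx; rewrite mulf_neq0 ?pnatr_eq0 // gt_eqF // sqrtr_gt0.
  by apply: ckZ => //; exact: ck_cst.
Qed.

(** A finite frame with continuous coordinates: an increment then splits into finitely many steps
    along the [e i], each a one-variable matter. *)
Definition findim E := exists (I : finType) (e : I -> E) (l : I -> {linear E -> R^o}),
  (forall i, continuous (l i)) /\ forall x, x = \sum_i l i x *: e i.

(** The mean value theorem on the segment from [y] in direction [e], with the continuity of the
    directional derivative at [y0]. The bound is uniform in the base point [y], because the
    coordinate steps of the chain rule start at varying points. *)
Lemma increment_bound F (W : set F) (g : F -> R^o) y0 (e : F) (eps : R) :
  open W -> W y0 -> ck 1 W g -> 0 < eps ->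
  exists2 del : R, 0 < del & forall y (t : R), `|y0 - y| < del -> `|t| < del ->
    `|g (t *: e + y) - g y - t * 'D_e g y0| <= eps * `|t|.
Proof.
move=> oW Wy0 cg eps0.
have cD := ck_cont (ck_derive e cg) Wy0.
have [rho rho0 Hrho] : exists2 rho : R, 0 < rho & forall y, `|y0 - y| < rho ->
    W y /\ `|'D_e g y0 - 'D_e g y| <= eps.
  have nW : nbhs y0 W by exact: open_nbhs_nbhs.
  have /cvgrPdist_le /(_ _ eps0) nD := cD.
  have : nbhs y0 (W `&` [set y | `|'D_e g y0 - 'D_e g y| <= eps]) by exact: filterI.
  move=> /nbhs_ballP[r /= r0 Hr]; exists r => // y Hy.
  by apply: Hr; rewrite -ball_normE.
pose M : R := 1 + `|e|.
have M0 : 0 < M by rewrite /M ltr_pwDl.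
have M10 : 0 < M + 1 by exact: addr_gt0.
(* With [M = 1 + |e|] this keeps the whole segment within distance [rho] of [y0]. *)
exists (rho / (M + 1)); first by rewrite divr_gt0.
move=> y t Hy Ht.
have inr (s : R) : `|s| <= `|t| -> `|y0 - (s *: e + y)| < rho.
  move=> Hs; rewrite opprD addrCA.
  apply: le_lt_trans (ler_normD _ _) _; rewrite normrN normrZ.
  have : `|s| * `|e| <= `|t| * M.
    by apply: ler_pM => //; rewrite /M lerDr.
  move: Ht Hy; rewrite !(ltr_pdivlMr _ _ M10).
  have tM : 0 <= `|t| * M by rewrite mulr_ge0 // ltW.
  have -> : forall u : R, u * (M + 1) = u * M + u by move=> u; rewrite mulrDr mulr1.
  have := @normr_ge0 _ _ (y0 - y).
  move: (`|s| * `|e|) (`|t|) (`|y0 - y|) tM => u a b *.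
  nra.
pose phi := fun s : R => g (s *: e + y) : R.
have dphi (s : R) : `|s| <= `|t| ->
    is_derive (s : R^o) (1 : R^o) (phi : R^o -> R^o) ('D_e g (s *: e + y)).
  move=> /inr /Hrho [Ws _].
  have := ck_is_derive e cg Ws => /is_derive_line h.
  apply/is_derive_line; move: h; congr (is_derive _ _ _ _).
  by apply/funext => u; rewrite addrA -scalerDl [u *: 1]mulr1.
have cphi (a b : R) : (forall s, s \in `[a, b] -> `|s| <= `|t|) -> {within `[a, b], continuous phi}.
  move=> H; apply: derivable_within_continuous => s /H /dphi [] //.
have fin (s : R) : `|s| <= `|t| -> `|t * 'D_e g (s *: e + y) - t * 'D_e g y0| <= eps * `|t|.
  move=> /inr /Hrho [_ H].
  by rewrite -mulrBr normrM mulrC ler_wpM2r // distrC.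
have -> : g y = phi 0 by rewrite /phi scale0r add0r.
rewrite -[g (t *: e + y)]/(phi t).
have [t0|t0] := leP 0 t.
- have seg s : s \in `[0, t] -> `|s| <= `|t|.
    by rewrite in_itv /= => /andP[s0 st]; rewrite !ger0_norm.
  have [s sin ->] := MVT_segment t0 (fun s h => dphi s (seg s (subset_itv_oo_cc h))) (cphi _ _ seg).
  by rewrite subr0 mulrC; apply: fin; exact: seg.
- have seg s : s \in `[t, 0] -> `|s| <= `|t|.
    by rewrite in_itv /= => /andP[ts s0]; rewrite !ler0_norm ?lerN2 // ltW.
  have [s sin E] := MVT_segment (ltW t0) (fun s h => dphi s (seg s (subset_itv_oo_cc h))) (cphi _ _ seg).
  have -> : phi t - phi 0 = t * 'D_e g (s *: e + y) by rewrite -opprB E sub0r mulrN opprK mulrC.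
  by apply: fin; exact: seg.
Qed.

(** The base point [Y h] of the difference quotient moves with [h], so the uniform bound takes the
    place of derivability at a fixed point. *)
Lemma cvg_increment F (W : set F) (g : F -> R^o) y0 e (Y : R -> F) (tau : R -> R) (a : R) :
  open W -> W y0 -> ck 1 W g -> Y @ 0^' --> y0 ->
  (fun h : R => h^-1 * tau h) @ 0^' --> a ->
  (fun h : R => h^-1 * (g (tau h *: e + Y h) - g (Y h))) @ 0^' --> (a * 'D_e g y0 : R).
Proof.
move=> oW Wy0 cg cY ca.
have FF : Filter (0 : R)^' by exact: dnbhs_filter.
have ct : tau @ 0^' --> (0 : R).
  have ci : (fun h : R => h) @ 0^' --> (0 : R) by exact: cvg_within.
  have := @cvgM _ _ _ FF _ _ _ _ ci ca; rewrite mul0r.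
  apply: cvg_trans; apply: near_eq_cvg; near=> h => /=.
  have h0 : h != 0 by near: h; exact: nbhs_dnbhs_neq.
  by rewrite mulrA divff // mul1r.
have -> : (fun h : R => h^-1 * (g (tau h *: e + Y h) - g (Y h))) =
  (fun h : R => h^-1 * tau h * 'D_e g y0 + h^-1 * (g (tau h *: e + Y h) - g (Y h) - tau h * 'D_e g y0)).
  apply/funext => h; ring.
rewrite -[a * _]addr0; apply: cvgD.
  by apply: cvgM ca _; exact: cvg_cst.
apply/cvgr0Pnorm_le => eps eps0.
have a1 : 0 < `|a| + 1 by rewrite ltr_wpDl.
(* The quotient of [tau h] by [h] is eventually at most |a| + 1 in size, which fixes the
   tolerance. *)
have [del del0 H] := increment_bound e oW Wy0 cg (divr_gt0 eps0 a1).
near=> h.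

rewrite normrM.
have Yd : `|y0 - Y h| < del by near: h; exact: (cvgrPdist_lt _ _).1 cY _ del0.
have td : `|tau h| < del by near: h; exact: cvgr0_norm_lt ct _ del0.
have ad : `|a - h^-1 * tau h| <= 1 by near: h; exact: (cvgrPdist_le _ _).1 ca _ ltr01.
have ad' : `|h^-1| * `|tau h| <= `|a| + 1.
  rewrite -normrM -[h^-1 * _](subKr a).
  by apply: le_trans (ler_normB _ _) _; rewrite lerD2l.
apply: le_trans (ler_wpM2l (normr_ge0 _) (H _ _ Yd td)) _.
rewrite mulrCA; apply: le_trans (ler_wpM2l _ ad') _; first by rewrite divr_ge0 // ltW.
by rewrite divfK ?gt_eqF.
Unshelve. all: by end_near. Qed.

(** The increment of [f] is spent one coordinate at a time, and the increments of [g] telescope.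
    Only directional derivatives of [f] enter, no total differential. *)
Lemma chain_scalar_sum F (W : set F) (g : F -> R^o) y0 (I : finType) (e : I -> F)
    (l : I -> {linear F -> R^o}) :
  (forall i, continuous (l i)) -> (forall x, x = \sum_i l i x *: e i) ->
  open W -> W y0 -> ck 1 W g ->
  forall E (f : E -> F) x v d, f x = y0 -> is_derive x v f d ->
    is_derive x v (fun y => g (f y)) (\sum_i l i d * 'D_(e i) g y0).
Proof.
move=> cl Hl oW Wfx cg E' f' x' v' d'.
have FF : Filter (0 : R)^' by exact: dnbhs_filter.
  move=> fx' /derivable_cvg hf; apply: cvg_is_derive.
  pose D (h : R) := f' (h *: v' + x') - f' x'.
  have cD : D @ 0^' --> (0 : F).
    have ci : (fun h : R => h) @ 0^' --> (0 : R) by exact: cvg_within.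
    have := @cvgZ _ _ _ _ FF _ _ _ _ ci hf; rewrite scale0r.
    apply: cvg_trans; apply: near_eq_cvg; near=> h => /=.
    have h0 : h != 0 by near: h; exact: nbhs_dnbhs_neq.
    by rewrite /D scalerA divff // scale1r.
  have clD i : (fun h => l i (D h)) @ 0^' --> (0 : R).
    by have := cvg_comp _ _ cD (cl i 0); rewrite linear0; exact.
  (* Induction on the coordinates still to be spent; the moving base point [Y h] absorbs the others
     and still tends to [y0]. *)
  have part (r : seq I) (Y : R -> F) : Y @ 0^' --> y0 ->
      (fun h : R => h^-1 * (g (\sum_(i <- r) l i (D h) *: e i + Y h) - g (Y h))) @ 0^' -->
      (\sum_(i <- r) l i d' * 'D_(e i) g y0 : R).
    elim: r Y => [|i r IH] Y cY.
      rewrite big_nil; apply: cvg_trans (@cvg_cst _ (0 : R) _ _ FF).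
      by apply: near_eq_cvg; near=> h; rewrite big_nil add0r subrr mulr0.
    have cY' : (fun h => l i (D h) *: e i + Y h) @ 0^' --> y0.
      have := @cvgD _ _ _ _ FF _ _ _ _
        (@cvgZ _ _ _ _ FF _ _ _ _ (clD i) (@cvg_cst _ (e i) _ _ FF)) cY.
      by rewrite scale0r add0r.
    have h1 := IH _ cY'.
    have ca : (fun h : R => h^-1 * l i (D h)) @ 0^' --> (l i d' : R).
      have := cvg_comp _ _ hf (cl i d'); apply: cvg_trans; apply: near_eq_cvg.
      by near=> h; rewrite /= linearZ.
    have h2 := cvg_increment (e := e i) oW Wfx cg cY ca.
    rewrite big_cons addrC; have := @cvgD _ _ _ _ FF _ _ _ _ h1 h2.
    apply: cvg_trans; apply: near_eq_cvg; near=> h => /=.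
    rewrite !fctE big_cons -mulrDr addrA subrK; congr (_ * (g _ - _)).
    by rewrite addrCA addrA.
  have := part (index_enum I) (fun _ => f' x') _; rewrite fx'.
  move=> /(_ (@cvg_cst _ y0 _ _ FF)); rewrite -fx'; apply: cvg_trans.
  apply: near_eq_cvg; near=> h.
  by rewrite -[\sum_(i <- _) _](Hl (D h)) /D subrK.
Unshelve. all: by end_near. Qed.

(** The chain rule for the identity map writes the derivative as a sum over the coordinates of the
    direction, which is linear in the direction. *)
Lemma derive_scalar_linear F (W : set F) (g : F -> R^o) y (a : R) v w :
  findim F -> open W -> W y -> ck 1 W g ->
  'D_(a *: v + w) g y = a * 'D_v g y + 'D_w g y.
Proof.
move=> [I [e [l [cl Hl]]]] oW Wy cg.
have H d : 'D_d g y = \sum_i l i d * 'D_(e i) g y.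
  have [_ <-//] := chain_scalar_sum cl Hl oW Wy cg (erefl : id y = y) (is_derive_id y d).
rewrite !H mulr_sumr -big_split; apply: eq_bigr => i _.
by rewrite linearP mulrDl mulrA.
Qed.

Lemma chain_scalar E F (W : set F) (g : F -> R^o) (f : E -> F) x v d :
  findim F -> open W -> W (f x) -> ck 1 W g -> is_derive x v f d ->
  is_derive x v (fun y => g (f y)) ('D_d g (f x)).
Proof.
move=> [I [e [l [cl Hl]]]] oW Wfx cg hf.
have [_ ->] := chain_scalar_sum cl Hl oW Wfx cg (erefl : id (f x) = f x) (is_derive_id (f x) d).
exact: chain_scalar_sum cl Hl oW Wfx cg _ _ _ _ _ _ hf.
Qed.

Lemma findim_R : findim R^o.
Proof.
exists unit, (fun _ => 1 : R^o), (fun _ => [the {linear R^o -> R^o} of idfun]).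
split=> [i x|x]; first exact: cvg_id.
by rewrite big_const card_unit /= addr0 [_ *: _]mulr1.
Qed.

Lemma is_derive_bigsum E F (I : finType) (h : I -> E -> F) x v (d : I -> F) :
  (forall i, is_derive x v (h i) (d i)) ->
  is_derive x v (fun y => \sum_i h i y) (\sum_i d i).
Proof.
move=> H; elim: (index_enum I) => [|i r IH].
  have -> : (fun y => \sum_(i <- [::]) h i y) = (fun=> 0) by apply/funext => y; rewrite big_nil.
  by rewrite big_nil; exact: is_derive_cst.
have -> : (fun y => \sum_(j <- i :: r) h j y) = (fun y => h i y + \sum_(j <- r) h j y).
  by apply/funext => y; rewrite big_cons.
by rewrite big_cons; apply: is_deriveD.
Qed.

Lemma chain E F G (W : set F) (g : F -> G) (f : E -> F) x v d :
  findim F -> findim G -> open W -> W (f x) -> ck 1 W g -> is_derive x v f d ->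
  is_derive x v (fun y => g (f y)) ('D_d g (f x)).
Proof.
move=> fF [I [e [l [cl Hl]]]] oW Wfx cg hf.
have gE : g = fun y => \sum_i l i (g y) *: e i by apply/funext => y; exact: Hl.
have cli i : ck 1 W (fun y => l i (g y)) by exact: ck_comp_lin.
have h1 : is_derive x v (fun y => \sum_i l i (g (f y)) *: e i)
    (\sum_i 'D_d (fun y => l i (g y)) (f x) *: e i).
  apply: is_derive_bigsum => i.
  have := is_derive_scale (chain_scalar fF oW Wfx (cli i) hf) (is_derive_cst (e i) x v).
  by rewrite scaler0 addr0.
have h2 : is_derive (f x) d (fun y => \sum_i l i (g y) *: e i)
    (\sum_i 'D_d (fun y => l i (g y)) (f x) *: e i).
  apply: is_derive_bigsum => i.
  have := is_derive_scale (ck_is_derive d (cli i) Wfx) (is_derive_cst (e i) (f x) d).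
  by rewrite scaler0 addr0.
move: h2; rewrite -gE => -[_ ->].
by have -> : (fun y => g (f y)) = (fun y => \sum_i l i (g (f y)) *: e i)
  by apply/funext => y; exact: Hl.
Qed.

Lemma derive_linear F G (W : set F) (g : F -> G) y (a : R) v w :
  findim F -> findim G -> open W -> W y -> ck 1 W g ->
  'D_(a *: v + w) g y = a *: 'D_v g y + 'D_w g y.
Proof.
move=> fF [I [e [l [cl Hl]]]] oW Wy cg.
have gE : g = fun y => \sum_i l i (g y) *: e i by apply/funext => z; exact: Hl.
have cli i : ck 1 W (fun y => l i (g y)) by exact: ck_comp_lin.
have H d : 'D_d g y = \sum_i 'D_d (fun y => l i (g y)) y *: e i.
  suff : is_derive y d (fun y => \sum_i l i (g y) *: e i)
      (\sum_i 'D_d (fun y => l i (g y)) y *: e i) by rewrite -gE => -[_ ->].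
  apply: is_derive_bigsum => i.
  have := is_derive_scale (ck_is_derive d (cli i) Wy) (is_derive_cst (e i) y d).
  by rewrite scaler0 addr0.
rewrite !H scaler_sumr -big_split; apply: eq_bigr => i _.
by rewrite (derive_scalar_linear _ _ _ fF oW Wy (cli i)) scalerDl scalerA.
Qed.

Lemma derive_sum_coord F G (W : set F) (g : F -> G) y (I : finType) (e : I -> F) (a : I -> R) :
  findim F -> findim G -> open W -> W y -> ck 1 W g ->
  'D_(\sum_i a i *: e i) g y = \sum_i a i *: 'D_(e i) g y.
Proof.
move=> fF fG oW Wy cg.
elim/big_rec2: _ => [|i u v _ IH]; first by rewrite derive0.
by rewrite (derive_linear _ _ _ fF fG oW Wy cg) IH.
Qed.

Lemma ck_bigsum E F k (V : set E) (I : finType) (h : I -> E -> F) : open V ->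
  (forall i, ck k V (h i)) -> ck k V (fun y => \sum_i h i y).
Proof.
move=> oV H; elim: (index_enum I) => [|i r IH].
  have -> : (fun y => \sum_(i <- [::]) h i y) = (fun=> 0) by apply/funext => y; rewrite big_nil.
  exact: ck_cst.
have -> : (fun y => \sum_(j <- i :: r) h j y) = (fun y => h i y + \sum_(j <- r) h j y).
  by apply/funext => y; rewrite big_cons.
exact: ckD.
Qed.

(** Induction on [k]: the derivative is a finite sum of coordinates of the derivative of [f], each
    times a partial derivative of [g] composed with [f], which is again a composition. *)
Lemma ck_comp E F G k (V : set E) (W : set F) (f : E -> F) (g : F -> G) :
  findim F -> findim G -> open V -> open W -> (forall x, V x -> W (f x)) ->
  ck k V f -> ck k W g -> ck k V (fun x => g (f x)).
Proof.
move=> fF fG oV oW VW; elim: k g => [|k IH] g cf cg.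
  split=> // x Vx; apply: continuous_comp; first exact: ck_cont cf Vx.
  exact: ck_cont cg (VW _ Vx).
have [I [e [l [cl Hl]]]] := fF.
have cg1 : ck 1 W g.
  by elim: k cg {IH cf} => // k IH /ckS.
apply: (@ck_step _ _ _ _ _ (fun v x => \sum_i l i ('D_v f x) *: 'D_(e i) g (f x))) => //.
- move=> x Vx; apply: continuous_comp; first exact: ck_cont cf Vx.
  exact: ck_cont cg (VW _ Vx).
- move=> x v Vx; rewrite -(derive_sum_coord _ _ fF fG oW (VW _ Vx) cg1) -Hl.
  exact: (chain fF fG oW (VW _ Vx) cg1) (ck_is_derive v cf Vx).
- move=> v; apply: ck_bigsum => // i; apply: ckZ => //.
    by apply: ck_comp_lin => //; exact: ck_derive.
  by apply: (IH (fun y => 'D_(e i) g y)); [exact: ckS|exact: ck_derive].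
Qed.

Definition linfn E F (f : E -> F) (Hf : linear f) : {linear E -> F} :=
  HB.pack f (GRing.isLinear.Build _ _ _ _ f Hf).

Lemma findim_mx m n : findim 'M[R]_(m, n).
Proof.
have lin (p : 'I_m * 'I_n) : linear (fun A : 'M[R]_(m, n) => A p.1 p.2 : R^o).
  by move=> a u v; rewrite !mxE.
exists ('I_m * 'I_n)%type, (fun p => delta_mx p.1 p.2), (fun p => linfn (lin p)).
split=> [p|x]; first exact: coord_continuous.
by rewrite [LHS]matrix_sum_delta pair_bigA.
Qed.

Lemma findim_prod E F : findim E -> findim F -> findim (E * F)%type.
Proof.
move=> [I [e [l [cl Hl]]]] [J [e' [l' [cl' Hl']]]].
have lin1 i : linear (fun x : (E * F)%type => l i x.1) by move=> a u v; exact: linearP.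
have lin2 i : linear (fun x : (E * F)%type => l' i x.2) by move=> a u v; exact: linearP.
exists (I + J)%type, (fun k => match k with inl i => (e i, 0) | inr j => (0, e' j) end),
  (fun k => match k with inl i => linfn (lin1 i) | inr j => linfn (lin2 j) end).
split=> [[i|j] x|[x y]].
- by apply: continuous_comp; [exact: cvg_fst|exact: cl].
- by apply: continuous_comp; [exact: cvg_snd|exact: cl'].
rewrite big_sumType /=.
have -> : \sum_i l i x *: (e i, 0 : F) = (x, 0).
  rewrite [in RHS](Hl x); elim/big_rec2: _ => // i a b _ ->.
  by congr pair; rewrite /= ?scaler0 ?addr0.
have -> : \sum_i l' i y *: (0 : E, e' i) = (0, y).
  rewrite [in RHS](Hl' y); elim/big_rec2: _ => // i a b _ ->.
  by congr pair; rewrite /= ?scaler0 ?addr0.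
by congr pair; rewrite /= ?addr0 ?add0r.
Qed.

Lemma linear_continuous_findim E F (f : E -> F) : findim E -> linear f -> continuous f.
Proof.
move=> [I [e [l [cl Hl]]]] lf.
have -> : f = fun x => \sum_i l i x *: f (e i).
  apply/funext => x; rewrite [in LHS](Hl x) -[f]/(linfn lf : E -> F) linear_sum.
  by apply: eq_bigr => i _; rewrite linearZ.
have : ck 0 setT (fun x => \sum_i l i x *: f (e i)).
  apply: ck_bigsum; first exact: openT.
  move=> i; apply: ckZ; [exact: openT| exact: ck_lin|exact: ck_cst].
by move=> h x; exact: ck_cont h _.
Qed.

Lemma smooth_sub E F (V V' : set E) (f : E -> F) : V' `<=` V ->
  smooth_open V f -> smooth_open V' f.
Proof. by move=> H h k; exact: ck_sub H (h k). Qed.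

Lemma smooth_continuous E F (V : set E) (f : E -> F) x : smooth_open V f -> V x ->
  {for x, continuous f}.
Proof. by move=> h; exact: ck_cont (h 0%N). Qed.

Lemma smooth_is_derive E F (V : set E) (f : E -> F) x v : smooth_open V f -> V x ->
  is_derive x v f ('D_v f x).
Proof. by move=> h; exact: ck_is_derive (h 1%N). Qed.

Lemma smooth_cst E F (V : set E) (a : F) : smooth_open V (fun _ => a).
Proof. by move=> k; exact: ck_cst. Qed.

Lemma smooth_lin E F (V : set E) (f : E -> F) : findim E -> linear f -> smooth_open V f.
Proof.
by move=> fE lf k; apply: (@ck_lin _ _ _ _ (linfn lf)); exact: linear_continuous_findim.
Qed.

Lemma smooth_id E (V : set E) : findim E -> smooth_open V (fun x => x).
Proof. by move=> fE; exact: smooth_lin. Qed.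

Lemma smooth_comp_lin E F G (V : set E) (f : F -> G) (g : E -> F) :
  findim F -> linear f -> open V -> smooth_open V g -> smooth_open V (fun x => f (g x)).
Proof.
move=> fE lf oV cg k.
by apply: (@ck_comp_lin _ _ _ _ _ _ (linfn lf)) => //; exact: linear_continuous_findim.
Qed.

Lemma smoothD E F (V : set E) (f g : E -> F) : open V ->
  smooth_open V f -> smooth_open V g -> smooth_open V (fun x => f x + g x).
Proof. by move=> oV hf hg k; exact: ckD. Qed.

Lemma smoothZ E F (V : set E) (a : E -> R^o) (f : E -> F) : open V ->
  smooth_open V a -> smooth_open V f -> smooth_open V (fun x => a x *: f x).
Proof. by move=> oV hf hg k; exact: ckZ. Qed.

Lemma smoothN E F (V : set E) (f : E -> F) : open V ->
  smooth_open V f -> smooth_open V (fun x => - f x).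
Proof.
move=> oV hf; have -> : (fun x => - f x) = (fun x => (-1 : R^o) *: f x).
  by apply/funext => x; rewrite scaleN1r.
by apply: smoothZ => //; exact: smooth_cst.
Qed.

Lemma smoothB E F (V : set E) (f g : E -> F) : open V ->
  smooth_open V f -> smooth_open V g -> smooth_open V (fun x => f x - g x).
Proof. by move=> oV hf hg; apply: smoothD => //; exact: smoothN. Qed.

Lemma smoothM E (V : set E) (f g : E -> R^o) : open V ->
  smooth_open V f -> smooth_open V g -> smooth_open V (fun x => f x * g x : R^o).
Proof. exact: smoothZ. Qed.

Lemma smoothV E (V : set E) (f : E -> R^o) : open V -> (forall x, V x -> f x != 0) ->
  smooth_open V f -> smooth_open V (fun x => (f x)^-1 : R^o).
Proof. by move=> oV f0 hf k; exact: ckV. Qed.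

Lemma smooth_sqrt E (V : set E) (f : E -> R^o) : open V -> (forall x, V x -> 0 < f x) ->
  smooth_open V f -> smooth_open V (fun x => Num.sqrt (f x) : R^o).
Proof. by move=> oV f0 hf k; exact: ck_sqrt. Qed.

Lemma smoothX E (V : set E) (f : E -> R^o) n : open V ->
  smooth_open V f -> smooth_open V (fun x => f x ^+ n : R^o).
Proof.
move=> oV hf; elim: n => [|n IH]; first exact: smooth_cst.
have -> : (fun x => f x ^+ n.+1 : R^o) = (fun x => f x * f x ^+ n).
  by apply/funext => x; rewrite exprS.
exact: smoothM.
Qed.

Lemma smooth_sum E F (V : set E) (I : finType) (h : I -> E -> F) : open V ->
  (forall i, smooth_open V (h i)) -> smooth_open V (fun y => \sum_i h i y).
Proof. by move=> oV H k; apply: ck_bigsum => // i; exact: H. Qed.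

Lemma smooth_entry E m n (V : set E) (f : E -> 'M[R]_(m, n)) i j : open V ->
  smooth_open V f -> smooth_open V (fun x => f x i j : R^o).
Proof.
apply: (@smooth_comp_lin _ _ _ _ (fun A : 'M[R]_(m, n) => A i j : R^o)).
- exact: findim_mx.
- by move=> a u v; rewrite !mxE.
Qed.

Lemma smooth_mx E m n (V : set E) (f : E -> 'M[R]_(m, n)) : open V ->
  (forall i j, smooth_open V (fun x => f x i j : R^o)) -> smooth_open V f.
Proof.
move=> oV H.
have -> : f = fun x => \sum_(p : 'I_m * 'I_n) (f x p.1 p.2 : R^o) *: delta_mx p.1 p.2.
  by apply/funext => x; rewrite [LHS]matrix_sum_delta pair_bigA.
apply: (@smooth_sum _ _ _ _ (fun p x => (f x p.1 p.2 : R^o) *: delta_mx p.1 p.2)) => // p.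
by apply: (@smoothZ _ _ V (fun x => f x p.1 p.2 : R^o)) => //; exact: smooth_cst.
Qed.

Lemma smooth_mulmx E m n p (V : set E) (f : E -> 'M[R]_(m, n)) (g : E -> 'M[R]_(n, p)) :
  open V -> smooth_open V f -> smooth_open V g -> smooth_open V (fun x => f x *m g x).
Proof.
move=> oV hf hg; apply: smooth_mx => // i j.
have -> : (fun x => (f x *m g x) i j : R^o) = (fun x => \sum_k (f x i k * g x k j) : R^o).
  by apply/funext => x; rewrite mxE.
by apply: smooth_sum => // k; apply: smoothM => //; exact: smooth_entry.
Qed.

Lemma smooth_trmx E m n (V : set E) (f : E -> 'M[R]_(m, n)) :
  open V -> smooth_open V f -> smooth_open V (fun x => (f x)^T).
Proof.
apply: (@smooth_comp_lin _ _ _ _ (@trmx R m n)); first exact: findim_mx.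
by move=> a u v; rewrite linearP.
Qed.

Lemma smooth_tr E n (V : set E) (f : E -> 'M[R]_n) :
  open V -> smooth_open V f -> smooth_open V (fun x => \tr (f x) : R^o).
Proof.
apply: (@smooth_comp_lin _ _ _ _ (@mxtrace R n : 'M[R]_n -> R^o)); first exact: findim_mx.
by move=> a u v; rewrite linearP.
Qed.

Lemma smooth_pair E F G (V : set E) (f : E -> F) (g : E -> G) :
  findim F -> findim G -> open V ->
  smooth_open V f -> smooth_open V g -> smooth_open V (fun x => (f x, g x)).
Proof.
move=> fF fG oV hf hg.
have -> : (fun x => (f x, g x)) = (fun x => (f x, 0) + (0, g x)).
  by apply/funext => x; congr pair; rewrite /= ?addr0 ?add0r.
apply: smoothD => //.
  apply: (@smooth_comp_lin _ _ _ _ (fun y : F => (y, 0 : G))) => //.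
  by move=> a u v; congr pair; rewrite /= scaler0 addr0.
apply: (@smooth_comp_lin _ _ _ _ (fun y : G => (0 : F, y))) => //.
by move=> a u v; congr pair; rewrite /= scaler0 addr0.
Qed.

Lemma smooth_fst E F G (V : set E) (f : E -> (F * G)%type) :
  findim F -> findim G -> open V -> smooth_open V f -> smooth_open V (fun x => (f x).1).
Proof.
move=> fF fG; apply: (@smooth_comp_lin _ _ _ _ fst) => //; exact: findim_prod.
Qed.

Lemma smooth_snd E F G (V : set E) (f : E -> (F * G)%type) :
  findim F -> findim G -> open V -> smooth_open V f -> smooth_open V (fun x => (f x).2).
Proof.
move=> fF fG; apply: (@smooth_comp_lin _ _ _ _ snd) => //; exact: findim_prod.
Qed.

Lemma smooth_comp E F G (V : set E) (W : set F) (f : E -> F) (g : F -> G) :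
  findim F -> findim G -> open V -> open W -> (forall x, V x -> W (f x)) ->
  smooth_open V f -> smooth_open W g -> smooth_open V (fun x => g (f x)).
Proof. by move=> fF fG oV oW VW hf hg k; exact: (ck_comp (W := W)). Qed.

Lemma preimage_open E F (V : set E) (W : set F) (f : E -> F) : open V -> open W ->
  (forall x, V x -> {for x, continuous f}) -> open (V `&` f @^-1` W).
Proof.
move=> oV oW cf; rewrite openE => x [Vx Wfx].
apply: filterI; first exact: open_nbhs_nbhs.
by apply: cf => //; exact: open_nbhs_nbhs.
Qed.

Lemma smooth_on_open E F (S V : set E) (f : E -> F) : open V -> S `<=` V ->
  smooth_open V f -> smooth_on S f.
Proof. by move=> oV SV hf p Sp; exists V, f; split=> //; exact: SV. Qed.

Lemma smooth_on_sub E F (S S' : set E) (f : E -> F) : S' `<=` S ->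
  smooth_on S f -> smooth_on S' f.
Proof.
move=> SS h p /SS Sp; have [V [g [oV Vp sg H]]] := h p Sp.
by exists V, g; split=> // x /SS; exact: H.
Qed.

Lemma smooth_on_comp E F G (S : set E) (T : set F) (f : E -> F) (g : F -> G) :
  findim F -> findim G -> (forall x, S x -> T (f x)) ->
  smooth_on S f -> smooth_on T g -> smooth_on S (fun x => g (f x)).
Proof.
move=> fF fG ST hf hg p Sp.
have [V [f' [oV Vp sf Hf]]] := hf p Sp.
have [W [g' [oW Wp sg Hg]]] := hg _ (ST _ Sp).
have oVW : open (V `&` f' @^-1` W).
  by apply: preimage_open => // x; exact: smooth_continuous.
exists (V `&` f' @^-1` W), (fun x => g' (f' x)); split=> //.
- by split=> //=; rewrite -Hf.
- apply: (smooth_comp fF fG oVW oW _ _ sg) => [x []//|].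
  by apply: smooth_sub sf => x [].
- by move=> x Sx [Vx /= Wx]; rewrite Hf // Hg // -Hf //; exact: ST.
Qed.

Lemma diffeo_sub E F (S : set E) (T : set F) f g (S' : set E) (T' : set F) :
  diffeo S T f g -> S' `<=` S -> T' `<=` T -> (forall x, S' x -> T' (f x)) ->
  (forall y, T' y -> S' (g y)) -> diffeo S' T' f g.
Proof.
move=> [[h1 h2] sf sg] SS TT a b; split.
- by split=> x Sx; split; [exact: a|by case: (h1 _ (SS _ Sx))|exact: b|by case: (h2 _ (TT _ Sx))].
- exact: smooth_on_sub sf.
- exact: smooth_on_sub sg.
Qed.

Lemma diffeo_comp E F G (S : set E) (T : set F) (U : set G) f g f' g' :
  findim E -> findim F -> findim G ->
  diffeo S T f g -> diffeo T U f' g' -> diffeo S U (fun x => f' (f x)) (fun y => g (g' y)).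
Proof.
move=> fE fF fG [[h1 h2] sf sg] [[h1' h2'] sf' sg']; split.
- split=> x Sx.
    by have [a b] := h1 _ Sx; have [c d] := h1' _ a; rewrite d.
  by have [a b] := h2' _ Sx; have [c d] := h2 _ a; rewrite d.
- by apply: (smooth_on_comp (T := T)) => // x /h1 [].
- by apply: (smooth_on_comp (T := T)) => // x /h2' [].
Qed.

Lemma smooth_on_continuous E F (S : set E) (f : E -> F) : open S ->
  smooth_on S f -> forall x, S x -> {for x, continuous f}.
Proof.
move=> oS h x Sx; have [V [g [oV Vp sg H]]] := h x Sx.
apply: (near_continuous (V := S `&` V)) (smooth_continuous sg Vp).
- exact: openI.
- by [].
- by move=> y [Sy Vy]; rewrite H.
Qed.

Lemma submanifold_diffeo E F k (S : set E) (T : set F) f g :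
  findim E -> findim F -> diffeo S T f g -> submanifold k T -> submanifold k S.
Proof.
move=> fE fF D sT p Sp.
have [[h1 h2] sf sg] := D.
have [V [W [oV Vp oW [a [b [[ab ba] sa sb]]]]]] := sT _ (h1 p Sp).1.
have [U [f' [oU Up sf' Hf]]] := sf p Sp.
have oUV : open (U `&` f' @^-1` V) by apply: preimage_open => // x; exact: smooth_continuous.
(* Shrinking [W] keeps [g (b w)] in the set [U] on which [f] agrees with the smooth map [f']. *)
pose W' := W `&` (fun w => g (b w)) @^-1` U.
have sgb : smooth_on W (fun w => g (b w)).
  apply: (smooth_on_comp (T := T)) => //.
    by move=> w /ba [[]].
have oW' : open W'.
  by apply: preimage_open => // w; exact: smooth_on_continuous sgb _.
exists (U `&` f' @^-1` V), W'; split=> //.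
  by split=> //=; rewrite -Hf.
exists (fun x => a (f x)), (fun w => g (b w)).
apply: (@diffeo_comp _ _ _ _ (T `&` V `&` g @^-1` U)) => //; first exact: findim_mx.
- apply: diffeo_sub D _ _ _ _.
  + by move=> x [].
  + by move=> x [[]].
  + move=> x [Sx [Ux /= Vx]]; have [Tfx gfx] := h1 _ Sx.
    by split; [split=> //; rewrite Hf|rewrite /= gfx].
  + move=> y [[Ty Vy] /= Ugy]; have [Sgy fgy] := h2 _ Ty.
    by split=> //; split=> //=; rewrite -Hf // fgy.
- apply: (@diffeo_sub _ _ (T `&` V) W) => //.
  + by move=> x [].
  + by move=> y [Ty Uy]; have [Wa ba'] := ab _ Ty; split=> //=; rewrite ba'.
  + by move=> w [Ww Uw]; have [Ta _] := ba _ Ww; split.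
Qed.

Lemma submanifold_open E k (S O : set E) : findim E -> open O -> submanifold k S ->
  submanifold k (S `&` O).
Proof.
move=> fE oO sS p [Sp Op].
have [V [W [oV Vp oW [a [b D]]]]] := sS _ Sp.
have [[ab ba] sa sb] := D.
pose W' := W `&` b @^-1` O.
have oW' : open W'.
  by apply: preimage_open => // w; exact: smooth_on_continuous sb _.
exists V, W'; split=> //; exists a, b.
apply: diffeo_sub D _ _ _ _.
- by move=> x [[]].
- by move=> w [].
- by move=> y [[Sy Oy] Vy]; have [|Wa ba'] := ab y; first by []; split=> //=; rewrite ba'.
- by move=> w [Ww Ow]; have [[? ?] _] := ba _ Ww; split.
Qed.

Lemma submanifold_open_full n (O : set 'rV[R]_n) : open O -> submanifold n O.
Proof.
move=> oO p Op; exists setT, O; split=> //; first exact: openT.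
exists id, id; split.
- by split=> x; [move=> []|].
- by apply: (smooth_on_open openT) => //; apply: smooth_id; exact: findim_mx.
- by apply: (smooth_on_open openT) => //; apply: smooth_id; exact: findim_mx.
Qed.

(** At a smooth point a velocity is the image, under the derivative of the inverse chart, of a
    velocity in R^k; there velocities add, and a straight line realizes the sum. The failure of this
    property detects the singular point of a fibre. *)
Lemma tangentD E k (S : set E) p u v : findim E -> smooth_points k S p ->
  tangent S p u -> tangent S p v -> tangent S p (u + v).
Proof.
move=> fE [Sp [V0 [oV0 V0p sub]]] tu tv.
have [V [W [oV Vp oW [f [g [[fg gf] sf sg]]]]]] := sub p (conj Sp V0p).
pose S' := S `&` V0 `&` V.
have S'p : S' p by [].
have [U [f' [oU Up sf' Hf]]] := sf _ S'p.
have [Wfp gfp] := fg _ S'p.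
have [U2 [g' [oU2 U2p sg' Hg]]] := sg _ Wfp.
have fp : f p = f' p by exact: Hf.
have fW : findim 'rV[R]_k by exact: findim_mx.
(* Along the curve [g'] after [f'] is the identity, so the derivative of [g'] in the direction of
   the velocity in the chart gives [w] back. *)
have lift w : tangent S p w -> exists d, is_derive (f p) d g' w.
  move=> [I [gam [oI I0 sgam Sgam [gam0 dgam]]]].
  pose J := I `&` gam @^-1` (V0 `&` V `&` U).
  have oJ : open J.
    by apply: preimage_open => //; [exact: openI (openI _ _) _|move=> x; exact: smooth_continuous].
  have J0 : J 0 by split; rewrite //= gam0.
  have S'gam t : J t -> S' (gam t).
    by move=> [It [[a b] c]]; split=> //; split=> //; exact: Sgam.
  have Wfg t : J t -> f (gam t) = f' (gam t).
    by move=> Jt; apply: Hf; [exact: S'gam|by case: Jt => _ []].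
  have Uf' : U (gam 0) by rewrite gam0.
  pose d := 'D_w f' p; exists d.
  have d1 : is_derive (0 : R^o) (1 : R^o) (fun t => f' (gam t)) d.
    rewrite /d -gam0; exact: (chain fE fW oU Uf' (sf' 1%N) dgam).
  have U2f' : U2 (f' (gam 0)) by rewrite gam0 -fp.
  have d2 := chain fW fE oU2 U2f' (sg' 1%N) d1.
  have d3 : is_derive (0 : R^o) (1 : R^o) (fun t => g' (f' (gam t))) w.
    pose J' := J `&` (fun t => f' (gam t)) @^-1` U2.
    have oJ' : open J'.
      apply: preimage_open => // t Jt; apply: continuous_comp.
        by apply: smooth_continuous sgam _; case: Jt.
      by apply: smooth_continuous sf' _; case: Jt => _ [].
    apply: (near_is_derive (V := J') (f := gam)) => //.
    move=> t [Jt U2t]; have [Wt gt] := fg _ (S'gam _ Jt).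
    by rewrite -(Wfg _ Jt) -Hg ?gt // Wfg.
  move: d2 d3 => -[_ d2] [_]; rewrite d2 => <-.
  by rewrite gam0 -fp; exact: smooth_is_derive sg' U2p.
have [d1 [_ e1]] := lift _ tu.
have [d2 [_ e2]] := lift _ tv.
have d12 : is_derive (f p) (d1 + d2) g' (u + v).
  rewrite -e1 -e2.
  have := derive_linear 1 d1 d2 fW fE oU2 U2p (sg' 1%N); rewrite !scale1r => <-.
  exact: smooth_is_derive sg' U2p.
pose I : set R^o := (fun t : R^o => t *: (d1 + d2) + f p) @^-1` (W `&` U2).
have sl (X : set R^o) : smooth_open X (fun t : R^o => t *: (d1 + d2) + f p).
  move=> k'; apply: (@ck_sub _ _ _ setT) => //; apply: ckD; first exact: openT.
    by apply: ckZ; [exact: openT|exact: smooth_id findim_R _|exact: ck_cst].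
  exact: ck_cst.
have oI : open I.
  rewrite -[I]setTI; apply: preimage_open; [exact: openT|exact: openI|].
  by move=> x _; exact: smooth_continuous (sl setT) _.
exists I, (fun t => g' (t *: (d1 + d2) + f p)); split=> //.
- by rewrite /I /= scale0r add0r.
- apply: (smooth_comp fW fE oI oU2) (sl _) sg'.
  by move=> x [].
- by move=> t [Wt Ut]; rewrite -Hg //; have [[[]]] := gf _ Wt.
- split; first by rewrite scale0r add0r -Hg.
  exact: (is_derive_line g' (f p) (d1 + d2) (u + v)).1.
Qed.

End Calculus.

(** * Anti-self-dual forms and oriented coframes *)

Section Determinants.
Variable R : comNzRingType.

(** Laplace expansion along the first row over indices in [nat]: on explicit entries it reduces to a
    polynomial that [ring] can treat. *)
Fixpoint ndet n (f : nat -> nat -> R) : R :=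
  if n is n'.+1 then
    foldr (fun j acc => (let t := f 0%N j * ndet n' (fun i k => f i.+1 (bump j k)) in
                         if odd j then - t else t) + acc) 0 (iota 0 n)
  else 1.

Definition mxn m n (f : nat -> nat -> R) : 'M[R]_(m, n) := \matrix_(i, j) f i j.

Lemma det_mxn n f : \det (mxn n n f) = ndet n f.
Proof.
elim: n f => [|n IH] f; first by rewrite det_mx00.
rewrite (expand_det_row _ ord0) /=.
have -> : (f 0%N 0%N * ndet n (fun i k => f i.+1 (bump 0 k)) +
  foldr (fun j acc => (if odd j then - (f 0%N j * ndet n (fun i k => f i.+1 (bump j k))) else
    (f 0%N j * ndet n (fun i k => f i.+1 (bump j k)))) + acc) 0 (iota 1 n)) =
  \sum_(j <- iota 0 n.+1) (-1) ^+ odd j * (f 0%N j * ndet n (fun i k => f i.+1 (bump j k))).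
  rewrite -[iota 0 n.+1]/(0%N :: iota 1 n) big_cons /= mul1r; congr (_ + _).
  elim: (iota 1 n) => [|j s IHs]; first by rewrite big_nil.
  by rewrite big_cons /= -IHs; case: (odd j); rewrite ?mul1r // expr1 mulN1r.
have -> : iota 0 n.+1 = index_iota 0 n.+1 by rewrite /index_iota subn0.
rewrite big_mkord.
apply: eq_bigr => j _.
rewrite /cofactor !mxE -IH add0n signr_odd mulrCA; congr (_ * (_ * \det _)).
by apply/matrixP => i k; rewrite !mxE.
Qed.

Lemma mxn_eta m n (A : 'M[R]_(m.+1, n.+1)) : A = mxn m.+1 n.+1 (fun i j => A (inord i) (inord j)).
Proof. by apply/matrixP => i j; rewrite mxE !inord_val. Qed.

Definition mxl m n (s : seq (seq R)) : 'M[R]_(m, n) := mxn m n (fun i j => nth 0 (nth [::] s i) j).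

End Determinants.

(** * Invariance of the anti-self-dual forms under SO(4) *)

Section ASD.
Variable R : realType.

(** The coefficient matrix of [Omega k b] in the coframe [b]. The three matrices span the
    anti-self-dual half of so(4) and multiply like the imaginary quaternions. *)
Definition Oh (k : nat) : 'M[R]_4 :=
  match k with
  | 0 => mxl 4 4 [:: [:: 0; 1; 0; 0]; [:: -1; 0; 0; 0]; [:: 0; 0; 0; -1]; [:: 0; 0; 1; 0]]
  | 1 => mxl 4 4 [:: [:: 0; 0; 1; 0]; [:: 0; 0; 0; 1]; [:: -1; 0; 0; 0]; [:: 0; -1; 0; 0]]
  | _ => mxl 4 4 [:: [:: 0; 0; 0; 1]; [:: 0; 0; -1; 0]; [:: 0; 1; 0; 0]; [:: -1; 0; 0; 0]]
  end.

Lemma wedge_rowE (b : 'M[R]_(4, 5)) i j :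
  wedge_row b i j = b^T *m (delta_mx i j - delta_mx j i) *m b.
Proof.
rewrite /wedge_row !rowE !trmx_mul !trmx_delta mulmxBr mulmxBl !mulmxA.
by rewrite -(mulmxA b^T _ (delta_mx 0 j)) -(mulmxA b^T _ (delta_mx 0 i)) !mul_delta_mx.
Qed.

Lemma OmegaE k (b : 'M[R]_(4, 5)) : Omega k b = b^T *m Oh k *m b.
Proof.
case: k => [[|[|[|k]]] hk] //; rewrite /Omega /= !wedge_rowE -mulmxBl -mulmxBr;
  congr (_ *m _ *m _);
  apply/matrixP => -[[|[|[|[|i]]]] hi] // [[|[|[|[|j]]]] hj] //;
  rewrite !mxE -!val_eqE /= ?subr0 ?sub0r ?opprB ?subr0 ?oppr0 // ?addr0 ?opprK //.
Qed.

(** The inverse is both the transpose and, as the determinant is 1, the adjugate. Each row thus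
    consists of signed minors of the remaining ones. *)
Lemma orth_adj n (A : 'M[R]_n) : A *m A^T = 1%:M -> \det A = 1 -> forall i j, cofactor A i j = A i j.
Proof.
move=> AA dA i j.
have AA' : A^T *m A = 1%:M by apply: mulmx1C.
have : A^T = \adj A.
  by rewrite -[RHS]mul1mx -AA' -mulmxA mul_mx_adj dA mulmx1.
by move/matrixP => /(_ j i); rewrite !mxE.
Qed.

(** The Hodge star in R^4: [t] is a vector product of [p], [q], [s], so the bivectors of (p, q) and
    of (s, t) have complementary coefficients. *)
Lemma compl_minors (p0 p1 p2 p3 q0 q1 q2 q3 s0 s1 s2 s3 t0 t1 t2 t3 : R) :
  s0^+2 + s1^+2 + s2^+2 + s3^+2 = 1 ->
  s0 * p0 + s1 * p1 + s2 * p2 + s3 * p3 = 0 ->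
  s0 * q0 + s1 * q1 + s2 * q2 + s3 * q3 = 0 ->
  t0 = - (p1 * (q2 * s3 - q3 * s2) - p2 * (q1 * s3 - q3 * s1) + p3 * (q1 * s2 - q2 * s1)) ->
  t1 = p0 * (q2 * s3 - q3 * s2) - p2 * (q0 * s3 - q3 * s0) + p3 * (q0 * s2 - q2 * s0) ->
  t2 = - (p0 * (q1 * s3 - q3 * s1) - p1 * (q0 * s3 - q3 * s0) + p3 * (q0 * s1 - q1 * s0)) ->
  t3 = p0 * (q1 * s2 - q2 * s1) - p1 * (q0 * s2 - q2 * s0) + p2 * (q0 * s1 - q1 * s0) ->
  [/\ s2 * t3 - s3 * t2 = p0 * q1 - p1 * q0, s0 * t1 - s1 * t0 = p2 * q3 - p3 * q2,
      s3 * t1 - s1 * t3 = p0 * q2 - p2 * q0 &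
   [/\ s0 * t2 - s2 * t0 = p3 * q1 - p1 * q3, s1 * t2 - s2 * t1 = p0 * q3 - p3 * q0 &
      s0 * t3 - s3 * t0 = p1 * q2 - p2 * q1]].
Proof.
move=> ss sp sq -> -> -> ->.
(* Each identity is a combination of the three relations; [w], [a] and [b] are their
   coefficients. *)
have key (w a b x y : R) : x = w * (s0^+2 + s1^+2 + s2^+2 + s3^+2)
    + a * (s0 * p0 + s1 * p1 + s2 * p2 + s3 * p3)
    + b * (s0 * q0 + s1 * q1 + s2 * q2 + s3 * q3) -> w = y -> x = y.
  by move=> -> ->; rewrite ss sp sq !mulr0 !addr0 mulr1.
split; last split.
- apply: (key _ (s1 * q0 - s0 * q1) (s0 * p1 - s1 * p0) _ _ _ erefl); ring.
- apply: (key _ (s3 * q2 - s2 * q3) (s2 * p3 - s3 * p2) _ _ _ erefl); ring.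
- apply: (key _ (s2 * q0 - s0 * q2) (s0 * p2 - s2 * p0) _ _ _ erefl); ring.
- apply: (key _ (s1 * q3 - s3 * q1) (s3 * p1 - s1 * p3) _ _ _ erefl); ring.
- apply: (key _ (s3 * q0 - s0 * q3) (s0 * p3 - s3 * p0) _ _ _ erefl); ring.
- apply: (key _ (s2 * q1 - s1 * q2) (s1 * p2 - s2 * p1) _ _ _ erefl); ring.
Qed.

Lemma cofactor_mxn n (f : nat -> nat -> R) (i j : 'I_n.+1) :
  cofactor (mxn n.+1 n.+1 f) i j =
  (-1) ^+ (i + j) * ndet n (fun a b => f (bump i a) (bump j b)).
Proof.
rewrite /cofactor -det_mxn; congr (_ * \det _).
by apply/matrixP => a b; rewrite !mxE.
Qed.

(** The rows of [A] are again an oriented orthonormal frame, and [Oh k] becomes the difference of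
    two complementary bivectors of that frame; such a difference is anti-self-dual in the standard
    frame as well. *)
Lemma Oh_conj (A : 'M[R]_4) k : A *m A^T = 1%:M -> \det A = 1 ->
  exists a : 'rV[R]_3, A^T *m Oh k *m A = \sum_j a 0 j *: Oh j.
Proof.
move=> oA dA.
have cof := orth_adj oA dA.
pose r (i j : nat) : R := A (inord i) (inord j).
have Ar : A = mxn 4 4 r by exact: mxn_eta.
have dots (i j : 'I_4) : r i 0%N * r j 0%N + r i 1%N * r j 1%N + r i 2%N * r j 2%N
    + r i 3%N * r j 3%N = (i == j)%:R.
  have := congr1 (fun B : 'M[R]_4 => B i j) oA; rewrite Ar !mxE => <-.
  by rewrite !big_ord_recl big_ord0 !mxE /= addr0 !addrA.
have cofs (i j : 'I_4) : r i j = (-1) ^+ (i + j) * ndet 3 (fun a b => r (bump i a) (bump j b)).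
  by have := cof i j; rewrite Ar cofactor_mxn !mxE.
pose o (m : nat) (h : (m < 4)%N) : 'I_4 := Ordinal h.
(* One computation serves all [k], with (p, q, s, t) equal to (0, 1, 2, 3), (0, 2, 3, 1) or (0, 3,
   1, 2). *)
have H (p q s t : nat) : (s < 4)%N -> (p < 4)%N -> (q < 4)%N -> s != p -> s != q ->
  r t 0%N = - (r p 1%N * (r q 2%N * r s 3%N - r q 3%N * r s 2%N) - r p 2%N * (r q 1%N * r s 3%N - r q 3%N * r s 1%N) + r p 3%N * (r q 1%N * r s 2%N - r q 2%N * r s 1%N)) ->
  r t 1%N = r p 0%N * (r q 2%N * r s 3%N - r q 3%N * r s 2%N) - r p 2%N * (r q 0%N * r s 3%N - r q 3%N * r s 0%N) + r p 3%N * (r q 0%N * r s 2%N - r q 2%N * r s 0%N) ->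
  r t 2%N = - (r p 0%N * (r q 1%N * r s 3%N - r q 3%N * r s 1%N) - r p 1%N * (r q 0%N * r s 3%N - r q 3%N * r s 0%N) + r p 3%N * (r q 0%N * r s 1%N - r q 1%N * r s 0%N)) ->
  r t 3%N = r p 0%N * (r q 1%N * r s 2%N - r q 2%N * r s 1%N) - r p 1%N * (r q 0%N * r s 2%N - r q 2%N * r s 0%N) + r p 2%N * (r q 0%N * r s 1%N - r q 1%N * r s 0%N) ->
  exists a : 'rV[R]_3,
    mxn 4 4 (fun i j => (r p i * r q j - r q i * r p j) - (r s i * r t j - r t i * r s j)) = \sum_j a 0 j *: Oh j.
  move=> hs hp hq sp sq t0 t1 t2 t3.
  have := dots (o s hs) (o s hs); have := dots (o s hs) (o p hp); have := dots (o s hs) (o q hq).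
  rewrite -!val_eqE /= eqxx (negbTE sp) (negbTE sq) -!expr2 => dq dp ds.
  have [e1 e2 e3 [e4 e5 e6]] := compl_minors ds dp dq t0 t1 t2 t3.
  pose c i j := (r p i * r q j - r q i * r p j) - (r s i * r t j - r t i * r s j).
  have cN i j : c j i = - c i j by rewrite /c; ring.
  have c0 i : c i i = 0 by rewrite /c; ring.
  have c1 : c 2%N 3%N = - c 0%N 1%N by clear -e1 e2; rewrite /c; lra.
  have c2 : c 1%N 3%N = c 0%N 2%N by clear -e3 e4; rewrite /c; lra.
  have c3 : c 1%N 2%N = - c 0%N 3%N by clear -e5 e6; rewrite /c; lra.
  exists (\row_j c 0%N j.+1); rewrite !big_ord_recl big_ord0 addr0 !mxE /=.
  by apply/matrixP => -[[|[|[|[|i]]]] hi] // [[|[|[|[|j]]]] hj] //;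
   rewrite !mxE /= ?mulr0 ?addr0 ?add0r ?mulr1 ?mulrN1 /bump /= -/(c _ _)
     ?c0 ?c1 ?c2 ?c3 // cN ?c1 ?c2 ?c3 ?opprK.
have E p q s t : (forall a b : 'I_4, (A^T *m Oh k *m A) a b =
     (r p a * r q b - r q a * r p b) - (r s a * r t b - r t a * r s b)) ->
   A^T *m Oh k *m A = mxn 4 4 (fun i j => (r p i * r q j - r q i * r p j) - (r s i * r t j - r t i * r s j)).
  by move=> e; apply/matrixP => a b; rewrite e mxE.
have cofE t c : (t < 4)%N -> (c < 4)%N -> r t c = (-1) ^+ (t + c) * ndet 3 (fun a b => r (bump t a) (bump c b)).
  by move=> ht hc; exact: cofs (Ordinal ht) (Ordinal hc).
case: k E => [|[|k]] E.
- rewrite (E 0 1 2 3)%N; last first.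
    move=> a b; rewrite Ar !mxE !big_ord_recl !big_ord0 !mxE !big_ord_recl !big_ord0 !mxE /= /bump /=; ring.
  by apply: (H 0 1 2 3)%N => //; rewrite (@cofE 3) //= /bump /=; ring.
- rewrite (E 0 2 3 1)%N; last first.
    move=> a b; rewrite Ar !mxE !big_ord_recl !big_ord0 !mxE !big_ord_recl !big_ord0 !mxE /= /bump /=; ring.
  by apply: (H 0 2 3 1)%N => //; rewrite (@cofE 1) //= /bump /=; ring.
- rewrite (E 0 3 1 2)%N; last first.
    move=> a b; rewrite Ar !mxE !big_ord_recl !big_ord0 !mxE !big_ord_recl !big_ord0 !mxE /= /bump /=; ring.
  by apply: (H 0 3 1 2)%N => //; rewrite (@cofE 2) //= /bump /=; ring.
Qed.

Lemma oriented_coframeP (x : 'rV[R]_5) (b : 'M[R]_(4, 5)) : oriented_coframe x b <->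
  [/\ x *m x^T = 1%:M, b *m b^T = 1%:M, b *m x^T = 0 & \det (col_mx x b : 'M[R]_5) = 1].
Proof.
rewrite /oriented_coframe.
have -> : (col_mx x b : 'M[R]_5) *m (col_mx x b)^T = block_mx (x *m x^T) (x *m b^T) (b *m x^T) (b *m b^T).
  by rewrite (tr_col_mx x b) (mul_col_row x b).
have -> : (1%:M : 'M[R]_5) = block_mx (1%:M : 'M[R]_1) 0 0 (1%:M : 'M[R]_4) by rewrite -scalar_mx_block.
split=> [[/(@eq_block_mx _ 1 4 1 4)[-> _ -> ->] ->]|[h1 h2 h3 ->]]; first by [].
have h4 : x *m b^T = 0 by rewrite -[x]trmxK -trmx_mul h3 trmx0.
by rewrite h1 h2 h3 h4.
Qed.

Lemma coframe_complete (x : 'rV[R]_5) b : oriented_coframe x b -> x^T *m x + b^T *m b = 1%:M.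
Proof.
move=> [h _]; have := mulmx1C h.
by rewrite (tr_col_mx x b) (mul_row_col x^T).
Qed.

(** Two oriented coframes at [x] differ by a matrix of SO(4), which preserves the anti-self-dual
    forms. *)
Lemma Omega_span x b b' k : oriented_coframe x b -> oriented_coframe x b' ->
  exists a : 'rV[R]_3, Omega k b' = \sum_j a 0 j *: Omega j b.
Proof.
move=> ob ob'; have cb := coframe_complete ob.
have [xx bb bx db] := (oriented_coframeP _ _).1 ob.
have [_ bb' bx' db'] := (oriented_coframeP _ _).1 ob'.
pose A := b' *m b^T.
have b'A : b' = A *m b.
  by rewrite /A -mulmxA -[LHS]mulmx1 -cb mulmxDr mulmxA bx' mul0mx add0r.
have oA : A *m A^T = 1%:M.
  by rewrite trmx_mul trmxK mulmxA -[A *m _]/(A *m b) -b'A bb'.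
have dA : \det A = 1.
  have e : (col_mx x b' : 'M[R]_5) = block_mx (1%:M : 'M[R]_1) 0 0 A *m (col_mx x b : 'M[R]_5).
    rewrite (mul_block_col (1%:M : 'M[R]_1) 0 0 A x b) !mul0mx mul1mx addr0 add0r.
    by rewrite -b'A.
  move: db'; rewrite e det_mulmx db mulr1.
  by rewrite (det_ublock (1%:M : 'M[R]_1) 0 A) det1 mul1r.
have [a Ha] := Oh_conj k oA dA; exists a.
have -> : Omega k b' = b^T *m (A^T *m Oh k *m A) *m b.
  by rewrite OmegaE b'A trmx_mul !mulmxA.
rewrite Ha.
rewrite mulmx_sumr mulmx_suml; apply: eq_bigr => j _.
by rewrite -scalemxAr -scalemxAl OmegaE.
Qed.

(** Membership in [M] provides some coframe; this replaces it by any prescribed one. *)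
Lemma M_coframe (p : amb R) b : M p -> oriented_coframe p.1 b ->
  exists a : 'rV[R]_3, p.2 = \sum_k a 0 k *: Omega k b.
Proof.
move=> [b' [ob' [a' ->]]] ob.
pose a k := xget 0 [set a : 'rV[R]_3 | Omega k b' = \sum_j a 0 j *: Omega j b].
have Ha k : Omega k b' = \sum_j a k 0 j *: Omega j b.
  have [c Hc] := Omega_span k ob ob'.
  by apply: (@xgetI _ 0 [set a : 'rV[R]_3 | Omega k b' = \sum_j a 0 j *: Omega j b] c).
exists (\row_j \sum_k a' 0 k * a k 0 j).
under eq_bigr do rewrite Ha scaler_sumr.
rewrite exchange_big; apply: eq_bigr => j _; rewrite mxE scaler_suml.
by apply: eq_bigr => k _; rewrite scalerA.
Qed.

Lemma M_unit (p : amb R) : M p -> p.1 *m p.1^T = 1%:M.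
Proof. by move=> [b [/oriented_coframeP[]]]. Qed.

Lemma mxtrace_mul_tr m n (A B : 'M[R]_(m, n)) : \tr (A *m B^T) = \sum_i \sum_j A i j * B i j.
Proof.
apply: eq_bigr => i _; rewrite mxE; apply: eq_bigr => j _; by rewrite mxE.
Qed.

Lemma mul_mxn4 (f g : nat -> nat -> R) : mxn 4 4 f *m mxn 4 4 g =
  mxn 4 4 (fun i j => f i 0%N * g 0%N j + (f i 1%N * g 1%N j + (f i 2%N * g 2%N j + f i 3%N * g 3%N j))).
Proof. by apply/matrixP => i j; rewrite !mxE !big_ord_recl big_ord0 !mxE /= addr0. Qed.

Lemma tr_mxn4 (f g : nat -> nat -> R) : \tr (mxn 4 4 f *m (mxn 4 4 g)^T) =
  let r i := f i 0%N * g i 0%N + (f i 1%N * g i 1%N + (f i 2%N * g i 2%N + f i 3%N * g i 3%N)) in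
  r 0%N + (r 1%N + (r 2%N + r 3%N)).
Proof. by rewrite mxtrace_mul_tr !big_ord_recl !big_ord0 !mxE /= !addr0. Qed.

Lemma tr_Oh (j k : 'I_3) : \tr (Oh j *m (Oh k)^T) = 4 *+ (j == k).
Proof.
case: j => [[|[|[|j]]] hj] //; case: k => [[|[|[|k]]] hk] //; rewrite -!val_eqE /=;
rewrite /Oh /mxl tr_mxn4 /=
  !(mul0r, mulr0, mulr1, mul1r, mulrN1, mulN1r, oppr0, addr0, add0r, opprK) ?subrr ?addr0 //.
Qed.

Lemma tr_Omega (b : 'M[R]_(4, 5)) (j k : 'I_3) : b *m b^T = 1%:M ->
  \tr (Omega j b *m (Omega k b)^T) = 4 *+ (j == k).
Proof.
move=> bb; rewrite !OmegaE !trmx_mul trmxK -tr_Oh.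
by rewrite !mulmxA -(mulmxA _ b b^T) bb mulmx1 mxtrace_mulC !mulmxA bb mul1mx.
Qed.

End ASD.

(** * Inner and cross products *)

Section Space3.
Variable R : realType.
Implicit Types u v w q : 'rV[R]_3.

Definition dot n (u v : 'rV[R]_n) : R := (u *m v^T) 0 0.
Definition crs u v : 'rV[R]_3 := \row_j nth 0
  [:: u 0 1 * v 0 2%:R - u 0 2%:R * v 0 1; u 0 2%:R * v 0 0 - u 0 0 * v 0 2%:R;
      u 0 0 * v 0 1 - u 0 1 * v 0 0] j.

Lemma dotE n (u v : 'rV[R]_n) : u *m v^T = (dot u v)%:M.
Proof. by rewrite [LHS]mx11_scalar. Qed.

Lemma dot_sum n (u v : 'rV[R]_n) : dot u v = \sum_i u 0 i * v 0 i.
Proof. by rewrite /dot mxE; apply: eq_bigr => i _; rewrite mxE. Qed.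

Lemma dotC n (u v : 'rV[R]_n) : dot u v = dot v u.
Proof. by rewrite !dot_sum; apply: eq_bigr => i _; rewrite mulrC. Qed.

Lemma dotDl n (u v w : 'rV[R]_n) : dot (u + v) w = dot u w + dot v w.
Proof. by rewrite /dot mulmxDl mxE. Qed.

Lemma dotZl n (u v : 'rV[R]_n) a : dot (a *: u) v = a * dot u v.
Proof. by rewrite /dot -scalemxAl mxE. Qed.

Lemma dotDr n (u v w : 'rV[R]_n) : dot w (u + v) = dot w u + dot w v.
Proof. by rewrite dotC dotDl !(dotC w). Qed.

Lemma dotZr n (u v : 'rV[R]_n) a : dot u (a *: v) = a * dot u v.
Proof. by rewrite dotC dotZl dotC. Qed.

Lemma dot0l n (u : 'rV[R]_n) : dot 0 u = 0.
Proof. by rewrite /dot mul0mx mxE. Qed.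

Lemma dot_ge0 n (u : 'rV[R]_n) : 0 <= dot u u.
Proof. by rewrite dot_sum sumr_ge0 // => i _; rewrite -expr2 sqr_ge0. Qed.

Lemma dot_eq0 n (u : 'rV[R]_n) : (dot u u == 0) = (u == 0).
Proof.
apply/idP/eqP => [|->]; last by rewrite dot0l.
rewrite dot_sum psumr_eq0 => [/allP h|i _]; last by rewrite -expr2 sqr_ge0.
apply/rowP => i; rewrite mxE; apply/eqP.
by have := h i; rewrite mem_index_enum -expr2 sqrf_eq0; exact.
Qed.

Lemma dot_gt0 n (u : 'rV[R]_n) : (0 < dot u u) = (u != 0).
Proof. by rewrite lt_def dot_ge0 andbT dot_eq0. Qed.

Lemma row3E (i : 'I_3) : [\/ i = 0, i = 1 | i = 2%:R].
Proof.
by case: i => [[|[|[|i]]] hi] //; [apply: Or31|apply: Or32|apply: Or33]; apply: val_inj.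
Qed.

Lemma row3P u v : u 0 0 = v 0 0 -> u 0 1 = v 0 1 -> u 0 2%:R = v 0 2%:R -> u = v.
Proof. by move=> a b c; apply/rowP => i; have [->|->|->] := row3E i. Qed.

Lemma dot3E u v : dot u v = u 0 0 * v 0 0 + u 0 1 * v 0 1 + u 0 2%:R * v 0 2%:R.
Proof.
rewrite dot_sum !big_ord_recl big_ord0 addr0 addrA; congr (_ * _ + _ * _ + _ * _);
congr (_ _ _); exact: val_inj.
Qed.

Lemma crs0 u v : crs u v 0 0 = u 0 1 * v 0 2%:R - u 0 2%:R * v 0 1. Proof. by rewrite mxE. Qed.
Lemma crs1 u v : crs u v 0 1 = u 0 2%:R * v 0 0 - u 0 0 * v 0 2%:R. Proof. by rewrite mxE. Qed.
Lemma crs2 u v : crs u v 0 2%:R = u 0 0 * v 0 1 - u 0 1 * v 0 0. Proof. by rewrite mxE. Qed.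
Definition crsE := (crs0, crs1, crs2).

Lemma dot_crsl u v : dot u (crs u v) = 0.
Proof. rewrite dot3E !crsE; ring. Qed.

Lemma dot_crsr u v : dot v (crs u v) = 0.
Proof. rewrite dot3E !crsE; ring. Qed.

Lemma dot_crs2 u v w q : dot (crs u v) (crs w q) = dot u w * dot v q - dot u q * dot v w.
Proof. rewrite !dot3E !crsE; ring. Qed.

Lemma crs_crs u v w : crs u (crs v w) = dot u w *: v - dot u v *: w.
Proof. apply: row3P; rewrite !crsE !mxE !dot3E; ring. Qed.

Lemma crsC u v : crs u v = - crs v u.
Proof. apply: row3P; rewrite [RHS]mxE !crsE; ring. Qed.

Lemma crsZl a u v : crs (a *: u) v = a *: crs u v.
Proof. apply: row3P; rewrite [RHS]mxE !crsE !mxE; ring. Qed.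

Lemma crsZr a u v : crs u (a *: v) = a *: crs u v.
Proof. apply: row3P; rewrite [RHS]mxE !crsE !mxE; ring. Qed.

Lemma crs_eq0 u v : dot u u = 1 -> dot u v = 0 -> dot (crs u v) (crs u v) = dot v v.
Proof. by move=> uu uv; rewrite dot_crs2 uu uv mul1r mul0r subr0. Qed.

Definition rot3 u v w : 'M[R]_3 := \matrix_(i < 3) nth 0 [:: u; v; w] i.

Lemma rot3_SO3 u v : dot u u = 1 -> dot v v = 1 -> dot u v = 0 -> SO3 (rot3 u v (crs u v)).
Proof.
move=> uu vv uv; split.
  apply/matrixP => i j; rewrite !mxE.
  transitivity (dot (row i (rot3 u v (crs u v))) (row j (rot3 u v (crs u v)))).
    by rewrite dot_sum; apply: eq_bigr => k _; rewrite !mxE.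
  have := dot_crsl u v; have := dot_crsr u v; have := crs_eq0 uu uv.
  rewrite !rowK => h1 h2 h3; have [->|->|->] := row3E i; have [->|->|->] := row3E j => /=;
  by rewrite ?uu ?vv ?uv ?h1 ?h2 ?h3 ?(dotC v u) ?uv // 1?dotC ?h2 ?h3.
rewrite (mxn_eta (rot3 _ _ _)) det_mxn /= /bump /= !mxE !inordK //=.
transitivity (dot (crs u v) (crs u v)); last by rewrite crs_eq0.
have -> : inord 0 = 0 :> 'I_3 by apply: val_inj; rewrite /= inordK.
have -> : inord 1 = 1 :> 'I_3 by apply: val_inj; rewrite /= inordK.
have -> : inord 2 = 2%:R :> 'I_3 by apply: val_inj; rewrite /= inordK.
rewrite dot3E !crsE; ring.
Qed.

Lemma orth_exists u : dot u u = 1 -> exists2 v, dot v v = 1 & dot u v = 0.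
Proof.
move=> uu.
have [w w0] : exists w, crs u w != 0.
  apply: contrapT => h.
  have H w : crs u w = 0 by apply/eqP/negPn/negP => k; apply: h; exists w.
  (* The products with two basis vectors already contain all coordinates of [u]. *)
  have := H (delta_mx 0 0); have := H (delta_mx 0 1).
  move=> /rowP h1 /rowP h2.
  have := h1 0; have := h1 2%:R; have := h2 1; have := h2 2%:R.
  rewrite !crsE !mxE /= !(mulr1, mulr0, subr0, sub0r).
  move=> /eqP; rewrite oppr_eq0 => /eqP a b c _.
  by move: uu; rewrite dot3E a b c; rewrite !mul0r !addr0 => /esym/eqP; rewrite oner_eq0.
exists ((Num.sqrt (dot (crs u w) (crs u w)))^-1 *: crs u w); last first.
  by rewrite dotZr dot_crsl mulr0.
rewrite dotZl dotZr mulrA -invfM -expr2 sqr_sqrtr ?dot_ge0 // mulVf //.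
by rewrite dot_eq0.
Qed.

Lemma crs_frame u v : dot u u = 1 -> dot v v = 1 -> dot u v = 0 ->
  crs v (crs u v) = u /\ crs (crs u v) u = v.
Proof.
move=> uu vv uv; split; first by rewrite crs_crs vv (dotC v) uv scale1r scale0r subr0.
by rewrite crsC crs_crs uv uu scale0r scale1r sub0r opprK.
Qed.

(* For a positive orthonormal basis (u, v, w), [v ^ w] is the matrix of [crs u]. *)
Definition star u : 'M[R]_3 := mxl 3 3
  [:: [:: 0; u 0 2%:R; - u 0 1]; [:: - u 0 2%:R; 0; u 0 0]; [:: u 0 1; - u 0 0; 0]].

Lemma wedge_crs v w : v^T *m w - w^T *m v = star (crs v w).
Proof.
apply/matrixP => i j; rewrite !mxE !big_ord_recl !big_ord0 !mxE /=.
have [->|->|->] := row3E i; have [->|->|->] := row3E j; rewrite /=; ring.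
Qed.

End Space3.

(** * Coframes adapted to R^3 + R^2 *)

Section Adapted.
Variable R : realType.
Implicit Types (C S : R) (u w q : 'rV[R]_3) (v y : 'rV[R]_2).

Definition prp v : 'rV[R]_2 := \row_j nth 0 [:: - v 0 1; v 0 0] j.
Definition rot2 v : 'M[R]_2 := \matrix_(i < 2) nth 0 [:: v; prp v] i.
Definition J2 : 'M[R]_2 := mxl 2 2 [:: [:: 0; 1]; [:: -1; 0]].
Definition row5 u v : 'rV[R]_5 := row_mx u v.

Lemma row2E (i : 'I_2) : i = 0 \/ i = 1.
Proof. by case: i => [[|[|i]] hi] //; [left|right]; apply: val_inj. Qed.

Lemma dot2E v y : dot v y = v 0 0 * y 0 0 + v 0 1 * y 0 1.
Proof.
rewrite dot_sum !big_ord_recl big_ord0 addr0; congr (_ * _ + _ * _);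
congr (_ _ _); exact: val_inj.
Qed.

Lemma row2P v y : v 0 0 = y 0 0 -> v 0 1 = y 0 1 -> v = y.
Proof. by move=> a b; apply/rowP => i; have [->|->] := row2E i. Qed.

Lemma prp0 v : prp v 0 0 = - v 0 1. Proof. by rewrite mxE. Qed.
Lemma prp1 v : prp v 0 1 = v 0 0. Proof. by rewrite mxE. Qed.

Lemma dot_prp v : dot v (prp v) = 0.
Proof. rewrite dot2E prp0 prp1; ring. Qed.

Lemma dot_prp2 v : dot (prp v) (prp v) = dot v v.
Proof. rewrite !dot2E prp0 prp1; ring. Qed.

Lemma wedge_prp v : dot v v = 1 -> v^T *m prp v - (prp v)^T *m v = J2.
Proof.
rewrite dot2E => vv; apply/matrixP => i j; rewrite !mxE !big_ord_recl !big_ord0 !mxE /=.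
have [->|->] := row2E i; have [->|->] := row2E j; rewrite /= -?vv; ring.
Qed.

Lemma dot_row5 u v w y : dot (row5 u v) (row5 w y) = dot u w + dot v y.
Proof. by rewrite /dot /row5 (tr_row_mx w y) (mul_row_col u v) mxE. Qed.

Definition frame5 u w v : 'M[R]_5 := \matrix_(i < 5)
  nth 0 [:: row5 u 0; row5 w 0; row5 (crs u w) 0; row5 0 v; row5 0 (prp v)] i.

(** Passes from [frame5] to the point and its coframe: a rotation by the angle with cosine C and
    sine S in the plane of [u] and [v], with an even reordering. *)
Definition lmat C S : 'M[R]_5 := mxl 5 5 [:: [:: C; 0; 0; S; 0]; [:: -S; 0; 0; C; 0];
  [:: 0; 0; 0; 0; 1]; [:: 0; 1; 0; 0; 0]; [:: 0; 0; 1; 0; 0]].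

(** These are the coordinates of a join of the spheres S^2 and S^1. *)
Definition xof C S u v : 'rV[R]_5 := row5 (C *: u) (S *: v).

Definition coframe C S u v w : 'M[R]_(4, 5) := \matrix_(i < 4)
  nth 0 [:: row5 (- S *: u) (C *: v); row5 0 (prp v); row5 w 0; row5 (crs u w) 0] i.

Lemma det_lmat C S : C ^+ 2 + S ^+ 2 = 1 -> \det (lmat C S) = 1.
Proof. by move=> <-; rewrite /lmat /mxl det_mxn /= /bump /=; ring. Qed.

Lemma orth_lmat C S : C ^+ 2 + S ^+ 2 = 1 -> lmat C S *m (lmat C S)^T = 1%:M.
Proof.
move=> CS; apply/matrixP => -[[|[|[|[|[|i]]]]] hi] // [[|[|[|[|[|j]]]]] hj] //;
rewrite !mxE !big_ord_recl big_ord0 !mxE -!val_eqE /=; move: CS; rewrite !expr2; lra.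
Qed.

Lemma row_block_l m1 m2 n1 n2 (A : 'M[R]_(m1, n1)) B (D : 'M[R]_(m2, n1)) (E : 'M[R]_(m2, n2)) i :
  row (lshift m2 i) (block_mx A B D E) = row_mx (row i A) (row i B).
Proof. by rewrite /block_mx rowKu row_row_mx. Qed.

Lemma row_block_r m1 m2 n1 n2 (A : 'M[R]_(m1, n1)) B (D : 'M[R]_(m2, n1)) (E : 'M[R]_(m2, n2)) i :
  row (rshift m1 i) (block_mx A B D E) = row_mx (row i D) (row i E).
Proof. by rewrite /block_mx rowKd row_row_mx. Qed.

Lemma block_orth m n (A : 'M[R]_m) (D : 'M[R]_n) : A *m A^T = 1%:M -> D *m D^T = 1%:M ->
  block_mx A 0 0 D *m (block_mx A 0 0 D)^T = 1%:M.
Proof.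
move=> hA hD; rewrite tr_block_mx mulmx_block !trmx0 !mulmx0 !mul0mx !addr0 !add0r hA hD.
by rewrite -scalar_mx_block.
Qed.

Lemma frame5_block u w v : frame5 u w v = block_mx (rot3 u w (crs u w)) 0 0 (rot2 v).
Proof.
apply/row_matrixP => i; rewrite rowK.
case: (@splitP 3 2 i) => k e.
  have -> : i = lshift 2 k by apply: val_inj.
  apply: (etrans _ (esym (row_block_l (rot3 u w (crs u w)) 0 0 (rot2 v) k))); rewrite row0 rowK /=.
  by have [->|->|->] := row3E k.
have -> : i = rshift 3 k by apply: val_inj.
apply: (etrans _ (esym (row_block_r (rot3 u w (crs u w)) 0 0 (rot2 v) k))); rewrite row0 rowK /=.
by have [->|->] := row2E k.
Qed.

Lemma rot2_orth v : dot v v = 1 -> rot2 v *m (rot2 v)^T = 1%:M /\ \det (rot2 v) = 1.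
Proof.
move=> vv; split.
  apply/matrixP => i j; rewrite !mxE.
  transitivity (dot (row i (rot2 v)) (row j (rot2 v))).
    by rewrite dot_sum; apply: eq_bigr => k _; rewrite !mxE.
  rewrite !rowK; have [->|->] := row2E i; have [->|->] := row2E j;
  by rewrite /= ?vv ?dot_prp ?dot_prp2 ?vv ?(dotC (prp v)) ?dot_prp.
rewrite (mxn_eta (rot2 v)) det_mxn /= /bump /= !mxE !inordK //= -[RHS]vv dot2E.
have -> : inord 0 = 0 :> 'I_2 by apply: val_inj; rewrite /= inordK.
have -> : inord 1 = 1 :> 'I_2 by apply: val_inj; rewrite /= inordK.
rewrite prp0 prp1; ring.
Qed.

Lemma frame5_orth u w v : dot u u = 1 -> dot w w = 1 -> dot u w = 0 -> dot v v = 1 ->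
  frame5 u w v *m (frame5 u w v)^T = 1%:M /\ \det (frame5 u w v) = 1.
Proof.
move=> uu ww uw vv; have [oo1 d1] := rot3_SO3 uu ww uw; have [oo2 d2] := rot2_orth vv.
rewrite frame5_block (det_ublock (rot3 u w (crs u w)) 0 (rot2 v)) d1 d2 mulr1; split=> //.
exact: block_orth oo1 oo2.
Qed.

Lemma row5D u v w y : row5 u v + row5 w y = row5 (u + w) (v + y).
Proof. exact: (add_row_mx u v w y). Qed.
Lemma row5Z a u v : a *: row5 u v = row5 (a *: u) (a *: v).
Proof. exact: (scale_row_mx a u v). Qed.

Lemma row500 : row5 0 0 = 0.
Proof. exact: (row_mx0 R 1 3 2). Qed.

Lemma coframe_prod C S u v w : col_mx (xof C S u v) (coframe C S u v w) = lmat C S *m frame5 u w v.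
Proof.
apply/row_matrixP => i; rewrite row_mul mulmx_sum_row !big_ord_recl big_ord0 !rowK !mxE /=.
case: (@splitP 1 4 i) => k e.
  have -> : i = lshift 4 k by apply: val_inj.
  have k0 : k = 0 by case: k {e} => [[|k] hk] //; exact: val_inj.
  rewrite rowKu k0 /= !row5Z ?scaler0 ?scale0r ?row500 ?addr0 ?add0r ?row5D ?addr0 ?add0r.
  by apply/rowP => j; rewrite mxE ?row500 ?addr0.
have -> : i = rshift 1 k by apply: val_inj.
rewrite rowKd rowK /=.
by case: k {e} => [[|[|[|[|k]]]] hk] //=; rewrite !row5Z ?scaler0 ?scale0r ?row500 ?addr0 ?add0r ?row5D ?addr0 ?add0r ?scale1r.
Qed.

Lemma coframe_oriented C S u v w : C ^+ 2 + S ^+ 2 = 1 -> dot u u = 1 -> dot w w = 1 ->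
  dot u w = 0 -> dot v v = 1 -> oriented_coframe (xof C S u v) (coframe C S u v w).
Proof.
move=> CS uu ww uw vv; have [oo d] := frame5_orth uu ww uw vv.
rewrite /oriented_coframe coframe_prod det_mulmx d det_lmat // mulr1; split=> //.
by rewrite trmx_mul !mulmxA -(mulmxA (lmat C S)) oo mulmx1 orth_lmat.
Qed.

Definition block5 (A : 'M[R]_3) (B : 'M[R]_(3, 2)) (D : 'M[R]_(2, 3)) (E : 'M[R]_2) : 'M[R]_5 :=
  block_mx A B D E.

Lemma block5D A B D E A' B' D' E' : block5 A B D E + block5 A' B' D' E' =
  block5 (A + A') (B + B') (D + D') (E + E').
Proof. exact: (add_block_mx A B D E A' B' D' E'). Qed.

Lemma block5Z a A B D E : a *: block5 A B D E = block5 (a *: A) (a *: B) (a *: D) (a *: E).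
Proof. exact: (scale_block_mx a A B D E). Qed.

Lemma block5N A B D E : - block5 A B D E = block5 (- A) (- B) (- D) (- E).
Proof. exact: (opp_block_mx A B D E). Qed.

Lemma block5T A B D E : (block5 A B D E)^T = block5 A^T D^T B^T E^T.
Proof. exact: (tr_block_mx A B D E). Qed.

Lemma block5M A B D E A' B' D' E' : block5 A B D E *m block5 A' B' D' E' =
  block5 (A *m A' + B *m D') (A *m B' + B *m E') (D *m A' + E *m D') (D *m B' + E *m E').
Proof. exact: (mulmx_block A B D E A' B' D' E'). Qed.

Lemma row5M u v A B D E : row5 u v *m block5 A B D E =
  row5 (u *m A + v *m D) (u *m B + v *m E).
Proof. exact: (mul_row_block u v A B D E). Qed.

Definition Bmat C S u v a w : 'M[R]_(3, 2) :=
  ((a * S) *: u + crs u w)^T *m prp v + C *: (w^T *m v).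

(** The first component is [a], and the vector [w], orthogonal to [u], holds the other two, so that
    no basis of the plane orthogonal to [u] has to be chosen. *)
Definition Amat C S u v a w : 'M[R]_5 :=
  block5 (- star (a *: u + S *: crs u w)) (- Bmat C S u v a w)
    (Bmat C S u v a w)^T ((a * C) *: J2).

Lemma wedge_row5 u v w y : (row5 u v)^T *m row5 w y - (row5 w y)^T *m row5 u v =
  block5 (u^T *m w - w^T *m u) (u^T *m y - w^T *m v) (v^T *m w - y^T *m u) (v^T *m y - y^T *m v).
Proof.
rewrite /row5 (tr_row_mx u v) (tr_row_mx w y) (mul_col_row u^T v^T w y) (mul_col_row w^T y^T u v).
rewrite (opp_block_mx (w^T *m u) (w^T *m v) (y^T *m u) (y^T *m v)).
exact: (add_block_mx (u^T *m w) (u^T *m y) (v^T *m w) (v^T *m y)).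
Qed.

Lemma starD u w : star (u + w) = star u + star w.
Proof.
apply/matrixP => i j; rewrite !mxE.
by have [->|->|->] := row3E i; have [->|->|->] := row3E j; rewrite /= ?mxE ?addr0 ?opprD.
Qed.

Lemma starZ a u : star (a *: u) = a *: star u.
Proof.
apply/matrixP => i j; rewrite !mxE.
by have [->|->|->] := row3E i; have [->|->|->] := row3E j; rewrite /= ?mxE ?mulr0 ?mulrN.
Qed.

Lemma starN u : star (- u) = - star u.
Proof. by rewrite -scaleN1r starZ scaleN1r. Qed.

Lemma crsDr u w q : crs u (w + q) = crs u w + crs u q.
Proof. apply: row3P; rewrite [RHS]mxE !crsE !mxE; ring. Qed.

Lemma tr_mulE m n (u : 'rV[R]_m) (v : 'rV[R]_n) i j : (u^T *m v) i j = u 0 i * v 0 j.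
Proof. by rewrite mxE big_ord1 mxE. Qed.

Lemma Omega_sum C S u v w (a : 'rV[R]_3) : dot u u = 1 -> dot w w = 1 ->
  dot u w = 0 -> dot v v = 1 ->
  \sum_k a 0 k *: Omega k (coframe C S u v w) =
  Amat C S u v (a 0 0) (a 0 1 *: w + a 0 2%:R *: crs u w).
Proof.
move=> uu ww uw vv; have [c1 c2] := crs_frame uu ww uw.
rewrite !big_ord_recl big_ord0 addr0.
have -> : lift ord0 ord0 = 1 :> 'I_3 by apply: val_inj.
have -> : lift ord0 (lift ord0 ord0) = 2%:R :> 'I_3 by apply: val_inj.
rewrite -[ord0]/(0 : 'I_3) /Omega /= /wedge_row !rowK /= !wedge_row5.
rewrite !(trmx0, mul0mx, mulmx0, subr0, sub0r, oppr0).
rewrite !block5N !block5D !block5Z !block5D.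
have e1 : crs u (a 0 1 *: w + a 0 2%:R *: crs u w) = a 0 1 *: crs u w - a 0 2%:R *: w.
  by rewrite crsDr !crsZr crs_crs uw uu scale0r scale1r sub0r scalerN.
congr block5.
- rewrite !(sub0r, subr0) !wedge_crs c1 -!(starN, starD, starZ); congr star.
  rewrite e1 !crsZl crs_crs uw uu scale0r scale1r; move: (crs u w) => y.
  apply/rowP => i; rewrite !mxE; ring.
- rewrite /Bmat e1; move: (crs u w) (prp v) => y z.
  apply/matrixP => i j; rewrite !(tr_mulE, mxE); ring.
- rewrite /Bmat e1; move: (crs u w) (prp v) => y z.
  apply/matrixP => i j; rewrite !(tr_mulE, mxE); ring.
- rewrite !(addr0, subr0, scaler0) -(wedge_prp vv).
  move: (prp v) => z; apply/matrixP => i j; rewrite !(tr_mulE, mxE); ring.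
Qed.

Lemma frame_expand u w q : dot u u = 1 -> dot w w = 1 -> dot u w = 0 ->
  q = dot q u *: u + dot q w *: w + dot q (crs u w) *: crs u w.
Proof.
move=> uu ww uw; have [oo _] := rot3_SO3 uu ww uw.
rewrite -[LHS]mulmx1 -(mulmx1C oo) mulmxA mulmx_sum_row !big_ord_recl big_ord0 addr0 addrA.
have e (k : 'I_3) : (q *m (rot3 u w (crs u w))^T) 0 k = dot q (row k (rot3 u w (crs u w))).
  by rewrite dot_sum mxE; apply: eq_bigr => j _; rewrite !mxE.
by rewrite !e !rowK.
Qed.

Definition xl (x : 'rV[R]_5) : 'rV[R]_3 := @lsubmx R 1 3 2 x.
Definition xr (x : 'rV[R]_5) : 'rV[R]_2 := @rsubmx R 1 3 2 x.
Definition height (A : 'M[R]_5) : R := A (rshift 3 (0 : 'I_2)) (rshift 3 (1 : 'I_2)).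
Definition brow v (A : 'M[R]_5) : 'rV[R]_3 := xl (row5 0 v *m A).
Definition rad2 (A : 'M[R]_5) : R := \tr (A *m A^T) / 4.

Lemma xl_row5 u v : xl (row5 u v) = u. Proof. exact: row_mxKl. Qed.
Lemma xr_row5 u v : xr (row5 u v) = v. Proof. exact: row_mxKr. Qed.
Lemma row5_eta (x : 'rV[R]_5) : x = row5 (xl x) (xr x).
Proof. by rewrite /row5 /xl /xr hsubmxK. Qed.

Lemma dot5 (x y : 'rV[R]_5) : dot x y = dot (xl x) (xl y) + dot (xr x) (xr y).
Proof. by rewrite -dot_row5 -!row5_eta. Qed.

Lemma Amat_height C S u v a w : height (Amat C S u v a w) = a * C.
Proof. by rewrite /height [LHS]block_mxEdr !mxE /= mulr1. Qed.

Lemma Amat_brow C S u v a w : dot v v = 1 -> brow v (Amat C S u v a w) = C *: w.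
Proof.
move=> vv; rewrite /brow row5M xl_row5 mul0mx add0r /Bmat linearD /= linearZ /=.
rewrite !trmx_mul !trmxK mulmxDr -scalemxAr !mulmxA !dotE dot_prp vv.
by rewrite mul_scalar_mx scale0r add0r mul1mx.
Qed.

Lemma rad2_Omega (b : 'M[R]_(4, 5)) (c : 'I_3 -> R) : b *m b^T = 1%:M ->
  rad2 (\sum_k c k *: Omega k b) = \sum_k c k ^+ 2.
Proof.
move=> bb; rewrite /rad2 linear_sum /= mulmx_suml (linear_sum (@mxtrace R 5)) /=.
have -> : \sum_i \tr (c i *: Omega i b *m (\sum_k (c k *: Omega k b)^T)) = \sum_i 4 * c i ^+ 2.
  apply: eq_bigr => i _.
  rewrite mulmx_sumr (linear_sum (@mxtrace R 5)) /= (bigD1 i) //= big1 => [|j ji].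
    by rewrite linearZ /= -scalemxAl -scalemxAr !linearZ /= tr_Omega // eqxx /= mulr1n; ring.
  by rewrite linearZ /= -scalemxAl -scalemxAr !linearZ /= tr_Omega // eq_sym (negbTE ji) !mulr0.
by rewrite -mulr_sumr mulrAC mulfV ?pnatr_eq0 // mul1r.
Qed.

Lemma M_Amat C S u v a w : C ^+ 2 + S ^+ 2 = 1 -> dot u u = 1 -> dot v v = 1 ->
  dot u w = 0 -> M (xof C S u v, Amat C S u v a w) /\ rad2 (Amat C S u v a w) = a ^+ 2 + dot w w.
Proof.
move=> CS uu vv uw; have [q qq uq] := orth_exists uu.
have wE := frame_expand w uu qq uq; rewrite (dotC w u) uw scale0r add0r in wE.
pose c : 'rV[R]_3 := \row_j nth 0 [:: a; dot w q; dot w (crs u q)] j.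
have e : Amat C S u v a w = \sum_k c 0 k *: Omega k (coframe C S u v q).
  by rewrite Omega_sum // !mxE /= -wE.
have oc := coframe_oriented CS uu qq uq vv.
split; first by exists (coframe C S u v q); split=> //; exists c.
have [_ bb _ _] := (oriented_coframeP _ _).1 oc.
rewrite e rad2_Omega // !big_ord_recl big_ord0 addr0 !mxE /=; congr (_ + _).
rewrite [in RHS]wE !(dotDl, dotDr, dotZl, dotZr) qq (dotC (crs u q)) dot_crsr.
by rewrite crs_eq0 // qq; ring.
Qed.

Lemma M_decomp_frame (p : amb R) C S u v q : M p -> p.1 = xof C S u v -> C ^+ 2 + S ^+ 2 = 1 ->
  dot u u = 1 -> dot q q = 1 -> dot u q = 0 -> dot v v = 1 ->
  exists2 a : 'rV[R]_3, p.2 = \sum_k a 0 k *: Omega k (coframe C S u v q) &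
    p.2 = Amat C S u v (a 0 0) (a 0 1 *: q + a 0 2%:R *: crs u q).
Proof.
move=> Mp p1 CS uu qq uq vv.
have oc := coframe_oriented CS uu qq uq vv; rewrite -p1 in oc.
have [a Ha] := M_coframe Mp oc.
by exists a => //; rewrite Ha Omega_sum.
Qed.

Lemma M_decomp (p : amb R) C S u v : M p -> p.1 = xof C S u v -> C ^+ 2 + S ^+ 2 = 1 ->
  dot u u = 1 -> dot v v = 1 -> exists a w, dot u w = 0 /\ p.2 = Amat C S u v a w.
Proof.
move=> Mp p1 CS uu vv; have [q qq uq] := orth_exists uu.
have [a _ Ha] := M_decomp_frame Mp p1 CS uu qq uq vv.
exists (a 0 0), (a 0 1 *: q + a 0 2%:R *: crs u q); split=> //.
by rewrite dotDr !dotZr uq dot_crsl !mulr0 addr0.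
Qed.

Lemma normalize n (x : 'rV[R]_n) : x != 0 -> exists2 u, dot u u = 1 & x = Num.sqrt (dot x x) *: u.
Proof.
move=> x0; have s0 : 0 < Num.sqrt (dot x x) by rewrite sqrtr_gt0 dot_gt0.
exists ((Num.sqrt (dot x x))^-1 *: x).
  by rewrite dotZl dotZr mulrA -invfM -expr2 sqr_sqrtr ?dot_ge0 // mulVf // dot_eq0.
by rewrite scalerA mulfV ?gt_eqF // scale1r.
Qed.

(** At 0 any unit vector does, with factor 0. This keeps the decomposition of points of S^4 uniform
    where x' or x'' vanishes. *)
Lemma normalize_any n (x : 'rV[R]_n.+1) : exists2 u, dot u u = 1 & x = Num.sqrt (dot x x) *: u.
Proof.
have [->|] := eqVneq x 0; last exact: normalize.
exists (delta_mx 0 0); last by rewrite dot0l sqrtr0 scale0r.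
by rewrite /dot trmx_delta mul_delta_mx mxE !eqxx.
Qed.

Lemma unit_decomp (x : 'rV[R]_5) : x *m x^T = 1%:M ->
  exists C S u v, [/\ 0 <= C, 0 <= S, dot u u = 1, dot v v = 1 &
    C ^+ 2 + S ^+ 2 = 1 /\ x = xof C S u v].
Proof.
move=> xx; have x1 : dot x x = 1 by rewrite /dot xx mxE.
have [u uu Hu] := normalize_any (xl x); have [v vv Hv] := normalize_any (xr x).
exists (Num.sqrt (dot (xl x) (xl x))), (Num.sqrt (dot (xr x) (xr x))), u, v.
split; rewrite ?sqrtr_ge0 // !sqr_sqrtr ?dot_ge0 //; split; first by rewrite -dot5.
by rewrite [LHS]row5_eta {1}Hu {1}Hv.
Qed.

End Adapted.

(** * Connection forms that vanish at a point *)

Section MatrixCalculus.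
Variable R : realType.
Implicit Types E F : normedModType R.

Lemma trmx_scale m n a (A : 'M[R]_(m, n)) : (a *: A)^T = a *: A^T.
Proof. exact: linearZ. Qed.

Lemma trmx_sub m n (A B : 'M[R]_(m, n)) : (A - B)^T = A^T - B^T.
Proof. exact: linearB. Qed.

Lemma is_derive_unique E F (f : E -> F) x v a b : is_derive x v f a -> is_derive x v f b -> a = b.
Proof. by move=> [_ <-] [_ <-]. Qed.

Lemma is_derive_linear E F (f : E -> F) (G : normedModType R) (l : F -> G) x v d :
  findim F -> linear l -> is_derive x v f d -> is_derive x v (fun y => l (f y)) (l d).
Proof.
move=> fF ll; apply: (@is_derive_lin _ _ _ _ f (linfn ll)).
exact: linear_continuous_findim.
Qed.

Lemma is_derive_trmx E m n (f : E -> 'M[R]_(m, n)) x v d :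
  is_derive x v f d -> is_derive x v (fun y => (f y)^T) d^T.
Proof.
apply: (is_derive_linear (l := @trmx R m n)); first exact: findim_mx.
by move=> a A B; rewrite linearP.
Qed.

Lemma is_derive_mulmx E m n p (f : E -> 'M[R]_(m, n)) (g : E -> 'M[R]_(n, p)) x v df dg :
  is_derive x v f df -> is_derive x v g dg ->
  is_derive x v (fun y => f y *m g y) (df *m g x + f x *m dg).
Proof.
move=> hf hg.
have sumE (A : 'M[R]_(m, n)) (B : 'M[R]_(n, p)) :
    A *m B = \sum_(i : 'I_m * 'I_n) A i.1 i.2 *: (delta_mx i.1 i.2 *m B).
  rewrite {1}(matrix_sum_delta A) pair_bigA mulmx_suml; apply: eq_bigr => i _.
  by rewrite -scalemxAl.
have -> : (fun y => f y *m g y) =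
    (fun y => \sum_(i : 'I_m * 'I_n) f y i.1 i.2 *: (delta_mx i.1 i.2 *m g y)).
  by apply/funext => y; exact: sumE.
rewrite !sumE -big_split /=; apply: is_derive_bigsum => i.
apply: (@is_derive_scale _ _ _ (fun y => f y i.1 i.2 : R^o) (fun y => delta_mx i.1 i.2 *m g y)).
  apply: (is_derive_linear (l := fun A : 'M[R]_(m, n) => A i.1 i.2 : R^o)) => //.
    exact: findim_mx.
  by move=> a A B; rewrite !mxE.
apply: (is_derive_linear (l := mulmx (delta_mx i.1 i.2))) => //; first exact: findim_mx.
by move=> a A B; rewrite linearP.
Qed.

Lemma is_derive_add E F (f g : E -> F) x v df dg :
  is_derive x v f df -> is_derive x v g dg -> is_derive x v (fun y => f y + g y) (df + dg).
Proof. exact: is_deriveD. Qed.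

Lemma is_derive_near E F (f g : E -> F) (V : set E) x v df dg : open V -> V x ->
  (forall y, V y -> f y = g y) -> is_derive x v f df -> is_derive x v g dg -> df = dg.
Proof.
by move=> oV Vx fg /(near_is_derive oV Vx fg) hf hg; exact: is_derive_unique hf hg.
Qed.

End MatrixCalculus.

(** * Determinants of reflections *)

Section Reflections.
Variable R : comNzRingType.

(** Sylvester's identity, by conjugating one block triangular matrix into another. A reflection is
    the identity plus a matrix of rank one. *)
Lemma det_1_plus m n (A : 'M[R]_(m, n)) (B : 'M[R]_(n, m)) :
  \det (1%:M + A *m B) = \det (1%:M + B *m A).
Proof.
have e : block_mx 1%:M 0 B 1%:M *m block_mx (1%:M + A *m B) A 0 1%:M *m block_mx 1%:M 0 (- B) 1%:M =
    block_mx 1%:M A 0 (1%:M + B *m A).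
  rewrite !mulmx_block !(mul1mx, mulmx1, mul0mx, mulmx0, addr0, add0r).
  congr block_mx; first by rewrite mulmxN addrK.
    rewrite mulmxN mulmxDl mul1mx opprD mulmxDr mulmx1 !mulmxA.
    by rewrite -opprD (addrC B) subrr.
  by rewrite addrC.
have := congr1 determinant e.
by rewrite !det_mulmx !det_lblock !det_ublock !det1 !mul1r !mulr1.
Qed.

End Reflections.

(** * Parallel transport of a coframe along great circles *)

Section LocalCoframe.
Variable R : realType.
Variables (x0 : 'rV[R]_5) (b0 : 'M[R]_(4, 5)).
Hypothesis ob0 : oriented_coframe x0 b0.

Let V : set 'rV[R]_5 := [set y | 0 < dot y x0].
(** Radial projection to the sphere: the coframe must be smooth on an open subset of R^5, as the
    exterior derivatives in [connection_forms] are ambient ones. *)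
Definition unitize (y : 'rV[R]_5) : 'rV[R]_5 := (Num.sqrt (dot y y))^-1 *: y.
(* Parallel transport of b0 along the great circle from x0 to y / |y|. *)
Definition transport (y : 'rV[R]_5) : 'M[R]_(4, 5) :=
  b0 - (1 + dot (unitize y) x0)^-1 *: (b0 *m (unitize y)^T *m (unitize y + x0)).

Let oP := (oriented_coframeP x0 b0).1 ob0.

Lemma smooth_dot (E : normedModType R) n (U : set E) (f g : E -> 'rV[R]_n) : open U ->
  smooth_open U f -> smooth_open U g -> smooth_open U (fun y => dot (f y) (g y) : R^o).
Proof.
move=> oU sf sg; apply: smooth_entry => //; apply: smooth_mulmx => //; exact: smooth_trmx.
Qed.

Lemma half_space_open : open V.
Proof.
have c : smooth_open setT (fun y : 'rV[R]_5 => dot y x0 : R^o).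
  apply: smooth_dot; [exact: openT|apply: smooth_id; exact: findim_mx|exact: smooth_cst].
rewrite -[V]setTI; apply: (@preimage_open _ _ R^o setT [set t : R | 0 < t]).
- exact: openT.
- exact: open_gt.
- by move=> y _; exact: smooth_continuous c _.
Qed.

Lemma half_space_norm y : V y -> 0 < dot y y.
Proof. by rewrite dot_gt0; apply: contraTneq => ->; rewrite dot0l ltxx. Qed.

Lemma unitize_unit y : 0 < dot y y -> dot (unitize y) (unitize y) = 1.
Proof.
move=> y0; rewrite dotZl dotZr mulrA -invfM -expr2 sqr_sqrtr ?ltW // mulVf // gt_eqF //.
Qed.

Lemma unitizeK y : 0 < dot y y -> Num.sqrt (dot y y) *: unitize y = y.
Proof. by move=> y0; rewrite scalerA mulfV ?scale1r // gt_eqF // sqrtr_gt0. Qed.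

Lemma unitize_id y : dot y y = 1 -> unitize y = y.
Proof. by move=> yy; rewrite /unitize yy sqrtr1 invr1 scale1r. Qed.

Lemma unitize_half y : V y -> 0 < dot (unitize y) x0.
Proof. by move=> Vy; rewrite dotZl mulr_gt0 // invr_gt0 sqrtr_gt0 half_space_norm. Qed.

Lemma smooth_unitize : smooth_open V unitize.
Proof.
have oV := half_space_open.
have si : smooth_open V (fun y : 'rV[R]_5 => y) by apply: smooth_id; exact: findim_mx.
apply: (smoothZ (a := fun y => (Num.sqrt (dot y y))^-1 : R^o)) => //.
apply: smoothV => //.
  by move=> y Vy; rewrite gt_eqF // sqrtr_gt0 half_space_norm.
apply: smooth_sqrt => //; first by move=> y; exact: half_space_norm.
exact: smooth_dot.
Qed.

Lemma smooth_transport : smooth_open V transport.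
Proof.
have oV := half_space_open; have sh := smooth_unitize.
apply: smoothB => //; first exact: smooth_cst.
apply: (smoothZ (a := fun y => (1 + dot (unitize y) x0)^-1 : R^o)) => //.
  apply: smoothV => //.
    by move=> y Vy; rewrite gt_eqF // addr_gt0 // unitize_half.
  apply: (@smoothD _ _ R^o) => //; first exact: smooth_cst.
  by apply: smooth_dot => //; exact: smooth_cst.
apply: smooth_mulmx => //; last by apply: smoothD => //; exact: smooth_cst.
by apply: smooth_mulmx => //; [exact: smooth_cst|exact: smooth_trmx].
Qed.

(** The transport is the product of the reflections along [x0] and along [x0 + h], a rotation that
    takes [x0] to [h]; the two determinants -1 preserve the orientation. *)
Lemma transport_oriented y : V y -> oriented_coframe (unitize y) (transport y).
Proof.
move=> Vy; have [xx bb bx db] := oP.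
have hh := unitize_unit (half_space_norm Vy); have hx := unitize_half Vy.
rewrite /transport; move: (unitize y) hh hx => h hh hx {Vy y}.
set k := 1 + dot h x0.
have k0 : k != 0 by rewrite gt_eqF // addr_gt0.
pose m := x0 + h.
have x01 : dot x0 x0 = 1 by rewrite /dot xx mxE.
(* This makes [k^-1] the factor of the reflection along [m]. *)
have mm : dot m m = 2 * k.
  by rewrite /m !(dotDl, dotDr) x01 hh (dotC x0) /k; ring.
have xm : dot x0 m = k by rewrite /m dotDr x01 dotC.
have e : col_mx h (b0 - k^-1 *: (b0 *m h^T *m (h + x0))) = (col_mx x0 b0 : 'M[R]_5) *m
   ((1%:M + (- 2 *: x0)^T *m x0) *m (1%:M + (- k^-1 *: m)^T *m m)).
  rewrite mulmxA (mul_col_mx x0 b0).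
  have -> : x0 *m (1%:M + (- 2 *: x0)^T *m x0) = - x0.
    rewrite mulmxDr mulmx1 linearZ /= -scalemxAl -scalemxAr mulmxA xx mul1mx.
    by apply/rowP => j; rewrite !mxE; ring.
  have -> : b0 *m (1%:M + (- 2 *: x0)^T *m x0) = b0.
    by rewrite mulmxDr mulmx1 linearZ /= -scalemxAl -scalemxAr mulmxA bx mul0mx scaler0 addr0.
  rewrite (mul_col_mx (- x0) b0); congr col_mx.
    rewrite mulmxDr mulmx1 linearZ /= -scalemxAl -scalemxAr mulmxA mulNmx dotE xm.
    rewrite mulNmx mul_scalar_mx scalerN scaleNr opprK scalerA mulVf // scale1r.
    by rewrite /m addrA addNr add0r.
  rewrite [RHS]mulmxDr mulmx1 trmx_scale -scalemxAl -scalemxAr mulmxA scaleNr.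
  have -> : b0 *m m^T = b0 *m h^T by rewrite /m linearD mulmxDr bx add0r.
  by rewrite /m (addrC x0).
have d1 : \det (1%:M + (- 2 *: x0)^T *m x0) = -1.
  by rewrite det_1_plus trmx_scale -scalemxAr xx det_mx11 !mxE /=; ring.
have d2 : \det (1%:M + (- k^-1 *: m)^T *m m) = -1.
  by rewrite det_1_plus trmx_scale -scalemxAr dotE mm det_mx11 !mxE /=; field.
apply/oriented_coframeP; split.
- by rewrite dotE hh.
- have bm : b0 *m (h + x0)^T = b0 *m h^T by rewrite linearD mulmxDr bx addr0.
  have mb : (h + x0) *m b0^T = (b0 *m h^T)^T by rewrite -bm trmx_mul trmxK.
  rewrite trmx_sub trmx_scale trmx_mul mulmxBl !mulmxBr bb -!scalemxAl -!scalemxAr.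
  rewrite !mulmxA bm -(mulmxA (b0 *m h^T) (h + x0) b0^T) mb.
  have mm' : dot (h + x0) (h + x0) = 2 * k by rewrite addrC.
  rewrite -(mulmxA _ (h + x0) (h + x0)^T) dotE mm' mul_mx_scalar -scalemxAl !scalerA.
  have -> : k^-1 * (k^-1 * (2 * k)) = k^-1 + k^-1 by field.
  move: (b0 *m h^T *m _) => X; apply/matrixP => i j; rewrite !mxE; ring.
- have hk : (h + x0) *m h^T = k%:M by rewrite mulmxDl !dotE hh (dotC x0) -raddfD.
  by rewrite mulmxBl -scalemxAl -(mulmxA (b0 *m h^T)) hk mul_mx_scalar scalerA mulVf // scale1r subrr.
- by rewrite e !det_mulmx d1 d2 db; ring.
Qed.

Lemma local_coframe_transport : local_coframe V transport.
Proof.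
split; [exact: half_space_open|exact: smooth_transport|].
move=> y Vy yy; have y1 : dot y y = 1 by rewrite /dot yy mxE.
by have := transport_oriented Vy; rewrite unitize_id.
Qed.

Lemma transport_center : V x0 /\ transport x0 = b0.
Proof.
have [xx bb bx db] := oP; have x1 : dot x0 x0 = 1 by rewrite /dot xx mxE.
split; first by rewrite /V /= x1.
by rewrite /transport unitize_id // bx mul0mx scaler0 subr0.
Qed.

(** The derivative is normal to the sphere: to first order the coframe is parallel at [x0]. *)
Lemma derive_transport_center u : is_derive x0 u transport (- (b0 *m u^T *m x0)).
Proof.
have [xx bb bx db] := oP; have x1 : dot x0 x0 = 1 by rewrite /dot xx mxE.
have oV := half_space_open; have [Vx0 _] := transport_center.
have dh := smooth_is_derive u smooth_unitize Vx0.
set d := 'D_u unitize x0 in dh.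
(* As [y] is a multiple of [unitize y], the derivative [d] differs from [u] by a multiple of [x0],
   which [b0] annihilates. *)
have bd : b0 *m d^T = b0 *m u^T.
  have sn : smooth_open V (fun y : 'rV[R]_5 => Num.sqrt (dot y y) : R^o).
    apply: smooth_sqrt => //; first by move=> y; exact: half_space_norm.
    by apply: smooth_dot => //; apply: smooth_id; exact: findim_mx.
  have hs := is_derive_scale (smooth_is_derive u sn Vx0) dh.
  have idE y : V y -> y = Num.sqrt (dot y y) *: unitize y.
    by move=> Vy; rewrite unitizeK // half_space_norm.
  rewrite [in RHS](is_derive_near oV Vx0 idE (is_derive_id x0 u) hs) unitize_id // x1 sqrtr1 scale1r.
  by rewrite linearD mulmxDr linearZ /= -scalemxAr bx scaler0 add0r.
have sk : smooth_open V (fun y => (1 + dot (unitize y) x0)^-1 : R^o).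
  apply: smoothV => //.
    by move=> y Vy; rewrite gt_eqF // addr_gt0 // unitize_half.
  apply: (@smoothD _ _ R^o) => //; first exact: smooth_cst.
  by apply: smooth_dot => //; [exact: smooth_unitize|exact: smooth_cst].
have h1 := is_derive_mulmx (is_derive_mulmx (is_derive_cst b0 x0 u) (is_derive_trmx dh))
  (is_derive_add dh (is_derive_cst x0 x0 u)).
have h2 := is_derive_add (is_derive_cst b0 x0 u)
  (is_deriveN (is_derive_scale (smooth_is_derive u sk Vx0) h1)).
move: h2; rewrite !unitize_id // bx !mul0mx scaler0 !add0r addr0 bd x1.
rewrite mulmxDr scalerDr -scalerDl.
have -> : (1 + 1)^-1 + (1 + 1)^-1 = 1 :> R by field.
by rewrite scale1r.
Qed.

Lemma derive_unitize_center u : dot x0 x0 = 1 -> dot x0 u = 0 -> is_derive x0 u unitize u.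
Proof.
move=> x1 xu; have oV := half_space_open; have Vx0 : V x0 by rewrite /V /= x1.
have dh := smooth_is_derive u smooth_unitize Vx0.
set d := 'D_u unitize x0 in dh.
have sn : smooth_open V (fun y : 'rV[R]_5 => Num.sqrt (dot y y) : R^o).
  apply: smooth_sqrt => //; first by move=> y; exact: half_space_norm.
  by apply: smooth_dot => //; apply: smooth_id; exact: findim_mx.
have hs := is_derive_scale (smooth_is_derive u sn Vx0) dh.
have idE y : V y -> y = Num.sqrt (dot y y) *: unitize y.
  by move=> Vy; rewrite unitizeK // half_space_norm.
have := is_derive_near oV Vx0 idE (is_derive_id x0 u) hs.
rewrite unitize_id // x1 sqrtr1 scale1r => uE.
have h := is_derive_mulmx dh (is_derive_trmx dh).
have u1 y : V y -> 1%:M = unitize y *m (unitize y)^T.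
  by move=> Vy; rewrite dotE unitize_unit // half_space_norm.
have := is_derive_near oV Vx0 u1 (is_derive_cst 1%:M _ _) h.
rewrite unitize_id // => /matrixP/(_ 0 0); rewrite [LHS]mxE [RHS]mxE => /esym h0.
have {}h0 : dot d x0 + dot x0 d = 0 by [].
have dx : dot x0 d = 0 by move: h0; rewrite (dotC d); lra.
move: (xu); rewrite {1}uE dotDr dotZr x1 mulr1 dx addr0 => n0.
by move: uE; rewrite n0 scale0r add0r => {2}->.
Qed.

End LocalCoframe.

(** * Connection forms of a smooth orthonormal coframe *)

Section ConnectionForms.
Variable R : realType.

(* Only the anti-self-dual part of a skew matrix acts on the [Oh k], which
   satisfy the quaternion relations [Oh k, Oh (k + 1)] = 2 Oh (k + 2). *)
Lemma Oh_commutator (w : 'M[R]_4) (k : 'I_3) : w^T = - w ->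
  Oh R k *m w - w *m Oh R k =
  2 *: ((- (\tr (w *m (Oh R (k + 2)%R)^T) / 4)) *: Oh R (k + 1)%R
      - (- (\tr (w *m (Oh R (k + 1)%R)^T) / 4)) *: Oh R (k + 2)%R).
Proof.
move=> wT; pose f (i j : nat) : R := w (inord i) (inord j).
have wE : w = mxn 4 4 f by exact: mxn_eta.
have fN i j : (i < 4)%N -> (j < 4)%N -> f i j = - f j i.
  by move=> hi hj; rewrite /f; have /matrixP/(_ (inord j) (inord i)) := wT; rewrite !mxE => ->.
have f0 i : (i < 4)%N -> f i i = 0.
  by move=> hi; have := fN i i hi hi; lra.
have f10 := fN 1 0 isT isT; have f20 := fN 2 0 isT isT; have f30 := fN 3 0 isT isT.
have f21 := fN 2 1 isT isT; have f31 := fN 3 1 isT isT; have f32 := fN 3 2 isT isT.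
have f00 := f0 0 isT; have f11 := f0 1 isT; have f22 := f0 2 isT; have f33 := f0 3 isT.
move: wE {fN f0}; clearbody f => wE.
have trE j : 2 * - (\tr (w *m (Oh R j)^T) / 4) = match j with
   | 0 => f 2 3 - f 0 1 | 1 => - (f 0 2 + f 1 3) | _ => f 1 2 - f 0 3 end.
  rewrite wE; case: j => [|[|j]];
  rewrite /Oh /mxl tr_mxn4 /= ?(f10,f20,f30,f21,f31,f32,f00,f11,f22,f33); by field.
rewrite scalerBr !scalerA !trE wE.
have [->|->|->] := row3E k; rewrite /= ?modn_small //= /Oh /mxl !mul_mxn4;
apply/matrixP => -[[|[|[|[|i]]]] hi] // [[|[|[|[|j]]]] hj] //;
rewrite !mxE /= ?(f10,f20,f30,f21,f31,f32,f00,f11,f22,f33); ring.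
Qed.

(** On vectors orthogonal to [y] the matrix [D] equals [D *m b^T *m b], so differentiating
    [b^T *m T *m b] amounts to a commutator of [T] with a skew matrix. *)
Lemma commutator_tangent (b D : 'M[R]_(4, 5)) (T : 'M[R]_4) (y v w : 'rV[R]_5) :
  y^T *m y + b^T *m b = 1%:M -> (D *m b^T)^T = - (D *m b^T) ->
  y *m v^T = 0 -> y *m w^T = 0 ->
  v *m (D^T *m T *m b + b^T *m T *m D) *m w^T =
  v *m b^T *m (T *m (D *m b^T) - D *m b^T *m T) *m (b *m w^T).
Proof.
move=> cb WT yv yw.
have Dz (z : 'rV[R]_5) : y *m z^T = 0 -> D *m z^T = D *m b^T *m (b *m z^T).
  move=> yz; rewrite -[in LHS](mul1mx z^T) -cb mulmxDl -(mulmxA y^T) yz mulmx0 add0r.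
  by rewrite !mulmxA.
have zD (z : 'rV[R]_5) : y *m z^T = 0 -> z *m D^T = - (z *m b^T *m (D *m b^T)).
  move=> yz; rewrite -[LHS]trmxK trmx_mul trmxK Dz // trmx_mul WT mulmxN.
  by rewrite trmx_mul trmxK.
rewrite mulmxDr mulmxDl [in RHS]mulmxBr [in RHS]mulmxBl [RHS]addrC; congr (_ + _).
  by rewrite !mulmxA zD // !mulNmx !mulmxA.
by rewrite -!mulmxA Dz // !mulmxA.
Qed.

Variables (V : set 'rV[R]_5) (b : 'rV[R]_5 -> 'M[R]_(4, 5)).
Hypotheses (open_V : open V) (smooth_b : smooth_open V b)
  (b_orth : forall y, V y -> b y *m (b y)^T = 1%:M)
  (b_oriented : forall y, V y -> y *m y^T = 1%:M -> oriented_coframe y (b y)).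

(** The component along [Oh k] of the skew matrix that describes the motion of the coframe, with the
    sign and the factor of [Oh_commutator]. *)
Definition rho_of (k : 'I_3) (y : 'rV[R]_5) : 'rV[R]_5 :=
  \row_m - (\tr ('D_(delta_mx 0 m) b y *m (b y)^T *m (Oh R k)^T) / 4).

Lemma db_skew y u : V y -> ('D_u b y *m (b y)^T)^T = - ('D_u b y *m (b y)^T).
Proof.
move=> Vy; have d := smooth_is_derive u smooth_b Vy.
have h := is_derive_mulmx d (is_derive_trmx d).
have := is_derive_near open_V Vy (fun y Vy => esym (b_orth Vy)) (is_derive_cst 1%:M y u) h.
by move=> /eqP; rewrite eq_sym addrC addr_eq0 trmx_mul trmxK => /eqP.
Qed.

Lemma rho_ofE k y u : V y ->
  eval1 (rho_of k y) u = - (\tr ('D_u b y *m (b y)^T *m (Oh R k)^T) / 4).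
Proof.
move=> Vy; rewrite /eval1 mxE.
have {2}-> : u = \sum_m u 0 m *: delta_mx 0 m by rewrite [LHS]row_sum_delta.
rewrite (derive_sum_coord _ _ (findim_mx _ _ _) (findim_mx _ _ _) open_V Vy (smooth_b 1%N)).
rewrite !mulmx_suml (linear_sum (@mxtrace R 4)) /= mulr_suml -sumrN; apply: eq_bigr => m _.
by rewrite /rho_of !mxE -!scalemxAl mxtraceZ; ring.
Qed.

Lemma derive_Omega k y u : V y ->
  is_derive y u (fun y => Omega k (b y)) (('D_u b y)^T *m Oh R k *m b y + (b y)^T *m Oh R k *m 'D_u b y).
Proof.
move=> Vy; have d := smooth_is_derive u smooth_b Vy.
have -> : (fun y => Omega k (b y)) = (fun y => (b y)^T *m Oh R k *m b y).
  by apply/funext => z; rewrite OmegaE.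
have := is_derive_mulmx (is_derive_mulmx (is_derive_trmx d) (is_derive_cst (Oh R k) y u)) d.
by rewrite mulmx0 addr0.
Qed.

(** The covariant derivative of the basis of forms in a single direction [u]. It is stronger than
    the structure equations, which are its alternating sum. *)
Lemma derive_Omega_tangent k y u v w : V y -> y *m y^T = 1%:M -> y *m v^T = 0 -> y *m w^T = 0 ->
  eval2 ('D_u (fun y => Omega k (b y)) y) v w =
  2 * (eval1 (rho_of (k + 2) y) u * eval2 (Omega (k + 1) (b y)) v w)
  - 2 * (eval1 (rho_of (k + 1) y) u * eval2 (Omega (k + 2) (b y)) v w).
Proof.
move=> Vy yy yv yw; have [_ ->] := derive_Omega k u Vy.
have WT := db_skew u Vy.
rewrite /eval2 !rho_ofE // (commutator_tangent _ (coframe_complete (b_oriented Vy yy)) WT yv yw).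
rewrite (Oh_commutator _ WT) !OmegaE.
rewrite -scalemxAr -scalemxAl mxE mulmxBr mulmxBl -!scalemxAr -!scalemxAl !mulmxA !mxE.
ring.
Qed.

Lemma connection_rho_of : connection_forms V b rho_of.
Proof.
move=> y Vy yy u v w yu yv yw k /=.
have e1 := derive_Omega_tangent k u Vy yy yv yw.
have e2 := derive_Omega_tangent k v Vy yy yu yw.
have e3 := derive_Omega_tangent k w Vy yy yu yv.
apply: etrans (f_equal2 +%R (f_equal2 (fun a b => a - b) e1 e2) e3) _.
rewrite {e1 e2 e3} /wedge12.
move: (eval1 (rho_of (k + 2) y)) (eval1 (rho_of (k + 1) y)) => r2 r1.
move: (eval2 (Omega (k + 1) (b y))) (eval2 (Omega (k + 2) (b y))) => O1 O2; ring.
Qed.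

End ConnectionForms.

(** * The G2-structure in an adapted frame *)

Section TangentSpace.
Variable R : realType.
Implicit Types (c : R) (p : amb R).

Definition Mc c : set (amb R) := [set p | M p /\ 0 < c + rad2 p.2].

Lemma findim_amb : findim (amb R : normedModType R).
Proof. by apply: findim_prod; exact: findim_mx. Qed.

Lemma trmx_add m n (A B : 'M[R]_(m, n)) : (A + B)^T = A^T + B^T.
Proof. exact: linearD. Qed.

(** The rate of change of the form [A] under parallel transport when its base point moves with
    velocity [u]: the two terms keep the normal direction in the kernel. *)
Definition hor (x : 'rV[R]_5) (A : 'M[R]_5) (u : 'rV[R]_5) : 'M[R]_5 :=
  - (x^T *m u *m A + A *m u^T *m x).

Lemma horD x A u v : hor x A (u + v) = hor x A u + hor x A v.
Proof. by rewrite /hor trmx_add mulmxDr mulmxDl mulmxDr mulmxDl addrACA opprD. Qed.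

Lemma horZ x A a u : hor x A (a *: u) = a *: hor x A u.
Proof. by rewrite /hor trmx_scale -scalemxAr -!scalemxAl -scalemxAr -!scalemxAl -scalerDr scalerN. Qed.

Lemma hor_sum x u (a : 'I_3 -> R) (Om : 'I_3 -> 'M[R]_5) :
  hor x (\sum_k a k *: Om k) u = \sum_k a k *: hor x (Om k) u.
Proof.
elim/big_rec2: _ => [|i A B _ <-]; first by rewrite /hor mulmx0 !mul0mx addr0 oppr0.
rewrite /hor mulmxDr !mulmxDl -!scalemxAr -!scalemxAl scalerN scalerDr.
by rewrite addrACA opprD.
Qed.

Section AtPoint.
Variables (c : R) (p : amb R) (b0 : 'M[R]_(4, 5)).
Hypotheses (Xp : Mc c p) (ob0 : oriented_coframe p.1 b0).
Let x0 := p.1.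
Let A0 := p.2.
Let V : set 'rV[R]_5 := [set y | 0 < dot y x0].
Let b := transport x0 b0.
Let V2 : set (amb R) := [set q | V q.1].

Let oP := (oriented_coframeP x0 b0).1 ob0.

Lemma b_orth y : V y -> b y *m (b y)^T = 1%:M.
Proof. by move=> /(transport_oriented ob0) /oriented_coframeP[]. Qed.

Lemma b_oriented y : V y -> y *m y^T = 1%:M -> oriented_coframe y (b y).
Proof.
move=> Vy yy; have := transport_oriented ob0 Vy; rewrite unitize_id //.
by rewrite /dot yy mxE.
Qed.

Let oV : open V := @half_space_open R x0.
Let sb : smooth_open V b := smooth_transport x0 b0.
Let Vx0 : V x0 := (transport_center ob0).1.
Let bx0 : b x0 = b0 := (transport_center ob0).2.

Lemma local_frame_forms : local_coframe V b /\ connection_forms V b (rho_of b).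
Proof.
split; first exact: local_coframe_transport.
exact: (connection_rho_of oV sb b_orth b_oriented).
Qed.

Lemma rho_of_center k u : eval1 (rho_of b k x0) u = 0.
Proof.
rewrite (rho_ofE oV sb) //; have [_ ->] := derive_transport_center ob0 u.
rewrite bx0; have [_ _ bx _] := oP.
have xb : x0 *m b0^T = 0 by rewrite -[x0]trmxK -trmx_mul bx trmx0.
rewrite mulNmx -(mulmxA _ x0 b0^T) xb mulmx0 oppr0 mul0mx.
by rewrite mxtrace0 mul0r oppr0.
Qed.

Lemma derive_Omega_center k u :
  is_derive x0 u (fun y => Omega k (b y)) (hor x0 (Omega k b0) u).
Proof.
have := derive_Omega sb k u Vx0.
have [_ ->] := derive_transport_center ob0 u; rewrite bx0 /hor OmegaE.
rewrite linearN /= !mulNmx mulmxN !trmx_mul trmxK -opprD.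
by rewrite !mulmxA.
Qed.

Lemma smooth_Omega k : smooth_open V (fun y => Omega k (b y)).
Proof.
have -> : (fun y => Omega k (b y)) = (fun y => (b y)^T *m Oh R k *m b y).
  by apply/funext => z; rewrite OmegaE.
apply: smooth_mulmx => //; apply: smooth_mulmx => //; first exact: smooth_trmx.
exact: smooth_cst.
Qed.

Lemma open_V2 : open V2.
Proof.
rewrite -[V2]setTI; apply: (@preimage_open _ _ _ setT V fst openT oV).
by move=> q _; exact: cvg_fst.
Qed.

Lemma smooth_fibre_coord k : smooth_open V2 (fibre_coord b k).
Proof.
have oV2 := open_V2; have fF := findim_mx R 1 5; have fG := findim_mx R 5 5.
have sid : smooth_open V2 (fun q : amb R => q) by apply: smooth_id; exact: findim_amb.
apply: (smoothM (f := fun q => \tr (q.2 *m (Omega k (b q.1))^T) : R^o)) => //.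
  apply: smooth_tr => //; apply: smooth_mulmx => //; first exact: smooth_snd.
  apply: smooth_trmx => //.
  apply: (smooth_comp (W := V) (g := fun y => Omega k (b y))) => //; first exact: smooth_fst.
  exact: smooth_Omega.
exact: smooth_cst.
Qed.

Lemma fibre_coordE (q : amb R) (a : 'I_3 -> R) k : V q.1 -> q.2 = \sum_k a k *: Omega k (b q.1) ->
  fibre_coord b k q = a k.
Proof.
move=> Vq qE; rewrite /fibre_coord qE mulmx_suml (linear_sum (@mxtrace R 5)) /= (bigD1 k) //=.
rewrite big1 => [|j jk].
  by rewrite -scalemxAl linearZ /= tr_Omega ?b_orth // eqxx addr0 mulr1n mulfK // pnatr_eq0.
by rewrite -scalemxAl linearZ /= tr_Omega ?b_orth // (negbTE jk) mulr0.
Qed.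

Lemma M_fibre_coord q : M q -> V q.1 -> q.2 = \sum_k fibre_coord b k q *: Omega k (b q.1).
Proof.
move=> Mq Vq; have [a Ha] := M_coframe Mq (b_oriented Vq (M_unit Mq)).
by rewrite {1}Ha; apply: eq_bigr => k _; rewrite (fibre_coordE k Vq Ha).
Qed.

Lemma tangent_fwd (u : amb R) : tangent (Mc c) p u -> dot x0 u.1 = 0 /\
  u.2 = hor x0 A0 u.1 + \sum_k 'D_u (fibre_coord b k) p *: Omega k b0.
Proof.
move=> [I [gam [oI I0 sg Mg [g0 dg]]]].
have Mg' t : I t -> M (gam t) by move=> /Mg [].
have fF := findim_mx R 1 5; have fG := findim_mx R 5 5.
have d1 : is_derive (0 : R^o) (1 : R^o) (fun t => (gam t).1) u.1.
  by apply: (is_derive_linear (l := fst)) dg; first exact: findim_amb.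
have d2 : is_derive (0 : R^o) (1 : R^o) (fun t => (gam t).2) u.2.
  by apply: (is_derive_linear (l := snd)) dg; first exact: findim_amb.
split.
  have h := is_derive_mulmx d1 (is_derive_trmx d1).
  have := is_derive_near oI I0 (fun t It => esym (M_unit (Mg' t It))) (is_derive_cst 1%:M _ _) h.
  rewrite g0 => /matrixP/(_ 0 0); rewrite [LHS]mxE [RHS]mxE => /esym h0.
  have : dot u.1 x0 + dot x0 u.1 = 0 by [].
  rewrite (dotC u.1); lra.
pose J := I `&` gam @^-1` V2.
have oJ : open J by apply: preimage_open => //; [exact: open_V2|move=> x; exact: smooth_continuous].
have J0 : J 0 by split; rewrite //= g0.
have Vg0 : V2 (gam 0) by rewrite g0.
have da k : is_derive (0 : R^o) (1 : R^o) (fun t => fibre_coord b k (gam t)) ('D_u (fibre_coord b k) (gam 0)).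
  exact: (chain findim_amb (findim_R R) open_V2 Vg0 (smooth_fibre_coord k 1%N) dg).
have Vx : V (gam 0).1 by rewrite g0.
have dO k : is_derive (0 : R^o) (1 : R^o) (fun t => Omega k (b (gam t).1))
    ('D_u.1 (fun y => Omega k (b y)) (gam 0).1).
  exact: (chain (g := fun y => Omega k (b y)) (f := fun t => (gam t).1) fF fG oV Vx (smooth_Omega k 1%N) d1).
have h : is_derive (0 : R^o) (1 : R^o)
    (fun t => \sum_k fibre_coord b k (gam t) *: Omega k (b (gam t).1)) _
  := is_derive_bigsum (fun k => is_derive_scale (da k) (dO k)).
have -> := is_derive_near oJ J0 (fun t Jt => M_fibre_coord (Mg' t Jt.1) Jt.2) d2 h.
rewrite g0 bx0 big_split addrC /=; congr (_ + _).
have -> : A0 = \sum_k fibre_coord b k p *: Omega k b0.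
  by rewrite -bx0; apply: M_fibre_coord => //; case: Xp.
rewrite hor_sum; apply: eq_bigr => k _.
by have [_ ->] := derive_Omega_center k u.1.
Qed.

Lemma tangent_bwd u1 (a : 'I_3 -> R) : dot x0 u1 = 0 ->
  tangent (Mc c) p (u1, hor x0 A0 u1 + \sum_k a k *: Omega k b0).
Proof.
move=> xu; have [xx _ _ _] := oP; have x1 : dot x0 x0 = 1 by rewrite /dot xx mxE.
pose a0 k := fibre_coord b k p.
have A0E : A0 = \sum_k a0 k *: Omega k b0.
  by rewrite -bx0; apply: M_fibre_coord => //; case: Xp.
(* The point moves along a line that [unitize] pushes back to the sphere, while the fibre
   coordinates in the transported coframe are affine in [t]. *)
pose line (t : R^o) : 'rV[R]_5 := t *: u1 + x0.
pose al k (t : R^o) : R^o := a0 k + t * a k.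
pose gam (t : R^o) : amb R := (unitize (line t), \sum_k al k t *: Omega k (b (line t))).
(* Restricting the time keeps c + r^2 positive, so that the curve stays in [Mc c]. *)
pose I : set R^o := [set t | 0 < c + \sum_k al k t ^+ 2].
have fF := findim_mx R 1 5; have fG := findim_mx R 5 5.
have fR := findim_R R.
have Vl t : V (line t) by rewrite /V /= dotDl dotZl (dotC u1) xu mulr0 add0r x1.
have sl : smooth_open setT line.
  apply: smoothD; [exact: openT| |exact: smooth_cst].
  by apply: smoothZ; [exact: openT|exact: smooth_id|exact: smooth_cst].
have sal k : smooth_open setT (al k).
  apply: (@smoothD _ _ R^o); [exact: openT|exact: smooth_cst|].
  by apply: smoothM; [exact: openT|exact: smooth_id|exact: smooth_cst].
have sx : smooth_open setT (fun t => unitize (line t)).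
  by apply: (smooth_comp fF fF openT oV _ sl (@smooth_unitize R x0)) => t _; exact: Vl.
have sO k : smooth_open setT (fun t => Omega k (b (line t))).
  by apply: (smooth_comp fF fG openT oV _ sl (smooth_Omega k)) => t _; exact: Vl.
have sA : smooth_open setT (fun t => \sum_k al k t *: Omega k (b (line t))).
  apply: smooth_sum; first exact: openT.
  by move=> k; apply: smoothZ; [exact: openT|exact: sal|exact: sO].
have sg : smooth_open setT gam by apply: (smooth_pair (f := fun t => unitize (line t))) => //; exact: openT.
have sI : smooth_open setT (fun t => c + \sum_k al k t ^+ 2 : R^o).
  apply: (@smoothD _ _ R^o); [exact: openT|exact: smooth_cst|].
  apply: (@smooth_sum _ _ R^o _ _ (fun k t => al k t ^+ 2)); first exact: openT.
  by move=> k; apply: smoothX; [exact: openT|exact: sal].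
have oI : open I.
  rewrite -[I]setTI; apply: (@preimage_open _ _ R^o setT [set t : R | 0 < t]).
  - exact: openT.
  - exact: open_gt.
  - by move=> t _; exact: smooth_continuous sI _.
have rg t : rad2 (gam t).2 = \sum_k al k t ^+ 2.
  by rewrite /gam /= rad2_Omega // b_orth.
have l0 : line 0 = x0 by rewrite /line scale0r add0r.
have al0 k : al k 0 = a0 k by rewrite /al mul0r addr0.
have gam0 : gam 0 = p.
  rewrite /gam l0 unitize_id // [RHS]surjective_pairing; congr pair.
  by rewrite [RHS]A0E bx0; apply: eq_bigr => k _; rewrite al0.
exists I, gam; split=> //.
- by rewrite /I /= -rg gam0; case: Xp.
- by apply: smooth_sub sg.
- move=> t It; split; last by rewrite rg.
  exists (b (line t)); split; first exact: (transport_oriented ob0 (Vl t)).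
  by exists (\row_k al k t); apply: eq_bigr => k _; rewrite mxE.
split=> //.
have dl : is_derive (0 : R^o) (1 : R^o) line u1.
  have h := is_derive_add (is_derive_scale (is_derive_id (0 : R^o) (1 : R^o)) (is_derive_cst u1 (0 : R^o) (1 : R^o))) (is_derive_cst x0 (0 : R^o) (1 : R^o)).
  by move: h; rewrite scaler0 !addr0 scale1r.
have dal k : is_derive (0 : R^o) (1 : R^o) (al k) (a k).
  have h := is_derive_add (is_derive_cst (a0 k : R^o) (0 : R^o) (1 : R^o)) (is_derive_scale (is_derive_id (0 : R^o) (1 : R^o)) (is_derive_cst (a k : R^o) (0 : R^o) (1 : R^o))).
  by move: h; rewrite scaler0 addr0 add0r scale1r.
have V0 : V (line 0) by exact: Vl.
have dO k : is_derive (0 : R^o) (1 : R^o) (fun t => Omega k (b (line t))) (hor x0 (Omega k b0) u1).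
  have := chain (g := fun y => Omega k (b y)) fF fG oV V0 (smooth_Omega k 1%N) dl; rewrite l0.
  by have [_ ->] := derive_Omega_center k u1.
have dA : is_derive (0 : R^o) (1 : R^o) (fun t => \sum_k al k t *: Omega k (b (line t)))
   (hor x0 A0 u1 + \sum_k a k *: Omega k b0).
  have h := is_derive_bigsum (fun k => is_derive_scale (dal k) (dO k)).
  move: h; rewrite l0 bx0 big_split addrC /=.
  have -> // : \sum_i al i 0 *: hor x0 (Omega i b0) u1 = hor x0 A0 u1.
  by rewrite A0E hor_sum; apply: eq_bigr => k _; rewrite al0.
have dx : is_derive (0 : R^o) (1 : R^o) (fun t => unitize (line t)) u1.
  have := chain fF fF oV V0 (@smooth_unitize R x0 1%N) dl; rewrite l0.
  by have [_ ->] := derive_unitize_center x1 xu.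
have := is_derive_add
  (is_derive_linear (l := fun y : 'rV[R]_5 => (y, 0 : 'M[R]_5)) fF _ dx)
  (is_derive_linear (l := fun y : 'M[R]_5 => (0 : 'rV[R]_5, y)) fG _ dA).
have -> : (fun t => (unitize (line t), 0 : 'M[R]_5) + (0 : 'rV[R]_5, \sum_k al k t *: Omega k (b (line t)))) = gam.
  by apply/funext => t; congr pair; rewrite /= ?addr0 ?add0r.
have -> : (u1, 0 : 'M[R]_5) + (0, hor x0 A0 u1 + \sum_k a k *: Omega k b0) =
   (u1, hor x0 A0 u1 + \sum_k a k *: Omega k b0) by congr pair; rewrite /= ?addr0 ?add0r.
apply.
  by move=> r y z; congr pair; rewrite /= scaler0 addr0.
by move=> r y z; congr pair; rewrite /= scaler0 addr0.
Qed.

(** Nothing is differentiated: [tangent_bwd] realizes the vector, [tangent_fwd] expresses it by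
    these derivatives, and the coefficients with respect to [Omega k b0] are unique. *)
Lemma derive_fibre_coord u1 (a : 'I_3 -> R) k : dot x0 u1 = 0 ->
  'D_(u1, hor x0 A0 u1 + \sum_k a k *: Omega k b0) (fibre_coord b k) p = a k.
Proof.
move=> xu; have [_ h] := tangent_fwd (tangent_bwd a xu).
move: h; rewrite /fst /snd; set u := (u1, _) => /addrI h.
have E (e : 'I_3 -> R) : fibre_coord b k (x0, \sum_k e k *: Omega k b0) = e k.
  by apply: fibre_coordE => //=; rewrite bx0.
by rewrite -(E (fun k => 'D_u (fibre_coord b k) p)) -h E.
Qed.

Lemma zeta_center u1 (a : 'I_3 -> R) k : dot x0 u1 = 0 ->
  zeta b (rho_of b) p k (u1, hor x0 A0 u1 + \sum_k a k *: Omega k b0) = a k.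
Proof.
move=> xu; rewrite /zeta /= !rho_of_center derive_fibre_coord //.
by rewrite !mulr0 subr0 addr0.
Qed.

Definition scale_G : R := Num.sqrt (Num.sqrt (c + rad2 A0)).

Lemma scale_G_gt0 : 0 < scale_G.
Proof. by rewrite !sqrtr_gt0; case: Xp. Qed.

Lemma scale_G4 : scale_G ^+ 4 = c + rad2 A0.
Proof.
rewrite (exprM _ 2 2) !sqr_sqrtr ?sqrtr_ge0 //.
by case: Xp => _ /ltW.
Qed.

(* In this frame of T_pM, [phi] is [e^k ~ G^-1 zeta_k], [e^(3+i) ~ sqrt 2 G b_i]. *)
Definition frame7 (j : 'I_7) : amb R :=
  match @fintype.split 3 4 j with
  | inl k => (0, scale_G *: Omega k b0)
  | inr i => (Num.sqrt 2 * scale_G)^-1 *: (row i b0, hor x0 A0 (row i b0))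
  end.

Definition vert (y : 'rV[R]_7) : 'rV[R]_3 := @lsubmx R 1 3 4 y.
Definition horz (y : 'rV[R]_7) : 'rV[R]_4 := @rsubmx R 1 3 4 y.
Let kap := (Num.sqrt 2 * scale_G)^-1.

Lemma hor0 x A : hor x A 0 = 0.
Proof. by rewrite /hor trmx0 !mulmx0 !mul0mx addr0 oppr0. Qed.

Lemma frame7_sum (y : 'rV[R]_7) : \sum_j y 0 j *: frame7 j =
  (kap *: (horz y *m b0), hor x0 A0 (kap *: (horz y *m b0)) +
    \sum_k (scale_G * vert y 0 k) *: Omega k b0).
Proof.
rewrite (@big_split_ord _ _ _ 3 4) /=.
have -> : \sum_(i < 3) y 0 (lshift 4 i) *: frame7 (lshift 4 i) =
    (0, \sum_k (scale_G * vert y 0 k) *: Omega k b0) :> amb R.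
  elim/big_rec2: _ => // i A B _ ->.
  rewrite /frame7 (unsplitK (inl _ i)) /vert mxE; congr pair; rewrite /= ?scaler0 ?add0r //.
  by rewrite scalerA mulrC.
have -> : \sum_(i < 4) y 0 (rshift 3 i) *: frame7 (rshift 3 i) =
    (kap *: (horz y *m b0), hor x0 A0 (kap *: (horz y *m b0))) :> amb R.
  rewrite mulmx_sum_row; elim/big_rec2: _ => [|i A B _ ->]; first by rewrite scaler0 hor0.
  rewrite /frame7 (unsplitK (inr _ i)) -/kap scalerDr horD.
  by congr pair; rewrite /= ?horZ !scalerA /horz mxE mulrC.
by congr pair; rewrite /= ?add0r // addrC.
Qed.

Lemma frame7_tangent u : tangent (Mc c) p u <-> exists y : 'rV[R]_7, u = \sum_j y 0 j *: frame7 j.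
Proof.
have G0 := scale_G_gt0.
have k0 : kap != 0 by rewrite invr_eq0 mulf_neq0 // gt_eqF // sqrtr_gt0.
have [_ _ bx _] := oP.
split=> [/tangent_fwd [xu uE]|[y ->]].
  pose y : 'rV[R]_7 := @row_mx R 1 3 4 (\row_k (scale_G^-1 * 'D_u (fibre_coord b k) p))
     (kap^-1 *: (u.1 *m b0^T)).
  exists y; rewrite frame7_sum /vert /horz /y row_mxKl row_mxKr.
  have -> : kap *: (kap^-1 *: (u.1 *m b0^T) *m b0) = u.1.
    rewrite -scalemxAl scalerA mulfV // scale1r -mulmxA -[RHS]mulmx1.
    rewrite -(coframe_complete ob0) mulmxDr !mulmxA.
    have -> : u.1 *m p.1^T = 0 by rewrite dotE dotC xu raddf0.
    by rewrite mul0mx add0r.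
  rewrite [LHS]surjective_pairing uE; congr (_, _ + _).
  by apply: eq_bigr => k _; rewrite mxE mulrA mulfV ?gt_eqF // mul1r.
rewrite frame7_sum; apply: tangent_bwd.
by rewrite dotZr /dot trmx_mul mulmxA -[x0 *m _]trmxK trmx_mul trmxK bx trmx0 mul0mx mxE mulr0.
Qed.

Lemma Oh_form (k : nat) (h h' : 'rV[R]_4) (f g : nat -> R) :
  (forall i : 'I_4, h 0 i = f i) -> (forall i : 'I_4, h' 0 i = g i) ->
  (h *m Oh R k *m h'^T) 0 0 = match k with
   | 0%N => f 0%N * g 1%N - f 1%N * g 0%N - (f 2%N * g 3%N - f 3%N * g 2%N)
   | 1%N => f 0%N * g 2%N - f 2%N * g 0%N - (f 3%N * g 1%N - f 1%N * g 3%N)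
   | _ => f 0%N * g 3%N - f 3%N * g 0%N - (f 1%N * g 2%N - f 2%N * g 1%N) end.
Proof.
move=> hf hg; rewrite !mxE !big_ord_recl !big_ord0 !mxE !big_ord_recl !big_ord0 !hf !hg.
case: k => [|[|k]]; rewrite !mxE /= /bump /=; ring.
Qed.

Lemma powR_G : (c + rad2 A0) `^ (1 / 4) = scale_G /\ (c + rad2 A0) `^ (- (3 / 4)) = scale_G ^- 3.
Proof.
have G0 := scale_G_gt0.
have e : (c + rad2 A0) = scale_G `^ 4%:R by rewrite powR_mulrn ?ltW // scale_G4.
have e' r : (c + rad2 A0) `^ r = scale_G `^ (4%:R * r) by rewrite e -powRrM.
rewrite !e'; split.
  by rewrite div1r mulfV ?pnatr_eq0 // powRr1 // ltW.
by rewrite mulrN mulrCA mulfV ?pnatr_eq0 // mulr1 powRN powR_mulrn // ltW.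
Qed.

Lemma frame7_phi (phi : amb R -> ('I_3 -> amb R) -> R) (Y : 'M[R]_(3, 7)) :
  bryant_salamon c (Mc c) phi ->
  phi p (fun i => \sum_j Y i j *: frame7 j) = phi0 Y.
Proof.
move=> bs; have [lc cf] := local_frame_forms.
have G0 := scale_G_gt0.
have rowE i : \sum_j Y i j *: frame7 j = \sum_j (row i Y) 0 j *: frame7 j.
  by apply: eq_bigr => j _; rewrite mxE.
have T i : tangent (Mc c) p (\sum_j Y i j *: frame7 j).
  by rewrite rowE; apply/frame7_tangent; exists (row i Y).
rewrite (bs V b (rho_of b) lc cf p Xp Vx0 _ T) /local_phi.
have -> : \sum_k fibre_coord b k p ^+ 2 = rad2 A0.
  have -> : A0 = \sum_k fibre_coord b k p *: Omega k b0.
    by rewrite -bx0; apply: M_fibre_coord => //; case: Xp.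
  by rewrite rad2_Omega //; have [] := oP.
have [-> ->] := powR_G.
pose y (i j : nat) : R := Y (inord i) (inord j).
have YE : Y = mxn 3 7 y by exact: mxn_eta.
have hx i : dot x0 (kap *: (horz (row i Y) *m b0)) = 0.
  have [_ _ bx _] := oP.
  by rewrite dotZr /dot trmx_mul mulmxA -[x0 *m _]trmxK trmx_mul trmxK bx trmx0 mul0mx mxE mulr0.
have z i (k : 'I_3) : zeta b (rho_of b) p k (\sum_j Y i j *: frame7 j) = scale_G * y i k.
  rewrite rowE frame7_sum zeta_center // /vert mxE mxE YE mxE //.
have w (k : 'I_3) i j : eval2 (Omega k (b p.1)) (\sum_l Y i l *: frame7 l).1 (\sum_l Y j l *: frame7 l).1 =
    kap ^+ 2 * (horz (row i Y) *m Oh R k *m (horz (row j Y))^T) 0 0.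
  rewrite !rowE !frame7_sum /= /eval2 -/x0 bx0 OmegaE trmx_scale -!scalemxAl -scalemxAr scalerA mxE -expr2.
  congr (_ * _); rewrite trmx_mul !mulmxA; have [_ bb _ _] := oP.
  by rewrite -(mulmxA _ b0 b0^T) bb mulmx1 -(mulmxA _ b0 b0^T) bb mulmx1.
have hh i (m : 'I_4) : horz (row i Y) 0 m = (fun m => y i (3 + m)%N) m.
  by rewrite /horz mxE mxE YE mxE.
(* The factor sqrt 2 in [kap] absorbs the 2 in front of the mixed terms of the form, and the powers
   of G cancel in both kinds of terms. *)
have k2 : 2 * scale_G * scale_G * kap ^+ 2 = 1.
  have s2 : Num.sqrt 2 ^+ 2 = 2 :> R by rewrite sqr_sqrtr.
  rewrite /kap invfM exprMn !exprVn s2; field.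
  by rewrite gt_eqF // pnatr_eq0.
have -> : wedge111 (zeta b (rho_of b) p) (fun i => \sum_j Y i j *: frame7 j) =
   scale_G ^+ 3 * ndet 3 (fun i j => y j i).
  rewrite /wedge111 -det_mxn -detZ; congr (\det _).
  by apply/matrixP => i j; rewrite !mxE z.
rewrite mulrA mulVf ?expf_neq0 ?gt_eqF // mul1r.
have -> : 2 * scale_G * \sum_k wedge12 (zeta b (rho_of b) p k)
    (fun v w => eval2 (Omega k (b p.1)) v.1 w.1) (\sum_j Y 0 j *: frame7 j) (\sum_j Y 1 j *: frame7 j)
    (\sum_j Y 2%:R j *: frame7 j) =
  \sum_(k < 3) wedge12 (fun i : 'I_3 => y i k) (fun i j => (horz (row i Y) *m Oh R k *m (horz (row j Y))^T) 0 0) 0 1 2%:R.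
  rewrite mulr_sumr; apply: eq_bigr => k _; rewrite /wedge12 !z !w.
  move: (_ 0 0) (_ 0 0) (_ 0 0) => a1 a2 a3.
  transitivity (2 * scale_G * scale_G * kap ^+ 2 * (y 0%R k * a3 - y 1%R k * a2 + y 2%:R k * a1)); first ring.
  by rewrite k2 mul1r.
have HF k (i j : 'I_3) := @Oh_form k _ _ (fun m => y i (3 + m)%N) (fun m => y j (3 + m)%N) (hh i) (hh j).
rewrite !big_ord_recl big_ord0 /wedge12 !HF.
rewrite /phi0.
have ef s0 s1 s2 : eform [:: s0; s1; s2] Y = ndet 3 (fun i j => y i (nth 0%N [:: s0; s1; s2] j)).
  by rewrite /eform -det_mxn; congr (\det _); apply/matrixP => i j; rewrite !mxE /y inord_val.
move: {YE z w hh HF} y ef => y ef; rewrite !ef /= /bump /=; ring.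
Qed.

End AtPoint.
End TangentSpace.

(** * The projection and the tangent spaces of its fibres *)

Section CoassociativePlane.
Variable R : realType.

Definition kmat (al be C : R) : 'M[R]_(4, 7) := mxl 4 7
  [:: [:: 0; 0; 1; 0; 0; 0; 0]; [:: 0; 0; 0; 0; 0; 1; 0];
      [:: be; - al; 0; 0; 0; 0; - C]; [:: 0; C; 0; - be; 0; 0; - al]].

Lemma eform_mul s (P : 'M[R]_4) (K : 'M[R]_(4, 7)) : eform s (P *m K) = \det P * eform s K.
Proof.
rewrite /eform -det_mulmx; congr (\det _); apply/matrixP => i j; rewrite !mxE.
by apply: eq_bigr => k _; rewrite !mxE.
Qed.

Lemma psi0_mul (P : 'M[R]_4) (K : 'M[R]_(4, 7)) : psi0 (P *m K) = \det P * psi0 K.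
Proof. rewrite /psi0 !eform_mul; ring. Qed.

Lemma eform_mxl (rs : seq (seq R)) s : all (fun i => (i < 7)%N) s -> size s = 4 ->
  eform s (mxl 4 7 rs) = ndet 4 (fun i j => nth 0 (nth [::] rs i) (nth 0%N s j)).
Proof.
move=> h sz; rewrite /eform -det_mxn; congr (\det _); apply/matrixP => i j; rewrite !mxE inordK //.
by apply: (allP h); rewrite mem_nth // sz.
Qed.

Lemma psi0_kmat al be C : psi0 (kmat al be C) ^+ 2 = (C ^+ 2 + al ^+ 2 + be ^+ 2) ^+ 2.
Proof.
rewrite /psi0 /kmat !eform_mxl //= /bump /=; ring.
Qed.

Lemma gram_kmat al be C : \det (kmat al be C *m (kmat al be C)^T) = (C ^+ 2 + al ^+ 2 + be ^+ 2) ^+ 2.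
Proof.
set D := C ^+ 2 + _ + _.
have -> : kmat al be C *m (kmat al be C)^T =
   mxl 4 4 [:: [:: 1; 0; 0; 0]; [:: 0; 1; 0; 0]; [:: 0; 0; D; 0]; [:: 0; 0; 0; D]].
  apply/matrixP => -[[|[|[|[|i]]]] hi] // [[|[|[|[|j]]]] hj] //;
  rewrite !mxE !big_ord_recl big_ord0 !mxE /= /bump /= /D; ring.
rewrite /mxl det_mxn /= /bump /=; ring.
Qed.

Definition coassoc_eqns (al be C : R) (y : 'rV[R]_7) : Prop :=
  [/\ y 0 (inord 4) = 0,
      al * y 0 (inord 0) + be * y 0 (inord 1) + C * y 0 (inord 3) = 0 &
      C * y 0 (inord 0) - al * y 0 (inord 3) + be * y 0 (inord 6) = 0].

(* The three equations cut out a plane whose orthogonal complement is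
   associative; [kmat] is an orthogonal basis of the plane. *)
Lemma coassoc_plane al be C (W : 'M[R]_(4, 7)) : 0 < C ^+ 2 + al ^+ 2 + be ^+ 2 ->
  (forall i, coassoc_eqns al be C (row i W)) -> psi0 W ^+ 2 = \det (W *m W^T).
Proof.
move=> D0 HW; set D := C ^+ 2 + _ + _ in D0.
pose w (i j : nat) : R := W (inord i) (inord j).
(* The coordinates of the rows of [W] in the orthogonal basis [kmat], whose rows have squared norms
   1, 1, D, D. *)
pose P : 'M[R]_4 := mxn 4 4 (fun i j => nth 0 [:: w i 2%N; w i 5%N;
   (be * w i 0%N - al * w i 1%N - C * w i 6%N) / D;
   (C * w i 1%N - be * w i 3%N - al * w i 6%N) / D] j).
have WE : W = mxn 4 7 w by exact: mxn_eta.
have Wk : W = P *m kmat al be C.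
  apply/matrixP => i j.
  have [] := HW i; rewrite !mxE.
  have e n : W i (inord n) = w i n by rewrite /w inord_val.
  rewrite !e => h4 h1 h2.
  rewrite !big_ord_recl big_ord0 !mxE [in LHS]WE mxE /= /bump /=.
  have Dn : D != 0 by rewrite gt_eqF.
  case: j => [[|[|[|[|[|[|[|j]]]]]]] hj] //=; rewrite ?(mulr0, addr0, add0r, mulr1, mul0r) //.
  - apply/eqP; rewrite -subr_eq0; apply/eqP.
    transitivity ((al * (al * w i 0%N + be * w i 1%N + C * w i 3%N)
      + C * (C * w i 0%N - al * w i 3%N + be * w i 6%N)) / D); last by rewrite h1 h2 !mulr0 addr0 mul0r.
    by move: Dn; rewrite /D => Dn; field.
  - apply/eqP; rewrite -subr_eq0; apply/eqP.
    transitivity ((be * (al * w i 0%N + be * w i 1%N + C * w i 3%N)) / D); last by rewrite h1 mulr0 mul0r.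
    by move: Dn; rewrite /D => Dn; field.
  - apply/eqP; rewrite -subr_eq0; apply/eqP.
    transitivity ((C * (al * w i 0%N + be * w i 1%N + C * w i 3%N)
      - al * (C * w i 0%N - al * w i 3%N + be * w i 6%N)) / D); last by rewrite h1 h2 !mulr0 subr0 mul0r.
    by move: Dn; rewrite /D => Dn; field.
  - apply/eqP; rewrite -subr_eq0; apply/eqP.
    transitivity ((be * (C * w i 0%N - al * w i 3%N + be * w i 6%N)) / D); last by rewrite h2 mulr0 mul0r.
    by move: Dn; rewrite /D => Dn; field.
(* Both sides are the square of the determinant of [P] times the same quantity for [kmat]. *)
rewrite {1}Wk psi0_mul Wk trmx_mul mulmxA -(mulmxA P) !det_mulmx det_tr gram_kmat exprMn psi0_kmat.
ring.
Qed.

End CoassociativePlane.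

(** * The differential of the projection *)

Section Projection.
Variable R : realType.
Implicit Types (c : R) (p : amb R).

Definition quartic c p : R := Num.sqrt (Num.sqrt (c + rad2 p.2)).

Definition bspi c p : 'rV[R]_3 := row_mx (height p.2)%:M (quartic c p *: xr p.1) : 'rV_(1 + 2).

Lemma bspiP c p q : bspi c p = bspi c q <->
  height p.2 = height q.2 /\ quartic c p *: xr p.1 = quartic c q *: xr q.1.
Proof.
split=> [/(@eq_row_mx _ 1 1 2)[/matrixP/(_ 0 0)]|[h1 h2]]; first by rewrite !mxE /= !mulr1n.
by rewrite /bspi h1 h2.
Qed.

Lemma quartic_gt0 c p : 0 < c + rad2 p.2 -> 0 < quartic c p.
Proof. by move=> h; rewrite !sqrtr_gt0. Qed.

Lemma height_linear : linear (@height R : 'M[R]_5 -> R^o).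
Proof. by move=> a A B; rewrite /height !mxE. Qed.

Lemma xr_linear : linear (@xr R).
Proof. by move=> a x y; rewrite /xr linearP. Qed.

Lemma heightD (A B : 'M[R]_5) : height (A + B) = height A + height B.
Proof. by have := height_linear 1 A B; rewrite !scale1r. Qed.

Lemma heightN (A : 'M[R]_5) : height (- A) = - height A.
Proof. by rewrite /height mxE. Qed.

Lemma height_row (x z : 'rV[R]_5) : height (x^T *m z) = xr x 0 0 * xr z 0 1.
Proof. by rewrite /height tr_mulE !mxE. Qed.

(** Both components of the projection are constant along curves in the fibre; the derivative of G
    x'' is multiplied by 4 G^3 to clear denominators. Inclusion in the kernel is enough, since the
    coassociative identity holds for any four vectors of the kernel. *)
Lemma tangent_fibre c b p (u : amb R) :
  tangent (Mc c `&` bspi c @^-1` [set b]) p u -> Mc c p ->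
  height u.2 = 0 /\
  (4 * quartic c p ^+ 4) *: xr u.1 + (\tr (p.2 *m u.2^T) / 2) *: xr p.1 = 0.
Proof.
move=> [I [gam [oI I0 sg Ng [g0 dg]]]] Xp.
have fF := findim_mx R 1 5; have fG := findim_mx R 5 5.
have d1 : is_derive (0 : R^o) (1 : R^o) (fun t => (gam t).1) u.1.
  by apply: (is_derive_linear (l := fst)) dg; first exact: findim_amb.
have d2 : is_derive (0 : R^o) (1 : R^o) (fun t => (gam t).2) u.2.
  by apply: (is_derive_linear (l := snd)) dg; first exact: findim_amb.
have cst t : I t -> height (gam t).2 = height p.2 /\ quartic c (gam t) *: xr (gam t).1 = quartic c p *: xr p.1.
  by move=> It; apply/bspiP; have [_ h1] := Ng _ It; have [_ h2] := Ng _ I0; move: h1 h2; rewrite /= g0 => -> ->.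
split.
  have h := is_derive_linear fG height_linear d2.
  exact: (is_derive_near oI I0 (fun t It => (cst t It).1) h (is_derive_cst _ _ _)).
have dx := is_derive_linear fF xr_linear d1.
pose F (t : R^o) : R^o := c + rad2 (gam t).2.
have dF : is_derive (0 : R^o) (1 : R^o) F (\tr (p.2 *m u.2^T) / 2).
  have h := is_derive_mulmx d2 (is_derive_trmx d2).
  have ltr : linear (fun A : 'M[R]_5 => \tr A / 4 : R^o).
    by move=> a A B; rewrite linearP mulrDl -mulrA.
  have := is_derive_add (is_derive_cst (c : R^o) (0 : R^o) (1 : R^o)) (is_derive_linear fG ltr h).
  rewrite add0r g0 linearD /= -(mxtrace_tr (u.2 *m _)) trmx_mul trmxK.
  by have -> : (\tr (p.2 *m u.2^T) + \tr (p.2 *m u.2^T)) / 4 = \tr (p.2 *m u.2^T) / 2 by field.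
have F0 : 0 < F 0 by rewrite /F g0; case: Xp.
have G0 : 0 < quartic c p by apply: quartic_gt0; case: Xp.
have dG : is_derive (0 : R^o) (1 : R^o) (fun t => quartic c (gam t) : R^o)
    (\tr (p.2 *m u.2^T) / 2 / (4 * quartic c p ^+ 3)).
  have s0 : 0 < Num.sqrt (F 0) by rewrite sqrtr_gt0.
  have h1 := is_derive_comp1 (is_derive1_sqrt F0) dF.
  have h2 := @is_derive_comp1 R _ (@Num.sqrt R) (fun t => Num.sqrt (F t) : R^o) 0 1 _ _
     (is_derive1_sqrt s0) h1.
  move: h2; set e := _ * _; suff -> : e = \tr (p.2 *m u.2^T) / 2 / (4 * quartic c p ^+ 3) by [].
  have e1 : Num.sqrt (Num.sqrt (F 0)) = quartic c p by rewrite /quartic /F g0.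
  have e2 : Num.sqrt (F 0) = quartic c p ^+ 2.
    by rewrite /quartic sqr_sqrtr ?sqrtr_ge0 // /F g0.
  by rewrite /e e1 e2; field; rewrite gt_eqF.
have h := is_derive_scale dG dx.
have := is_derive_near oI I0 (fun t It => (cst t It).2) h (is_derive_cst _ _ _).
rewrite g0 => /(congr1 (fun z => (4 * quartic c p ^+ 3) *: z)).
rewrite scaler0 scalerDr !scalerA => <-; rewrite addrC; congr (_ *: _ + _ *: _).
  by field; rewrite gt_eqF.
by rewrite (exprS _ 3); ring.
Qed.

Lemma hor_height (x u : 'rV[R]_5) (A : 'M[R]_5) : A^T = - A ->
  height (hor x A u) = - dot (prp (xr x)) (xr (u *m A)).
Proof.
move=> AT; rewrite /hor heightN heightD -mulmxA height_row.
have -> : A *m u^T = - (u *m A)^T by rewrite trmx_mul AT mulNmx opprK.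
by rewrite mulNmx heightN height_row dot2E prp0 prp1; ring.
Qed.

Lemma Omega_skew k (b : 'M[R]_(4, 5)) : (Omega k b)^T = - Omega k b.
Proof.
have e (i j : 'I_4) : (wedge_row b i j)^T = - wedge_row b i j.
  by rewrite /wedge_row trmx_sub !trmx_mul !trmxK opprB.
have e2 i j m l : (wedge_row b i j - wedge_row b m l)^T = - (wedge_row b i j - wedge_row b m l).
  by rewrite trmx_sub !e; move: (wedge_row b i j) (wedge_row b m l) => X Y; rewrite opprB opprK addrC.
by case: k => [[|[|[|k]]] hk] //; exact: e2.
Qed.

Lemma Omega_perp k x (b : 'M[R]_(4, 5)) : oriented_coframe x b ->
  Omega k b *m x^T = 0 /\ x *m Omega k b = 0.
Proof.
move=> /oriented_coframeP[_ _ bx _].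
have xb : x *m b^T = 0 by rewrite -[x]trmxK -trmx_mul bx trmx0.
by rewrite OmegaE !mulmxA xb !mul0mx -!mulmxA bx !mulmx0.
Qed.

(** Parallel transport preserves r, so a horizontal vector does not change it. *)
Lemma tr_hor (x u : 'rV[R]_5) (A : 'M[R]_5) : A *m x^T = 0 -> x *m A = 0 ->
  \tr (A *m (hor x A u)^T) = 0.
Proof.
move=> Ax xA; rewrite /hor linearN /= mulmxN linearN /= trmx_add !trmx_mul !trmxK mulmxDr linearD /=.
rewrite !mulmxA mxtrace_mulC !mulmxA xA !mul0mx mxtrace0 Ax !mul0mx mxtrace0.
by rewrite addr0 oppr0.
Qed.

(** In a coframe whose b_2 is along [w] the form has components (a, lam, 0), and the kernel
    equations take the shape [coassoc_eqns]. Their coefficients vanish together only if x' = 0 and A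
    = 0. *)
Lemma coassoc_point c b p (phi : amb R -> ('I_3 -> amb R) -> R) :
  bryant_salamon c (Mc c) phi -> (Mc c `&` bspi c @^-1` [set b]) p ->
  ~ (xl p.1 = 0 /\ rad2 p.2 = 0) ->
  exists2 e : 'I_7 -> amb R, adapted_frame (Mc c) phi p e &
    forall W : 'M[R]_(4, 7),
      (forall i, tangent (Mc c `&` bspi c @^-1` [set b]) p (\sum_j W i j *: e j)) ->
      psi0 W ^+ 2 = \det (W *m W^T).
Proof.
move=> bs [Xp pb] nv; have [Mp r0] := Xp.
have [C [S [u [v [C0 S0 uu vv [CS xE]]]]]] := unit_decomp (M_unit Mp).
have [a [w [uw AE]]] := M_decomp Mp xE CS uu vv.
have [q [lam [qq uq wE]]] : exists q lam, [/\ dot q q = 1, dot u q = 0 & w = lam *: q].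
  have [->|w0] := eqVneq w 0.
    by have [q qq uq] := orth_exists uu; exists q, 0; rewrite scale0r.
  have [q qq wE] := normalize w0; exists q, (Num.sqrt (dot w w)); split=> //.
  have s0 : Num.sqrt (dot w w) != 0 by rewrite gt_eqF // sqrtr_gt0 dot_gt0.
  by apply: (mulfI s0); rewrite -dotZr -wE mulr0.
pose b0 := coframe C S u v q.
have ob0 : oriented_coframe p.1 b0 by rewrite xE; exact: coframe_oriented.
pose al : 'I_3 -> R := fun k => nth 0 [:: a; lam; 0] k.
have hO (e : 'rV[R]_3) : height (\sum_k e 0 k *: Omega k b0) = e 0 0 * C.
  by rewrite Omega_sum // Amat_height.
have AO : p.2 = \sum_k al k *: Omega k b0.
  have := Omega_sum C S (\row_k al k) uu qq uq vv; rewrite !mxE /= scale0r addr0 -wE -AE => <-.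
  by apply: eq_bigr => k _; rewrite mxE.
have [_ bb bx _] := (oriented_coframeP _ _).1 ob0.
exists (frame7 c p b0); first by split=> [y|Y]; [exact: frame7_tangent|exact: frame7_phi].
move=> W HW.
have G0 := scale_G_gt0 Xp; set G := scale_G c p in G0.
pose kap := (Num.sqrt 2 * G)^-1.
have k2 : 2 * G ^+ 2 * kap ^+ 2 = 1.
  have s2 : Num.sqrt 2 ^+ 2 = 2 :> R by rewrite sqr_sqrtr.
  rewrite /kap invfM exprMn !exprVn s2; field.
  by rewrite gt_eqF // pnatr_eq0.
have kap0 : 0 < kap by rewrite invr_gt0 mulr_gt0 // sqrtr_gt0.
(* The quotient of the horizontal scale [kap] by the vertical scale [G], times [S]. By [k2] the same
   number appears in the equation of the height and in that of x''. *)
have [m mE] : exists m, m = S * kap / G by exists (S * kap / G).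
have r2 : rad2 p.2 = a ^+ 2 + lam ^+ 2.
  rewrite AO rad2_Omega // !big_ord_recl big_ord0 /al /=; ring.
apply: (@coassoc_plane _ (m * a) (m * lam) C).
  rewrite !exprMn -addrA -mulrDr -r2.
  have rr : 0 <= rad2 p.2 by rewrite r2 addr_ge0 // sqr_ge0.
  have mm : m ^+ 2 = S ^+ 2 * (kap / G) ^+ 2 by rewrite mE; ring.
  have kg : 0 < (kap / G) ^+ 2 by rewrite exprn_gt0 // divr_gt0.
  move: C0; rewrite le_eqVlt => /orP[/eqP C0|C0]; last first.
    by rewrite ltr_wpDr ?exprn_gt0 // mulr_ge0 ?sqr_ge0.
  have S1 : S ^+ 2 = 1 by rewrite -CS -C0; ring.
  rewrite -C0 expr0n add0r mm S1 mul1r mulr_gt0 // lt_def rr andbT.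
  apply/eqP => r00; apply: nv; split=> //.
  by rewrite xE /xof xl_row5 -C0 scale0r.
move=> i; set y := row i W.
have [h1 h2] := tangent_fibre (HW i) Xp.
have rowE : \sum_j W i j *: frame7 c p b0 j = \sum_j y 0 j *: frame7 c p b0 j.
  by apply: eq_bigr => j _; rewrite mxE.
move: h1 h2; rewrite rowE frame7_sum /= -/G -/kap.
set h := horz y; set z := vert y.
have xrh : xr (h *m b0) = (h 0 0 * C) *: v + h 0 1 *: prp v.
  have e1 : lift ord0 ord0 = 1 :> 'I_4 by apply: val_inj.
  rewrite mulmx_sum_row !big_ord_recl big_ord0 !rowK /= !row5Z ?e1 ?scaler0 ?addr0.
  rewrite !row5D xr_row5 ?scaler0 ?addr0 ?add0r.
  by rewrite scalerA.
have Aperp : p.2 *m p.1^T = 0 /\ p.1 *m p.2 = 0.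
  rewrite AO mulmx_suml mulmx_sumr; split; apply: big1 => k _.
    by rewrite -scalemxAl (Omega_perp k ob0).1 scaler0.
  by rewrite -scalemxAr (Omega_perp k ob0).2 scaler0.
have AT : p.2^T = - p.2.
  rewrite AO linear_sum -sumrN; apply: eq_bigr => k _.
  by apply: etrans (trmx_scale _ _) _; rewrite Omega_skew scalerN.
have trA : \tr (p.2 *m (hor p.1 p.2 (kap *: (h *m b0)) + \sum_k (G * z 0 k) *: Omega k b0)^T) =
    4 * G * (a * z 0 0 + lam * z 0 1).
  rewrite trmx_add mulmxDr linearD /= (tr_hor _ Aperp.1 Aperp.2) add0r.
  rewrite [X in _ *m X](_ : _ = \sum_k ((G * z 0 k) *: Omega k b0)^T); last by rewrite linear_sum.
  rewrite mulmx_sumr (linear_sum (@mxtrace R 5)) /=.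
  have -> : \sum_k \tr (p.2 *m ((G * z 0 k) *: Omega k b0)^T) = \sum_k 4 * G * (al k * z 0 k).
    apply: eq_bigr => k _; rewrite trmx_scale -scalemxAr linearZ /= AO mulmx_suml (linear_sum (@mxtrace R 5)) /=.
    rewrite (bigD1 k) //= big1 => [|j jk].
      by rewrite -scalemxAl linearZ /= tr_Omega // eqxx addr0 mulr1n; ring.
    by rewrite -scalemxAl linearZ /= tr_Omega // (negbTE jk) mulr0.
  rewrite -mulr_sumr !big_ord_recl big_ord0 /al /= mul0r !addr0.
  by congr (_ * (_ * z _ _ + _ * z _ _)); apply: val_inj.
have hh : height (hor p.1 p.2 (kap *: (h *m b0)) + \sum_k (G * z 0 k) *: Omega k b0) =
   G * z 0 0 * C - S * kap * (a * h 0 0 - lam * h 0 3%:R).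
  rewrite heightD hor_height //.
  have -> : \sum_k (G * z 0 k) *: Omega k b0 = \sum_k (G *: z) 0 k *: Omega k b0.
    by apply: eq_bigr => k _; rewrite [(G *: z) 0 k]mxE.
  rewrite hO [(G *: z) 0 0]mxE addrC; congr (_ - _).
  rewrite xE /xof xr_row5.
  have -> : prp (S *: v) = S *: prp v by apply: row2P; rewrite ?mxE /= ?mxE ?mulrN.
  have -> : dot (S *: prp v) (xr ((kap *: (h *m b0)) *m p.2)) = S * kap * (h *m b0 *m p.2 *m b0^T) 0 1.
    rewrite dotZl -scalemxAl -mulrA; congr (_ * _).
    have -> : forall t : 'rV[R]_5, dot (prp v) (xr t) = dot t (row 1 b0).
      by move=> t; rewrite rowK /= dot5 xl_row5 xr_row5 (dotC (xl t)) dot0l add0r dotC.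
    rewrite dotZl /dot tr_row [X in _ = _ * X]mxE; congr (_ * _).
    by rewrite mxE; apply: eq_bigr => j _; rewrite !mxE.
  congr (_ * _).
  have -> : h *m b0 *m p.2 *m b0^T = \sum_k al k *: (h *m Oh R k).
    rewrite AO -!mulmxA mulmx_suml mulmx_sumr mulmx_sumr; apply: eq_bigr => k _.
    rewrite -scalemxAl -!scalemxAr OmegaE !mulmxA -(mulmxA h) bb mulmx1.
    by rewrite -(mulmxA _ b0 b0^T) bb mulmx1.
  have e3 : lift ord0 (lift ord0 (lift ord0 ord0)) = 3%:R :> 'I_4 by apply: val_inj.
  rewrite !big_ord_recl big_ord0 /al /= !mxE !big_ord_recl !big_ord0 !mxE /= /bump /= e3.
  by rewrite !(mulr0, mul0r, addr0, add0r, mulr1, mulrN1); ring.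
rewrite trA hh xE /xof xr_row5 => h1.
have -> : xr (kap *: (h *m b0)) = kap *: xr (h *m b0) by rewrite /xr linearZ.
rewrite xrh !scalerA scalerDr !scalerA => h2.
(* The equation with values in R^2 is tested on [prp v] and then on [v]. *)
have h20 : 4 * quartic c p ^+ 4 * kap * h 0 1 = 0.
  have := congr1 (fun t => dot t (prp v)) h2.
  by rewrite !(dotDl, dotZl) dot_prp dot_prp2 vv dot0l; lra.
have h21 : 4 * quartic c p ^+ 4 * kap * (h 0 0 * C) + 4 * G * (a * z 0 0 + lam * z 0 1) / 2 * S = 0.
  have := congr1 (fun t => dot t v) h2.
  by rewrite !(dotDl, dotZl) (dotC (prp v)) dot_prp vv dot0l; lra.
have zE (n : nat) (k : 'I_3) : n = k -> y 0 (inord n) = z 0 k.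
  by move=> ->; rewrite /z /vert [RHS]mxE; congr (y 0 _); apply: val_inj; rewrite /= inordK // (ltn_trans (ltn_ord k)).
have hE (n : nat) (k : 'I_4) : n = (3 + k)%N -> y 0 (inord n) = h 0 k.
  move=> ->; rewrite /h /horz [RHS]mxE; congr (y 0 _); apply: val_inj; rewrite /= inordK //.
  exact: (ltn_ord k).
rewrite /coassoc_eqns (hE 4 1) // (zE 0 0) // (zE 1 1) // (hE 3 0) // (hE 6 3%:R) //.
have q4 : quartic c p = G by [].
rewrite q4 in h20 h21.
have n1 : 4 * G ^+ 4 * kap != 0 by rewrite !mulf_neq0 ?expf_neq0 ?pnatr_eq0 ?gt_eqF.
split.
- by apply: (mulfI n1); rewrite mulr0.
- apply: (mulfI n1); rewrite mulr0 -h21 mE.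
  have -> : 4 * G ^+ 4 * kap * (S * kap / G * a * z 0 0 + S * kap / G * lam * z 0 1 + C * h 0 0) =
     4 * G ^+ 4 * kap * (h 0 0 * C) + 2 * (2 * G ^+ 2 * kap ^+ 2) * G * S * (a * z 0 0 + lam * z 0 1).
    by field; rewrite gt_eqF.
  by rewrite k2; field.
- have n2 : G != 0 by rewrite gt_eqF.
  apply: (mulfI n2); rewrite mulr0 -h1 mE; field; exact: n2.
Qed.

End Projection.

(** * Smoothness at a point, charts of T*S^2 *)

Section SmoothAt.
Variable R : realType.
Implicit Types E F G : normedModType R.

(** Conditions such as a nonzero denominator are then checked at [x] only, and the neighbourhoods
    need not be tracked. *)
Definition smooth_at E F (x : E) (f : E -> F) : Prop :=
  exists V, [/\ open V, V x & smooth_open V f].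

Lemma smooth_at_on E F (S : set E) (f : E -> F) : (forall x, S x -> smooth_at x f) -> smooth_on S f.
Proof. by move=> H x /H[V [oV Vx sf]]; exists V, f. Qed.

Lemma smooth_at_open E F (V : set E) (f : E -> F) x : open V -> smooth_open V f -> V x -> smooth_at x f.
Proof. by move=> oV sf Vx; exists V. Qed.

Lemma smooth_at_full E F (f : E -> F) x : smooth_open setT f -> smooth_at x f.
Proof. by move=> sf; apply: smooth_at_open sf _ => //; exact: openT. Qed.

Lemma smooth_at_map E F G x (f : E -> F) (h : E -> G) :
  (forall V, open V -> smooth_open V f -> smooth_open V h) -> smooth_at x f -> smooth_at x h.
Proof. by move=> H [V [oV Vx sf]]; exists V; split=> //; exact: H. Qed.

Lemma smooth_at_map2 E F F' G x (f : E -> F) (g : E -> F') (h : E -> G) :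
  (forall V, open V -> smooth_open V f -> smooth_open V g -> smooth_open V h) ->
  smooth_at x f -> smooth_at x g -> smooth_at x h.
Proof.
move=> H [V [oV Vx sf]] [W [oW Wx sg]]; exists (V `&` W); split=> //; first exact: openI.
by apply: H; [exact: openI|apply: smooth_sub sf => y []|apply: smooth_sub sg => y []].
Qed.

Lemma smooth_at_continuous E F x (f : E -> F) : smooth_at x f -> {for x, continuous f}.
Proof. by move=> [V [_ Vx sf]]; exact: smooth_continuous sf Vx. Qed.

Lemma smooth_at_is_derive E F x v (f : E -> F) : smooth_at x f -> is_derive x v f ('D_v f x).
Proof. by move=> [V [_ Vx sf]]; exact: smooth_is_derive sf Vx. Qed.

Lemma smooth_at_cst E F (x : E) (a : F) : smooth_at x (fun _ => a).
Proof. by apply: smooth_at_full; exact: smooth_cst. Qed.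

Lemma smooth_at_lin E F x (f : E -> F) : findim E -> linear f -> smooth_at x f.
Proof. by move=> fE lf; apply: smooth_at_full; exact: smooth_lin. Qed.

Lemma smooth_at_id E (x : E) : findim E -> smooth_at x (fun y => y).
Proof. by move=> fE; exact: smooth_at_lin. Qed.

Lemma smooth_at_comp_lin E F G x (f : F -> G) (g : E -> F) :
  findim F -> linear f -> smooth_at x g -> smooth_at x (fun y => f (g y)).
Proof. by move=> fF lf; apply: smooth_at_map => V oV; exact: smooth_comp_lin. Qed.

Lemma smooth_atD E F x (f g : E -> F) :
  smooth_at x f -> smooth_at x g -> smooth_at x (fun y => f y + g y).
Proof. by apply: smooth_at_map2 => V oV; exact: smoothD. Qed.

Lemma smooth_atB E F x (f g : E -> F) :
  smooth_at x f -> smooth_at x g -> smooth_at x (fun y => f y - g y).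
Proof. by apply: smooth_at_map2 => V oV; exact: smoothB. Qed.

Lemma smooth_atN E F x (f : E -> F) : smooth_at x f -> smooth_at x (fun y => - f y).
Proof. by apply: smooth_at_map => V oV; exact: smoothN. Qed.

Lemma smooth_atZ E F x (a : E -> R^o) (f : E -> F) :
  smooth_at x a -> smooth_at x f -> smooth_at x (fun y => a y *: f y).
Proof. by apply: smooth_at_map2 => V oV; exact: smoothZ. Qed.

Lemma smooth_atM E x (f g : E -> R^o) :
  smooth_at x f -> smooth_at x g -> smooth_at x (fun y => f y * g y : R^o).
Proof. exact: smooth_atZ. Qed.

Lemma smooth_atX E x (f : E -> R^o) n : smooth_at x f -> smooth_at x (fun y => f y ^+ n : R^o).
Proof. by apply: smooth_at_map => V oV; exact: smoothX. Qed.

(** The neighbourhood is cut down to the preimage of the open set on which the outer operation is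
    smooth. *)
Lemma smooth_at_shrink E G x (f : E -> R^o) (h : E -> G) (P : set R) :
  (forall V, open V -> (forall y, V y -> P (f y)) -> smooth_open V f -> smooth_open V h) ->
  open (P : set R^o) -> P (f x) -> smooth_at x f -> smooth_at x h.
Proof.
move=> H oP Pfx [V [oV Vx sf]].
have oW : open (V `&` f @^-1` P) by apply: preimage_open => // y; exact: smooth_continuous.
exists (V `&` f @^-1` P); split=> //; apply: H => //; first by move=> y [].
by apply: smooth_sub sf => y [].
Qed.

Lemma smooth_atV E x (f : E -> R^o) : f x != 0 ->
  smooth_at x f -> smooth_at x (fun y => (f y)^-1 : R^o).
Proof.
move=> f0; apply: (smooth_at_shrink (P := [set t : R | t != 0])) => //.
by move=> V oV; exact: smoothV.
Qed.

Lemma smooth_at_sqrt E x (f : E -> R^o) : 0 < f x ->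
  smooth_at x f -> smooth_at x (fun y => Num.sqrt (f y) : R^o).
Proof.
move=> f0; apply: (smooth_at_shrink (P := [set t : R | 0 < t])) => //.
by move=> V oV; exact: smooth_sqrt.
Qed.

Lemma smooth_at_entry E m n x (f : E -> 'M[R]_(m, n)) i j :
  smooth_at x f -> smooth_at x (fun y => f y i j : R^o).
Proof. by apply: smooth_at_map => V oV; exact: smooth_entry. Qed.

Lemma smooth_at_fin E (I : finType) x (P : I -> set E -> Prop) :
  (forall i V W, open W -> W `<=` V -> P i V -> P i W) ->
  (forall i, exists V, [/\ open V, V x & P i V]) ->
  exists V, [/\ open V, V x & forall i, P i V].
Proof.
move=> mono H.
suff [V [oV Vx HV]] : exists V, [/\ open V, V x & forall i, i \in enum I -> P i V].
  by exists V; split=> // i; apply: HV; rewrite mem_enum.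
elim: (enum I) => [|i s [V [oV Vx HV]]].
  by exists setT; split=> //; exact: openT.
have [W [oW Wx HW]] := H i.
exists (V `&` W); split=> //; first exact: openI.
move=> j; rewrite inE => /orP[/eqP->|js].
  by apply: mono HW; [exact: openI|move=> y []].
by apply: mono (HV j js); [exact: openI|move=> y []].
Qed.

Lemma smooth_at_mx E m n x (f : E -> 'M[R]_(m, n)) :
  (forall i j, smooth_at x (fun y => f y i j : R^o)) -> smooth_at x f.
Proof.
move=> H.
have [|ij|V [oV Vx HV]] := @smooth_at_fin E ('I_m * 'I_n)%type x
  (fun ij V => smooth_open V (fun y => f y ij.1 ij.2 : R^o)).
- by move=> ij V W _; exact: smooth_sub.
- exact: H.
- by exists V; split=> //; apply: smooth_mx => // i j; exact: (HV (i, j)).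
Qed.

Lemma smooth_at_mulmx E m n p x (f : E -> 'M[R]_(m, n)) (g : E -> 'M[R]_(n, p)) :
  smooth_at x f -> smooth_at x g -> smooth_at x (fun y => f y *m g y).
Proof. by apply: smooth_at_map2 => V oV; exact: smooth_mulmx. Qed.

Lemma smooth_at_trmx E m n x (f : E -> 'M[R]_(m, n)) :
  smooth_at x f -> smooth_at x (fun y => (f y)^T).
Proof. by apply: smooth_at_map => V oV; exact: smooth_trmx. Qed.

Lemma smooth_at_tr E n x (f : E -> 'M[R]_n) :
  smooth_at x f -> smooth_at x (fun y => \tr (f y) : R^o).
Proof. by apply: smooth_at_map => V oV; exact: smooth_tr. Qed.

Lemma smooth_at_dot E n x (f g : E -> 'rV[R]_n) :
  smooth_at x f -> smooth_at x g -> smooth_at x (fun y => dot (f y) (g y) : R^o).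
Proof. by apply: smooth_at_map2 => V oV; exact: smooth_dot. Qed.

Lemma smooth_at_pair E F G x (f : E -> F) (g : E -> G) : findim F -> findim G ->
  smooth_at x f -> smooth_at x g -> smooth_at x (fun y => (f y, g y)).
Proof. by move=> fF fG; apply: smooth_at_map2 => V oV; exact: smooth_pair. Qed.

Lemma smooth_at_fst E F G x (f : E -> (F * G)%type) : findim F -> findim G ->
  smooth_at x f -> smooth_at x (fun y => (f y).1).
Proof. by move=> fF fG; apply: smooth_at_map => V oV; exact: smooth_fst. Qed.

Lemma smooth_at_snd E F G x (f : E -> (F * G)%type) : findim F -> findim G ->
  smooth_at x f -> smooth_at x (fun y => (f y).2).
Proof. by move=> fF fG; apply: smooth_at_map => V oV; exact: smooth_snd. Qed.

Lemma smooth_at_comp E F G x (f : E -> F) (g : F -> G) : findim F -> findim G ->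
  smooth_at x f -> smooth_at (f x) g -> smooth_at x (fun y => g (f y)).
Proof.
move=> fF fG [V [oV Vx sf]] [W [oW Wx sg]].
have oVW : open (V `&` f @^-1` W) by apply: preimage_open => // y; exact: smooth_continuous.
exists (V `&` f @^-1` W); split=> //.
apply: (smooth_comp (W := W)) => //; first by move=> y [].
by apply: smooth_sub sf => y [].
Qed.

Lemma smooth_at_row n E x (f : E -> 'rV[R]_n) :
  (forall j, smooth_at x (fun y => f y 0 j : R^o)) -> smooth_at x f.
Proof. by move=> H; apply: smooth_at_mx => i j; rewrite (ord1 i). Qed.

Lemma smooth_at_crs E x (f g : E -> 'rV[R]_3) :
  smooth_at x f -> smooth_at x g -> smooth_at x (fun y => crs (f y) (g y)).
Proof.
move=> sf sg; apply: smooth_at_row => j.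
have h (i k : 'I_3) : smooth_at x (fun y => f y 0 i * g y 0 k : R^o).
  by apply: smooth_atM; exact: smooth_at_entry.
have H (i k l m : 'I_3) : smooth_at x (fun y => f y 0 i * g y 0 k - f y 0 l * g y 0 m : R^o).
  by apply: smooth_atB; exact: h.
by have [->|->|->] := row3E j; under eq_fun do rewrite crsE; exact: H.
Qed.

Lemma open_pos E (V : set E) (f : E -> R^o) : open V -> smooth_open V f ->
  open (V `&` [set x | 0 < f x]).
Proof.
move=> oV sf; apply: (@preimage_open _ _ R^o V [set t : R | 0 < t]) => //.
by move=> x; exact: smooth_continuous.
Qed.

Lemma closure_path E (S : set E) (gam : R^o -> E) : {for 0, continuous gam} ->
  (forall t, 0 < t -> S (gam t)) -> closure S (gam 0).
Proof.
move=> cg Sg B nB.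
have /nbhs_ballP[e /= e0 He] := cg _ nB.
exists (gam (e / 2)); split; first by apply: Sg; rewrite divr_gt0.
apply: He; rewrite /ball /= sub0r normrN gtr0_norm ?divr_gt0 //.
by rewrite ltr_pdivrMr // ltr_pMr // ltr1n.
Qed.

End SmoothAt.

(** * Charts of T*S^2 *)

Section TangentSphere.
Variable R : realType.
Local Notation V3 := 'rV[R]_3.

Lemma TstarS2E (q p : V3) : TstarS2 (q, p) <-> dot q q = 1 /\ dot q p = 0.
Proof.
rewrite /TstarS2 /= !dotE; split=> -[h1 h2].
  by move/matrixP: h1 => /(_ 0 0); move/matrixP: h2 => /(_ 0 0); rewrite !mxE /= !mulr1n.
by rewrite h1 h2; split=> //; apply/matrixP => i j; rewrite !mxE mul0rn.
Qed.

Section Chart.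
Variables (q0 b0 : V3).
Hypotheses (qq : dot q0 q0 = 1) (bb : dot b0 b0 = 1) (qb : dot q0 b0 = 0).

Let c0 := crs q0 b0.

Definition sphere_chart (z : V3 * V3) : 'rV[R]_4 := \row_j nth 0
  [:: dot z.1 b0; dot z.1 c0; dot z.2 b0; dot z.2 c0] j.

Definition chart_root (t : 'rV[R]_4) : R := Num.sqrt (1 - t 0 0 ^+ 2 - t 0 1 ^+ 2).

(** Inverts the orthogonal projection of the hemisphere around [q0]; the third component of the
    covector follows from its orthogonality to the point. *)
Definition sphere_chart_inv (t : 'rV[R]_4) : V3 * V3 :=
  (chart_root t *: q0 + t 0 0 *: b0 + t 0 1 *: c0,
   (- (t 0 0 * t 0 2%:R + t 0 1 * t 0 3%:R) / chart_root t) *: q0 + t 0 2%:R *: b0 + t 0 3%:R *: c0).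

Let qc : dot q0 c0 = 0. Proof. exact: dot_crsl. Qed.
Let bc : dot b0 c0 = 0. Proof. exact: dot_crsr. Qed.
Let cc : dot c0 c0 = 1. Proof. by rewrite crs_eq0. Qed.

Let dots (a b c : R) : let z := a *: q0 + b *: b0 + c *: c0 in
  [/\ dot z q0 = a, dot z b0 = b & dot z c0 = c].
Proof.
by split; rewrite !(dotDl, dotZl) ?qq ?qb ?qc ?bb ?bc ?cc ?(dotC b0 q0) ?qb ?(dotC c0 q0) ?qc ?(dotC c0 b0) ?bc;
  ring.
Qed.

Let dot2 (a b c a' b' c' : R) :
  dot (a *: q0 + b *: b0 + c *: c0) (a' *: q0 + b' *: b0 + c' *: c0) = a * a' + b * b' + c * c'.
Proof. by have [h1 h2 h3] := dots a b c; rewrite !(dotDr, dotZr) h1 h2 h3; ring. Qed.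

Lemma row4E (i : 'I_4) : [\/ i = 0, i = 1, i = 2%:R | i = 3%:R].
Proof.
by case: i => [[|[|[|[|i]]]] hi] //; [apply: Or41|apply: Or42|apply: Or43|apply: Or44]; apply: val_inj.
Qed.

Lemma sphere_chart_diffeo :
  diffeo (@TstarS2 R `&` [set z | 0 < dot z.1 q0]) [set t : 'rV[R]_4 | 0 < 1 - t 0 0 ^+ 2 - t 0 1 ^+ 2]
    sphere_chart sphere_chart_inv.
Proof.
have f3 := findim_mx R 1 3; have f4 := findim_mx R 1 4.
split; first split.
- move=> [q p] [/TstarS2E[q1 qp] /= q00].
  have Eq := frame_expand q qq bb qb; have Ep := frame_expand p qq bb qb.
  have n1 : dot q q0 ^+ 2 + dot q b0 ^+ 2 + dot q c0 ^+ 2 = 1.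
    by rewrite -[RHS]q1 [in RHS]Eq dot2; ring.
  have n2 : dot q q0 * dot p q0 + dot q b0 * dot p b0 + dot q c0 * dot p c0 = 0.
    by rewrite -[RHS]qp [in RHS]Eq [in RHS]Ep dot2.
  have e1 : 1 - dot q b0 ^+ 2 - dot q c0 ^+ 2 = dot q q0 ^+ 2 by rewrite -n1; ring.
  have er : chart_root (sphere_chart (q, p)) = dot q q0.
    by rewrite /chart_root !mxE /= e1 sqrtr_sqr gtr0_norm.
  split; first by rewrite /= !mxE /= e1 exprn_gt0.
  rewrite /sphere_chart_inv er !mxE /= [in RHS]Eq [in RHS]Ep; congr (_, _ *: _ + _ + _).
  by apply: (mulIf (lt0r_neq0 q00)); rewrite divfK ?gt_eqF //; move: n2; lra.
- move=> t /= t0.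
  have r0 : 0 < chart_root t by rewrite sqrtr_gt0.
  have r2 : chart_root t ^+ 2 = 1 - t 0 0 ^+ 2 - t 0 1 ^+ 2 by rewrite sqr_sqrtr // ltW.
  have [d1 d2 d3] := dots (chart_root t) (t 0 0) (t 0 1).
  have [d4 d5 d6] := dots (- (t 0 0 * t 0 2%:R + t 0 1 * t 0 3%:R) / chart_root t) (t 0 2%:R) (t 0 3%:R).
  split; first split.
  + apply/TstarS2E; rewrite !dot2 -!expr2 r2; split; first by ring.
    by field; rewrite gt_eqF.
  + by rewrite /= d1.
  + apply/rowP => j; rewrite mxE /=.
    by have [->|->|->|->] := row4E j; rewrite /= ?d2 ?d3 ?d5 ?d6.
- apply: smooth_at_on => z _; apply: smooth_at_row => j.
  have s1 : smooth_at z (@fst V3 V3) by apply: smooth_at_lin => //; exact: findim_prod.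
  have s2 : smooth_at z (@snd V3 V3) by apply: smooth_at_lin => //; exact: findim_prod.
  by have [->|->|->|->] := row4E j; under eq_fun do rewrite mxE /=; apply: smooth_at_dot => //;
    exact: smooth_at_cst.
- apply: smooth_at_on => t /= t0.
  have st j : smooth_at t (fun t : 'rV[R]_4 => t 0 j : R^o).
    by apply: smooth_at_entry; exact: smooth_at_id.
  have sr : smooth_at t (fun t => chart_root t : R^o).
    apply: (smooth_at_sqrt (f := fun t : 'rV[R]_4 => 1 - t 0 0 ^+ 2 - t 0 1 ^+ 2)) => //.
    apply: (smooth_atB (f := fun t : 'rV[R]_4 => 1 - t 0 0 ^+ 2 : R^o)); last exact: smooth_atX.
    by apply: (smooth_atB (f := fun _ => 1 : R^o)); [exact: smooth_at_cst|exact: smooth_atX].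
  have lc (a b c : 'rV[R]_4 -> R^o) : smooth_at t a -> smooth_at t b -> smooth_at t c ->
      smooth_at t (fun t => a t *: q0 + b t *: b0 + c t *: c0).
    move=> sa sb sc.
    by apply: smooth_atD; [apply: smooth_atD|]; apply: smooth_atZ => //; exact: smooth_at_cst.
  apply: smooth_at_pair => //; apply: lc => //.
  apply: (smooth_atM (g := fun t => (chart_root t)^-1 : R^o)); last first.
    by apply: smooth_atV => //; rewrite gt_eqF // sqrtr_gt0.
  by apply: (@smooth_atN _ _ R^o); apply: (@smooth_atD _ _ R^o); apply: smooth_atM.
Qed.

End Chart.

Lemma findim_TS : findim (V3 * V3)%type.
Proof. by apply: findim_prod; exact: findim_mx. Qed.

Lemma TstarS2_submanifold : submanifold 4 (@TstarS2 R).
Proof.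
move=> [q p] /[dup] Tqp /TstarS2E[qq _]; have [b bb qb] := orth_exists qq.
have s1 : smooth_open setT (@fst V3 V3) by apply: smooth_lin => //; exact: findim_TS.
have oV : open [set z : V3 * V3 | 0 < dot z.1 q].
  rewrite -[X in open X]setTI; apply: open_pos; first exact: openT.
  by apply: smooth_dot => //; [exact: openT|exact: smooth_cst].
have oW : open [set t : 'rV[R]_4 | 0 < 1 - t 0 0 ^+ 2 - t 0 1 ^+ 2].
  rewrite -[X in open X]setTI.
  apply: (open_pos (f := fun t : 'rV[R]_4 => 1 - t 0 0 ^+ 2 - t 0 1 ^+ 2)); first exact: openT.
  have sx j : smooth_open setT (fun t : 'rV[R]_4 => t 0 j ^+ 2 : R^o).
    apply: smoothX; first exact: openT.
    by apply: smooth_entry; [exact: openT|exact: smooth_id (findim_mx _ _ _)].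
  have oT : open [set: 'rV[R]_4] := openT.
  apply: (smoothB (f := fun t : 'rV[R]_4 => 1 - t 0 0 ^+ 2 : R^o)) => //.
  by apply: (smoothB (f := fun=> 1 : R^o)) => //; exact: smooth_cst.
exists [set z | 0 < dot z.1 q], [set t | 0 < 1 - t 0 0 ^+ 2 - t 0 1 ^+ 2]; split=> //=.
  by rewrite qq.
by exists (sphere_chart q b), (sphere_chart_inv q b); exact: sphere_chart_diffeo.
Qed.

End TangentSphere.

(** * The cone over RP^3 *)

Section Cone.
Variable R : realType.
Local Notation V3 := 'rV[R]_3.
Implicit Types (a b c q p : V3) (Q : 'M[R]_4).

(** If [r] is 1 and [a], [b], [c] are the rows of a rotation, this is n^T n for the unit quaternions
    n and -n of that rotation: the products n_i n_j are affine in its entries. *)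
Definition conemat (r : R) a b c : 'M[R]_4 :=
  let x i := a 0 i in let y i := b 0 i in let z i := c 0 i in
  4^-1 *: mxl 4 4
   [:: [:: r + x 0 + y 1 + z 2%:R; z 1 - y 2%:R; x 2%:R - z 0; y 0 - x 1];
       [:: z 1 - y 2%:R; r + x 0 - y 1 - z 2%:R; x 1 + y 0; x 2%:R + z 0];
       [:: x 2%:R - z 0; x 1 + y 0; r - x 0 + y 1 - z 2%:R; y 2%:R + z 1];
       [:: y 0 - x 1; x 2%:R + z 0; y 2%:R + z 1; r - x 0 - y 1 + z 2%:R]].

Definition cone_a Q : V3 := \row_j nth 0
  [:: Q 0 0 + Q 1 1 - Q 2%:R 2%:R - Q 3%:R 3%:R; 2 * (Q 1 2%:R - Q 0 3%:R); 2 * (Q 1 3%:R + Q 0 2%:R)] j.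
Definition cone_b Q : V3 := \row_j nth 0
  [:: 2 * (Q 1 2%:R + Q 0 3%:R); Q 0 0 - Q 1 1 + Q 2%:R 2%:R - Q 3%:R 3%:R; 2 * (Q 2%:R 3%:R - Q 0 1)] j.
Definition cone_c Q : V3 := \row_j nth 0
  [:: 2 * (Q 1 3%:R - Q 0 2%:R); 2 * (Q 2%:R 3%:R + Q 0 1); Q 0 0 - Q 1 1 - Q 2%:R 2%:R + Q 3%:R 3%:R] j.

Lemma tr4 Q : \tr Q = Q 0 0 + Q 1 1 + Q 2%:R 2%:R + Q 3%:R 3%:R.
Proof.
rewrite /mxtrace !big_ord_recl big_ord0 addr0 !addrA.
by congr (_ + _ + _ + _); congr (Q _ _); apply: val_inj.
Qed.

Lemma conemat_inv r a b c : let Q := conemat r a b c in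
  [/\ \tr Q = r, cone_a Q = a, cone_b Q = b & cone_c Q = c].
Proof.
split; first by rewrite tr4 !mxE /=; field.
- by apply: row3P; rewrite !mxE /=; field.
- by apply: row3P; rewrite !mxE /=; field.
- by apply: row3P; rewrite !mxE /=; field.
Qed.

Lemma conematK Q : Q^T = Q -> conemat (\tr Q) (cone_a Q) (cone_b Q) (cone_c Q) = Q.
Proof.
move=> QT; have h i j : Q j i = Q i j by rewrite -{1}QT mxE.
apply/matrixP => i j; rewrite tr4.
by have [->|->|->|->] := row4E i; have [->|->|->|->] := row4E j; rewrite !mxE /=
  ?(h 0 1) ?(h 0 2%:R) ?(h 0 3%:R) ?(h 1 2%:R) ?(h 1 3%:R) ?(h 2%:R 3%:R); field.
Qed.

Lemma conematZ r t a b c : conemat (t * r) (t *: a) (t *: b) (t *: c) = t *: conemat r a b c.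
Proof.
apply/matrixP => i j.
have [->|->|->|->] := row4E i; have [->|->|->|->] := row4E j; rewrite !mxE /=; ring.
Qed.

Lemma RP3_unit (n : 'rV[R]_4) : dot n n = 1 -> RP3 (n^T *m n).
Proof.
move=> nn; rewrite /RP3 /= trmx_mul trmxK mulmxA -(mulmxA _ n) dotE nn mulmx1.
by rewrite mxtrace_mulC dotE nn mxtrace_scalar; split.
Qed.

(** A normalized nonzero row n is fixed by [P]. Then [P] minus n^T n is a symmetric projection of
    trace 0, and its trace is its squared Frobenius norm. *)
Lemma RP3_rank1 (P : 'M[R]_4) : RP3 P -> exists2 n : 'rV[R]_4, dot n n = 1 & P = n^T *m n.
Proof.
move=> [PT PP trP].
have [i Pi] : exists i, row i P != 0.
  apply: contrapT => h.
  have P0 : P = 0.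
    apply/row_matrixP => i; rewrite row0; apply/eqP/negPn/negP => k; apply: h; by exists i.
  by move: trP; rewrite P0 mxtrace0 => /esym/eqP; rewrite oner_eq0.
have [n nn nE] := normalize Pi; exists n => //.
have nP : n *m P = n.
  have s0 : Num.sqrt (dot (row i P) (row i P)) != 0 by rewrite gt_eqF // sqrtr_gt0 dot_gt0.
  apply: (scalerI s0); rewrite scalemxAl -nE.
  by rewrite -row_mul PP.
have Pn : P *m n^T = n^T by rewrite -{1}PT -trmx_mul nP.
set D := P - n^T *m n.
have DT : D^T = D by rewrite trmx_sub trmx_mul trmxK PT.
have DD : D *m D = D.
  rewrite mulmxBl !mulmxBr PP mulmxA Pn -!(mulmxA n^T) nP [n *m (_ *m _)]mulmxA dotE nn mul1mx.
  by rewrite subrr subr0.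
have tD : \tr D = 0.
  by rewrite linearB /= trP mxtrace_mulC dotE nn mxtrace_scalar subrr.
apply/eqP; rewrite -subr_eq0 -/D; apply/eqP.
have : \tr (D *m D^T) = 0 by rewrite DT DD.
rewrite mxtrace_mul_tr => /eqP; rewrite psumr_eq0 => [/allP h|k _]; last first.
  by apply: sumr_ge0 => j _; rewrite -expr2 sqr_ge0.
apply/matrixP => k l; rewrite [RHS]mxE; have := h k; rewrite mem_index_enum => /(_ isT).
rewrite psumr_eq0 => [/allP h2|j _]; last by rewrite -expr2 sqr_ge0.
by have := h2 l; rewrite mem_index_enum -expr2 sqrf_eq0 => /(_ isT)/eqP.
Qed.

(** The Euler-Rodrigues formulas. They become homogeneous identities once 1 is replaced by a power
    of |n|^2. *)
Lemma RP3_rot (P : 'M[R]_4) : RP3 P ->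
  [/\ dot (cone_a P) (cone_a P) = 1, dot (cone_b P) (cone_b P) = 1,
      dot (cone_a P) (cone_b P) = 0 & crs (cone_a P) (cone_b P) = cone_c P].
Proof.
move=> /RP3_rank1[n nn ->].
have n1 : n 0 0 ^+ 2 + n 0 1 ^+ 2 + n 0 2%:R ^+ 2 + n 0 3%:R ^+ 2 = 1.
  rewrite -nn dot_sum !big_ord_recl big_ord0 addr0 !addrA !expr2.
  by congr (_ * _ + _ * _ + _ * _ + _ * _); congr (n _ _); apply: val_inj.
rewrite !dot3E; split.
- by rewrite -[RHS](expr1n R 2) -n1 !(tr_mulE, mxE) /=; ring.
- by rewrite -[RHS](expr1n R 2) -n1 !(tr_mulE, mxE) /=; ring.
- by rewrite !(tr_mulE, mxE) /=; ring.
- apply: row3P; rewrite crsE !(tr_mulE, mxE) /= -[RHS]mulr1 -[X in _ = _ * X]n1; ring.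
Qed.

(** The quaternion of a rotation has no uniform formula, so idempotency is derived directly from the
    quadratic relations of a rotation matrix. *)
Lemma conemat_RP3 q e : dot q q = 1 -> dot e e = 1 -> dot q e = 0 -> RP3 (conemat 1 q e (crs q e)).
Proof.
move=> qq ee qe.
have [r1 r2] := crs_frame qq ee qe.
have cc := crs_eq0 qq qe; rewrite ee in cc.
have [oo _] := rot3_SO3 qq ee qe.
have col (i j : 'I_3) : q 0 i * q 0 j + e 0 i * e 0 j + crs q e 0 i * crs q e 0 j = (i == j)%:R.
  have := mulmx1C oo => /matrixP/(_ i j); rewrite !mxE !big_ord_recl big_ord0 !mxE /= addr0 addrA => <-.
  by [].
have qc := dot_crsl q e; have ec := dot_crsr q e.
(* The relations of rows, columns and cross products are collected; [lra] then treats the products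
   of entries as unknowns. *)
have k0 := congr1 (fun u : V3 => u 0 0) (erefl (crs q e)).
have k1 := congr1 (fun u : V3 => u 0 1) (erefl (crs q e)).
have k2 := congr1 (fun u : V3 => u 0 2%:R) (erefl (crs q e)).
rewrite [in LHS]crsE in k0; rewrite [in LHS]crsE in k1; rewrite [in LHS]crsE in k2.
have a0 := congr1 (fun u : V3 => u 0 0) r1; have a1 := congr1 (fun u : V3 => u 0 1) r1.
have a2 := congr1 (fun u : V3 => u 0 2%:R) r1.
have b0 := congr1 (fun u : V3 => u 0 0) r2; have b1 := congr1 (fun u : V3 => u 0 1) r2.
have b2 := congr1 (fun u : V3 => u 0 2%:R) r2.
have c00 := col 0 0; have c01 := col 0 1; have c02 := col 0 2%:R.
have c11 := col 1 1; have c12 := col 1 2%:R; have c22 := col 2%:R 2%:R.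
move: {oo col r1 r2} qq ee qe cc qc ec k0 k1 k2 a0 a1 a2 b0 b1 b2 c00 c01 c02 c11 c12 c22.
move: (crs q e) => f; rewrite !crsE !dot3E /=.
rewrite /RP3 /conemat /=.
move: (q 0 0) (q 0 1) (q 0 2%:R) (e 0 0) (e 0 1) (e 0 2%:R) (f 0 0) (f 0 1) (f 0 2%:R).
move=> q0 q1 q2 e0 e1 e2 f0 f1 f2 *.
split.
- apply/matrixP => i j.
  by have [->|->|->|->] := row4E i; have [->|->|->|->] := row4E j; rewrite !mxE.
- rewrite -scalemxAl -scalemxAr; congr (_ *: _); apply/matrixP => i j.
  have [->|->|->|->] := row4E i; have [->|->|->|->] := row4E j;
  rewrite !mxE !big_ord_recl big_ord0 !mxE /=; lra.
- by rewrite tr4 !mxE /=; field.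
Qed.

(** The product of |p| with the projection of the rotation whose rows are q, p / |p| and their cross
    product. Homogeneity removes the division, so the value at p = 0 is 0. *)
Definition cone_chart (z : V3 * V3) : 'M[R]_4 :=
  let r := Num.sqrt (dot z.2 z.2) in conemat r (r *: z.1) z.2 (crs z.1 z.2).
Definition cone_chart_inv Q : V3 * V3 := ((\tr Q)^-1 *: cone_a Q, cone_b Q).

Lemma cone_chart_unit q r e : dot q q = 1 -> 0 <= r -> dot e e = 1 -> dot q e = 0 ->
  cone_chart (q, r *: e) = r *: conemat 1 q e (crs q e).
Proof.
move=> qq r0 ee qe; rewrite /cone_chart /= dotZl dotZr ee mulr1 -expr2 sqrtr_sqr ger0_norm //.
by rewrite crsZr -conematZ mulr1.
Qed.

Lemma cone_RP3 Q : (@coneRP3 R `\ 0) Q -> exists t P, [/\ 0 < t, RP3 P, Q = t *: P & \tr Q = t].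
Proof.
move=> [[t [P [t0 RP ->]]] /= /eqP Q0]; exists t, P.
rewrite scaler_eq0 negb_or in Q0; case/andP: Q0 => tn0 _.
by split=> //; [rewrite lt_def tn0|case: RP => _ _ trP; rewrite linearZ /= trP mulr1].
Qed.

Lemma cone_aZ t Q : cone_a (t *: Q) = t *: cone_a Q.
Proof. apply: row3P; rewrite !mxE /=; ring. Qed.
Lemma cone_bZ t Q : cone_b (t *: Q) = t *: cone_b Q.
Proof. apply: row3P; rewrite !mxE /=; ring. Qed.

Lemma smooth_at_conemat (E : normedModType R) x (r : E -> R^o) (a b c : E -> V3) :
  smooth_at x r -> smooth_at x a -> smooth_at x b -> smooth_at x c ->
  smooth_at x (fun y => conemat (r y) (a y) (b y) (c y)).
Proof.
move=> sr sa sb sc; apply: smooth_at_mx => i j.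
have ea k : smooth_at x (fun y => a y 0 k : R^o) by exact: smooth_at_entry.
have eb k : smooth_at x (fun y => b y 0 k : R^o) by exact: smooth_at_entry.
have ec k : smooth_at x (fun y => c y 0 k : R^o) by exact: smooth_at_entry.
have [->|->|->|->] := row4E i; have [->|->|->|->] := row4E j; under eq_fun do rewrite !mxE /=;
  (apply: smooth_atM; first exact: smooth_at_cst);
  repeat first [exact: sr | exact: ea | exact: eb | exact: ec
               | apply: (@smooth_atD _ _ R^o) | apply: (@smooth_atN _ _ R^o)].
Qed.

Lemma linear_cone_a : linear cone_a.
Proof. move=> t P Q; apply: row3P; rewrite !mxE /=; ring. Qed.
Lemma linear_cone_b : linear cone_b.
Proof. move=> t P Q; apply: row3P; rewrite !mxE /=; ring. Qed.

Lemma smooth_at_cone_chart z : z.2 != 0 -> smooth_at z cone_chart.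
Proof.
move=> z0; have f3 := findim_mx R 1 3.
have s1 : smooth_at z (@fst V3 V3) by apply: smooth_at_lin => //; exact: findim_TS.
have s2 : smooth_at z (@snd V3 V3) by apply: smooth_at_lin => //; exact: findim_TS.
have sr : smooth_at z (fun z : V3 * V3 => Num.sqrt (dot z.2 z.2) : R^o).
  by apply: smooth_at_sqrt; [rewrite dot_gt0|exact: smooth_at_dot].
apply: smooth_at_conemat => //; first exact: smooth_atZ.
exact: smooth_at_crs.
Qed.

Lemma smooth_at_cone_chart_inv Q : \tr Q != 0 -> smooth_at Q cone_chart_inv.
Proof.
move=> Q0; have f3 := findim_mx R 1 3; have f4 := findim_mx R 4 4.
apply: smooth_at_pair => //; last by apply: smooth_at_lin => //; exact: linear_cone_b.
apply: (smooth_atZ (a := fun Q => (\tr Q)^-1 : R^o)).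
  by apply: smooth_atV => //; apply: smooth_at_tr; exact: smooth_at_id.
by apply: smooth_at_lin => //; exact: linear_cone_a.
Qed.

Lemma cone_diffeo :
  diffeo (@TstarS2 R `&` [set z | z.2 != 0]) (@coneRP3 R `\ 0) cone_chart cone_chart_inv.
Proof.
split; first split.
- move=> [q p] [/TstarS2E[qq qp] /= p0].
  have [e ee pE] := normalize p0; set r := Num.sqrt _ in pE.
  have r0 : 0 < r by rewrite sqrtr_gt0 dot_gt0.
  have qe : dot q e = 0.
    by apply: (mulfI (lt0r_neq0 r0)); rewrite -dotZr -pE qp mulr0.
  have cE : cone_chart (q, p) = r *: conemat 1 q e (crs q e).
    by rewrite [in LHS]pE cone_chart_unit // ltW.
  have RP := conemat_RP3 qq ee qe; have [_ _ tr1] := RP.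
  split; first split; first by exists r, (conemat 1 q e (crs q e)); split=> //; exact: ltW.
    move=> /= c0; have := congr1 (@mxtrace R 4) c0.
    by rewrite cE linearZ /= tr1 mulr1 mxtrace0 => /eqP; rewrite gt_eqF.
  have [h1 h2 h3 h4] := conemat_inv r (r *: q) p (crs q p).
  by rewrite /cone_chart_inv /cone_chart /= h1 h2 h3 scalerA mulVf ?gt_eqF // scale1r.
- move=> Q hQ; have [t [P [t0 RP QE trQ]]] := cone_RP3 hQ.
  have [aa bb ab abc] := RP3_rot RP; have [PT _ tr1] := RP.
  have -> : cone_chart_inv Q = (cone_a P, t *: cone_b P).
    by rewrite /cone_chart_inv trQ QE cone_aZ cone_bZ scalerA mulVf ?gt_eqF // scale1r.
  split; first split.
  + by apply/TstarS2E; rewrite dotZr ab mulr0.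
  + by rewrite /= -dot_gt0 dotZl dotZr bb mulr1 mulr_gt0.
  + by rewrite cone_chart_unit ?(ltW t0) // abc QE; congr (_ *: _); rewrite -tr1; exact: conematK.
- by apply: smooth_at_on => z [_ z0]; exact: smooth_at_cone_chart.
- apply: smooth_at_on => Q hQ; apply: smooth_at_cone_chart_inv.
  by have [t [P [t0 _ _ ->]]] := cone_RP3 hQ; rewrite gt_eqF.
Qed.

Lemma cone_RpRP3_diffeo : diffeo (@coneRP3 R `\ 0) (@RpRP3 R)
  (fun Q => ((\tr Q : R^o), (\tr Q)^-1 *: Q)) (fun y : R^o * 'M[R]_4 => y.1 *: y.2).
Proof.
have f4 := findim_mx R 4 4; have f1 := findim_R R.
have fp : findim (R^o * 'M[R]_4)%type by exact: findim_prod.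
split; first split.
- move=> Q hQ; have [t [P [t0 RP QE trQ]]] := cone_RP3 hQ; rewrite trQ QE.
  rewrite !scalerA mulVf ?gt_eqF // scale1r; split; first by split.
  by rewrite mulr1.
- move=> [t P] [/= t0 RP]; have [_ _ tr1] := RP.
  split; first split; first by exists t, P; split=> //; exact: ltW.
    move=> /= c0; have := congr1 (@mxtrace R 4) c0.
    by rewrite linearZ /= tr1 mulr1 mxtrace0 => /eqP; rewrite gt_eqF.
  by rewrite linearZ /= tr1 mulr1 scalerA mulVf ?gt_eqF // scale1r.
- apply: smooth_at_on => Q hQ; have [t [P [t0 RP QE trQ]]] := cone_RP3 hQ.
  have sQ : smooth_at Q (fun Q : 'M[R]_4 => Q) by exact: smooth_at_id.
  have st := smooth_at_tr sQ.
  apply: smooth_at_pair => //.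
  by apply: (smooth_atZ (a := fun Q => (\tr Q)^-1 : R^o)) => //; apply: smooth_atV => //; rewrite trQ gt_eqF.
- apply: smooth_at_on => y _.
  by apply: smooth_atZ; apply: smooth_at_lin.
Qed.

End Cone.

(** * Fibres that contain a regular S^2-orbit *)

Section Smooth5.
Variables (R : realType) (E : normedModType R) (x : E).

Lemma smooth_at_row5 (f : E -> 'rV[R]_3) (g : E -> 'rV[R]_2) :
  smooth_at x f -> smooth_at x g -> smooth_at x (fun y => row5 (f y) (g y)).
Proof.
move=> sf sg.
have -> : (fun y => row5 (f y) (g y)) = (fun y => row5 (f y) 0 + row5 0 (g y)).
  by apply/funext => y; rewrite row5D addr0 add0r.
apply: smooth_atD.
  apply: (smooth_at_comp_lin (f := fun u => row5 u 0)) => //; first exact: findim_mx.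
  by move=> a u w; rewrite row5Z row5D scaler0 addr0.
apply: (smooth_at_comp_lin (f := fun u => row5 0 u)) => //; first exact: findim_mx.
by move=> a u w; rewrite row5Z row5D scaler0 addr0.
Qed.

Lemma smooth_at_block5 (A : E -> 'M[R]_3) (B : E -> 'M[R]_(3, 2)) (D : E -> 'M[R]_(2, 3)) (F : E -> 'M[R]_2) :
  smooth_at x A -> smooth_at x B -> smooth_at x D -> smooth_at x F ->
  smooth_at x (fun y => block5 (A y) (B y) (D y) (F y)).
Proof.
move=> sA sB sD sF.
have -> : (fun y => block5 (A y) (B y) (D y) (F y)) = (fun y =>
   block5 (A y) 0 0 0 + block5 0 (B y) 0 0 + (block5 0 0 (D y) 0 + block5 0 0 0 (F y))).
  by apply/funext => y; rewrite !block5D !(addr0, add0r).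
by apply: smooth_atD; apply: smooth_atD;
  [apply: (smooth_at_comp_lin (f := fun X => block5 X 0 0 0))
  |apply: (smooth_at_comp_lin (f := fun X => block5 0 X 0 0))
  |apply: (smooth_at_comp_lin (f := fun X => block5 0 0 X 0))
  |apply: (smooth_at_comp_lin (f := fun X => block5 0 0 0 X))] => //; try exact: findim_mx;
  move=> a u w; rewrite block5Z block5D !scaler0 !addr0.
Qed.

Lemma smooth_at_star (f : E -> 'rV[R]_3) : smooth_at x f -> smooth_at x (fun y => star (f y)).
Proof.
apply: smooth_at_comp_lin; first exact: findim_mx.
by move=> a u w; rewrite starD starZ.
Qed.

Lemma smooth_at_prp (f : E -> 'rV[R]_2) : smooth_at x f -> smooth_at x (fun y => prp (f y)).
Proof.
apply: smooth_at_comp_lin; first exact: findim_mx.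
move=> a u w; apply: row2P; rewrite !mxE /= ?mxE; ring.
Qed.

Lemma smooth_at_xof (C S : E -> R^o) (u : E -> 'rV[R]_3) (v : E -> 'rV[R]_2) :
  smooth_at x C -> smooth_at x S -> smooth_at x u -> smooth_at x v ->
  smooth_at x (fun y => xof (C y) (S y) (u y) (v y)).
Proof. by move=> *; apply: smooth_at_row5; apply: smooth_atZ. Qed.

Lemma smooth_at_Amat (C S a : E -> R^o) (u w : E -> 'rV[R]_3) (v : E -> 'rV[R]_2) :
  smooth_at x C -> smooth_at x S -> smooth_at x a -> smooth_at x u -> smooth_at x v -> smooth_at x w ->
  smooth_at x (fun y => Amat (C y) (S y) (u y) (v y) (a y) (w y)).
Proof.
move=> sC sS sa su sv sw.
have sc := smooth_at_crs su sw.
have sB : smooth_at x (fun y => Bmat (C y) (S y) (u y) (v y) (a y) (w y)).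
  apply: smooth_atD.
    apply: smooth_at_mulmx; last exact: smooth_at_prp.
    apply: smooth_at_trmx; apply: smooth_atD => //; apply: smooth_atZ => //; exact: smooth_atM.
  by apply: smooth_atZ => //; apply: smooth_at_mulmx => //; exact: smooth_at_trmx.
apply: smooth_at_block5.
- by apply: smooth_atN; apply: smooth_at_star; apply: smooth_atD; apply: smooth_atZ.
- exact: smooth_atN.
- exact: smooth_at_trmx.
- apply: smooth_atZ; [exact: smooth_atM|exact: smooth_at_cst].
Qed.

Lemma smooth_at_xl (f : E -> 'rV[R]_5) : smooth_at x f -> smooth_at x (fun y => xl (f y)).
Proof.
by apply: smooth_at_comp_lin; [exact: findim_mx|move=> a u w; rewrite /xl linearP].
Qed.

Lemma smooth_at_xr (f : E -> 'rV[R]_5) : smooth_at x f -> smooth_at x (fun y => xr (f y)).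
Proof. by apply: smooth_at_comp_lin; [exact: findim_mx|exact: xr_linear]. Qed.

Lemma smooth_at_brow (v : E -> 'rV[R]_2) (A : E -> 'M[R]_5) : smooth_at x v -> smooth_at x A ->
  smooth_at x (fun y => brow (v y) (A y)).
Proof.
move=> sv sA; apply: smooth_at_xl; apply: smooth_at_mulmx => //.
by apply: smooth_at_row5 => //; exact: smooth_at_cst.
Qed.

Lemma smooth_at_rad2 (A : E -> 'M[R]_5) : smooth_at x A -> smooth_at x (fun y => rad2 (A y) : R^o).
Proof.
move=> sA; apply: smooth_atM; last exact: smooth_at_cst.
by apply: smooth_at_tr; apply: smooth_at_mulmx => //; exact: smooth_at_trmx.
Qed.

End Smooth5.

(** * Parametrization by T*S^2 over a root of the cubic *)

Section Fibres.
Variable R : realType.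
Variable c : R.
Hypothesis c0 : 0 <= c.
Implicit Types (s sg g : R) (v : 'rV[R]_2) (p : amb R) (z : 'rV[R]_3 * 'rV[R]_3).

Definition base s (y : 'rV[R]_2) : 'rV[R]_3 := row_mx s%:M y : 'rV_(1 + 2).
Definition fib (b : 'rV[R]_3) : set (amb R) := Mc c `&` bspi c @^-1` [set b].
Definition gfun p : R := Num.sqrt (c + rad2 p.2).

Lemma base_inj s y s' y' : base s y = base s' y' -> s = s' /\ y = y'.
Proof. by move=> /(@eq_row_mx _ 1 1 2)[/matrixP/(_ 0 0)]; rewrite !mxE /= !mulr1n. Qed.

Lemma fibP s y p : fib (base s y) p <->
  [/\ Mc c p, height p.2 = s & Num.sqrt (gfun p) *: xr p.1 = y].
Proof.
split=> [[Mp /base_inj[h1 h2]]|[Mp h1 h2]]; first by [].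
by split=> //=; rewrite /bspi -/(base _ _) h1 /quartic h2.
Qed.

Lemma gfunP p : Mc c p -> 0 < gfun p /\ gfun p ^+ 2 = c + rad2 p.2.
Proof. by move=> [_ h]; rewrite /gfun sqrtr_gt0 sqr_sqrtr // ltW. Qed.

Lemma fib_intro C S (u : 'rV[R]_3) v a w g sg : C ^+ 2 + S ^+ 2 = 1 -> dot u u = 1 -> dot v v = 1 ->
  dot u w = 0 -> 0 < g -> g ^+ 2 = c + (a ^+ 2 + dot w w) -> S * Num.sqrt g = sg ->
  let p := (xof C S u v, Amat C S u v a w) in
  [/\ fib (base (a * C) (sg *: v)) p, gfun p = g & rad2 p.2 = a ^+ 2 + dot w w].
Proof.
move=> CS uu vv uw g0 g2 Sg p.
have [Mp r2] := M_Amat a CS uu vv uw; rewrite -/p in Mp.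
have gE : gfun p = g by rewrite /gfun r2 -g2 sqrtr_sqr gtr0_norm.
split=> //; apply/fibP; rewrite gE; split.
- by split=> //; rewrite r2 -g2 exprn_gt0.
- exact: Amat_height.
- by rewrite /p /xof xr_row5 scalerA mulrC Sg.
Qed.

(** The base point determines x'' once g is known: S is [sg / Num.sqrt g] and takes the sign of
    [sg], while C is chosen nonnegative. *)
Lemma fib_elim s sg v p : dot v v = 1 -> fib (base s (sg *: v)) p -> let g := gfun p in
  exists C u a w, [/\ 0 < g, 0 <= C, dot u u = 1, dot u w = 0 & C ^+ 2 = 1 - sg ^+ 2 / g] /\
    [/\ p.1 = xof C (sg / Num.sqrt g) u v, p.2 = Amat C (sg / Num.sqrt g) u v a w, a * C = s,
        g ^+ 2 = c + rad2 p.2 & rad2 p.2 = a ^+ 2 + dot w w].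
Proof.
move=> vv /fibP[Mp hs hy] g; have [g0 g2] := gfunP Mp; rewrite -/g in g0 g2 hy.
have r0 : 0 < Num.sqrt g by rewrite sqrtr_gt0.
have [u uu xlE] := normalize_any (xl p.1); set C := Num.sqrt _ in xlE.
have xrE : xr p.1 = (sg / Num.sqrt g) *: v.
  apply: (scalerI (lt0r_neq0 r0)); rewrite hy scalerA; congr (_ *: _).
  by rewrite mulrC divfK // gt_eqF.
have pE : p.1 = xof C (sg / Num.sqrt g) u v by rewrite [LHS]row5_eta xlE xrE.
have CS : C ^+ 2 + (sg / Num.sqrt g) ^+ 2 = 1.
  have [Mp1 _] := Mp; have := M_unit Mp1; rewrite dotE => /matrixP/(_ 0 0).
  rewrite !mxE /= !mulr1n => <-; rewrite dot5 xlE xrE !(dotZl, dotZr) uu vv; ring.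
have Sg : (sg / Num.sqrt g) ^+ 2 = sg ^+ 2 / g by rewrite expr_div_n sqr_sqrtr // ltW.
have [a [w [uw AE]]] := M_decomp Mp.1 pE CS uu vv.
exists C, u, a, w; split; split=> //.
- exact: sqrtr_ge0.
- by rewrite -CS Sg; ring.
- by rewrite -hs AE Amat_height.
- by rewrite AE; have [_ ->] := M_Amat a CS uu vv uw.
Qed.

(* [g0] is the value of sqrt (c + r^2) on the S^2-orbit contained in the fibre. *)
Definition root_cond s V g0 : Prop :=
  [/\ 0 < g0, V < g0, c <= g0 ^+ 2 & (g0 ^+ 2 - c) * (g0 - V) = s ^+ 2 * g0].

(* On the fibre, |brow v A|^2 = (g - g0) * hfun g0 V g for g = sqrt (c + r^2). *)
Definition hfun g0 V g : R := g + g0 - V - c * V / (g * g0).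

(** The choice a = s / C gives the height s. The length of w is fixed by r^2, and because |p|^2 = g
    - g0 the vector w is a positive smooth multiple of p even at p = 0. *)
Definition phi1 g0 s sg v z : amb R :=
  let g := g0 + dot z.2 z.2 in
  let C := Num.sqrt (1 - sg ^+ 2 / g) in let S := sg / Num.sqrt g in
  (xof C S z.1 v, Amat C S z.1 v (s / C) ((Num.sqrt (hfun g0 (sg ^+ 2) g) / C) *: z.2)).

Definition inv1 g0 sg v p : 'rV[R]_3 * 'rV[R]_3 :=
  ((Num.sqrt (dot (xl p.1) (xl p.1)))^-1 *: xl p.1,
   (Num.sqrt (hfun g0 (sg ^+ 2) (gfun p)))^-1 *: brow v p.2).

(** Up to the factor g, [hfun] is the quotient of the cubic by g - g0; the term c V / g0 is the
    constant coefficient c V divided by the root. *)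
Lemma hfun_eq s V g0 g : root_cond s V g0 -> g != 0 ->
  (g ^+ 2 - c) * (g - V) - s ^+ 2 * g = (g - g0) * g * hfun g0 V g.
Proof.
move=> [g00 _ _ E] gn.
have n0 : g0 != 0 by rewrite gt_eqF.
apply: (mulIf n0).
transitivity ((g ^+ 2 - c) * (g - V) * g0 - g * (s ^+ 2 * g0)); first by ring.
by rewrite -E /hfun; field; rewrite gn n0.
Qed.

(** The negative term is dominated: c V <= c g <= g g0^2. *)
Lemma hfun_gt0 s V g0 g : root_cond s V g0 -> 0 <= V -> V < g -> 0 < hfun g0 V g.
Proof.
move=> [g00 Vg0 cg0 E] V0 Vg.
have gg : 0 < g by apply: le_lt_trans Vg.
have p0 : 0 < g * g0 by rewrite mulr_gt0.
have -> : hfun g0 V g = (g * g0 * (g - V) + (g * g0 ^+ 2 - c * V)) / (g * g0).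
  by rewrite /hfun; field; rewrite !gt_eqF.
rewrite divr_gt0 // ltr_wpDr ?mulr_gt0 ?subr_gt0 //.
rewrite subr_ge0; apply: (@le_trans _ _ (c * g)); first by rewrite ler_wpM2l // ltW.
by rewrite mulrC ler_wpM2l // ltW.
Qed.

Lemma phi1_inv s sg v g0 z : dot v v = 1 -> root_cond s (sg ^+ 2) g0 -> TstarS2 z ->
  fib (base s (sg *: v)) (phi1 g0 s sg v z) /\ inv1 g0 sg v (phi1 g0 s sg v z) = z.
Proof.
case: z => q p vv rc /TstarS2E[qq qp]; have [g00 Vg0 cg0 E] := rc.
rewrite /phi1 /=; set g := g0 + dot p p; set V := sg ^+ 2.
have V0 : 0 <= V by rewrite sqr_ge0.
have Vg : V < g by rewrite ltr_wpDr ?dot_ge0.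
have gg : 0 < g by exact: le_lt_trans Vg.
have H0 := hfun_gt0 rc V0 Vg; have HE := hfun_eq rc (lt0r_neq0 gg).
have k0 : 0 < 1 - V / g by rewrite subr_gt0 ltr_pdivrMr // mul1r.
set C := Num.sqrt (1 - V / g); set S := sg / Num.sqrt g.
have C0 : 0 < C by rewrite sqrtr_gt0.
have C2 : C ^+ 2 = 1 - V / g by rewrite sqr_sqrtr // ltW.
have S2 : S ^+ 2 = V / g by rewrite expr_div_n sqr_sqrtr // ltW.
set H := hfun g0 V g in H0 HE *.
have H2 : Num.sqrt H ^+ 2 = H by rewrite sqr_sqrtr // ltW.
pose w := (Num.sqrt H / C) *: p.
have g2 : g ^+ 2 = c + ((s / C) ^+ 2 + dot w w).
  rewrite /w dotZl dotZr.
  have -> : dot p p = g - g0 by rewrite /g; ring.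
  have -> : (s / C) ^+ 2 + Num.sqrt H / C * (Num.sqrt H / C * (g - g0)) =
     (s ^+ 2 + Num.sqrt H ^+ 2 * (g - g0)) / C ^+ 2 by field; rewrite gt_eqF.
  have gV : g - V != 0 by rewrite gt_eqF // subr_gt0.
  have gn : g != 0 by rewrite gt_eqF.
  have -> : C ^+ 2 = (g - V) / g by rewrite C2; field.
  rewrite H2.
  have -> : (s ^+ 2 + H * (g - g0)) / ((g - V) / g) = (s ^+ 2 * g + (g - g0) * g * H) / (g - V).
    by field; rewrite gn gV.
  rewrite -HE.
  have -> : s ^+ 2 * g + ((g ^+ 2 - c) * (g - V) - s ^+ 2 * g) = (g ^+ 2 - c) * (g - V) by ring.
  by rewrite mulfK // addrC subrK.
have qw : dot q w = 0 by rewrite dotZr qp mulr0.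
have CS : C ^+ 2 + S ^+ 2 = 1 by rewrite C2 S2 subrK.
have Sg : S * Num.sqrt g = sg by rewrite /S divfK // gt_eqF // sqrtr_gt0.
have [h1 h2 h3] := fib_intro CS qq vv qw gg g2 Sg.
have aC : s / C * C = s by rewrite divfK // gt_eqF.
rewrite aC in h1; split=> //.
rewrite /inv1 h2 -/H /= Amat_brow // /xof xl_row5 dotZl dotZr qq mulr1 -expr2 sqrtr_sqr gtr0_norm //.
rewrite !scalerA mulVf ?gt_eqF // scale1r; congr pair.
have -> : (Num.sqrt H)^-1 * C * (Num.sqrt H / C) = 1 by field; rewrite !gt_eqF ?sqrtr_gt0.
by rewrite scale1r.
Qed.

Lemma inv1_phi s sg v g0 p : dot v v = 1 -> root_cond s (sg ^+ 2) g0 -> fib (base s (sg *: v)) p ->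
  [/\ xl p.1 != 0, sg ^+ 2 < gfun p, TstarS2 (inv1 g0 sg v p) & phi1 g0 s sg v (inv1 g0 sg v p) = p].
Proof.
move=> vv rc Fp; have [g00 Vg0 cg0 E] := rc.
have [C [u [a [w [[g1 C0 uu uw C2] [pE AE aC g2 r2]]]]]] := fib_elim vv Fp.
move: g1 C2 pE AE g2; set g := gfun p; set V := sg ^+ 2; set S := sg / _ => g1 C2 pE AE g2.
have V0 : 0 <= V by rewrite sqr_ge0.
have gn : g != 0 by rewrite gt_eqF.
(* If C = 0, then g = V and s = 0, so the cubic gives c = g0^2; but c <= g^2 would then make V at
   least g0. *)
have C1 : 0 < C.
  rewrite lt_def C0 andbT; apply/eqP => Cn0; move: C2 aC; rewrite Cn0 mulr0 expr0n /= => C2 s0.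
  have gV : g = V by apply/eqP; rewrite -subr_eq0 -(mulIr_eq0 _ (mulIf (invr_neq0 gn))) mulrBl mulfV // -C2.
  move: E; rewrite -s0 expr0n mul0r => /eqP; rewrite mulf_eq0 subr_eq0 [g0 - _ == 0]gt_eqF ?subr_gt0 // orbF => /eqP gc.
  have : c <= g ^+ 2 by rewrite g2 r2 lerDl addr_ge0 ?sqr_ge0 ?dot_ge0.
  by rewrite -gc gV ler_pXn2r ?nnegrE ?(ltW g00) // leNgt Vg0.
have Vg : V < g.
  have : 0 < 1 - V / g by rewrite -C2 exprn_gt0.
  by rewrite subr_gt0 ltr_pdivrMr // mul1r.
have H0 := hfun_gt0 rc V0 Vg; have HE := hfun_eq rc gn.
set H := hfun g0 V g in H0 HE.
have xlE : xl p.1 = C *: u by rewrite pE /xof xl_row5.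
have nx : Num.sqrt (dot (xl p.1) (xl p.1)) = C.
  by rewrite xlE dotZl dotZr uu mulr1 -expr2 sqrtr_sqr gtr0_norm.
have h0 : 0 < Num.sqrt H by rewrite sqrtr_gt0.
have H2 : Num.sqrt H ^+ 2 = H by rewrite sqr_sqrtr // ltW.
have iE : inv1 g0 sg v p = (u, (C / Num.sqrt H) *: w).
  rewrite /inv1 -/g -/V -/H nx xlE AE Amat_brow // !scalerA mulVf ?gt_eqF // scale1r.
  by rewrite (mulrC C).
have gE : g0 + dot ((C / Num.sqrt H) *: w) ((C / Num.sqrt H) *: w) = g.
  rewrite dotZl dotZr.
  have -> : dot w w = g ^+ 2 - c - a ^+ 2 by rewrite g2 r2; ring.
  have -> : C / Num.sqrt H * (C / Num.sqrt H * (g ^+ 2 - c - a ^+ 2)) =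
    ((g ^+ 2 - c) * C ^+ 2 - (a * C) ^+ 2) / Num.sqrt H ^+ 2 by field; rewrite gt_eqF.
  rewrite aC H2 C2.
  have -> : ((g ^+ 2 - c) * (1 - V / g) - s ^+ 2) / H = ((g ^+ 2 - c) * (g - V) - s ^+ 2 * g) / (g * H).
    by field; rewrite gn gt_eqF.
  rewrite HE; have -> : (g - g0) * g * H / (g * H) = g - g0 by field; rewrite gn gt_eqF.
  by rewrite addrC subrK.
split=> //.
- by rewrite xlE -dot_gt0 dotZl dotZr uu mulr1 mulr_gt0.
- by rewrite iE; apply/TstarS2E; rewrite dotZr uw mulr0.
rewrite iE /phi1 /= gE -/V -/S -/H -C2 sqrtr_sqr gtr0_norm // scalerA.
have -> : Num.sqrt H / C * (C / Num.sqrt H) = 1 by field; rewrite !gt_eqF.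
have -> : s / C = a by rewrite -aC mulfK // gt_eqF.
by rewrite scale1r [RHS]surjective_pairing pE AE.
Qed.

Lemma smooth_at_hfun (E : normedModType R) (x : E) (g0 V g : E -> R^o) : g x != 0 -> g0 x != 0 ->
  smooth_at x g0 -> smooth_at x V -> smooth_at x g ->
  smooth_at x (fun y => hfun (g0 y) (V y) (g y) : R^o).
Proof.
move=> gn g0n s0 sV sg'.
apply: (@smooth_atB _ _ R^o); first by apply: (@smooth_atB _ _ R^o) => //; exact: (@smooth_atD _ _ R^o).
apply: smooth_atM; first by apply: smooth_atM => //; exact: smooth_at_cst.
by apply: smooth_atV; [rewrite mulf_neq0|exact: smooth_atM].
Qed.

(** Local triviality requires joint smoothness, with the base point varying too. *)
Lemma smooth_at_phi1 (E : normedModType R) (x : E) (g0 s sg : E -> R^o) (v : E -> 'rV[R]_2)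
    (q p : E -> 'rV[R]_3) :
  root_cond (s x) (sg x ^+ 2) (g0 x) ->
  smooth_at x g0 -> smooth_at x s -> smooth_at x sg -> smooth_at x v -> smooth_at x q -> smooth_at x p ->
  smooth_at x (fun y => phi1 (g0 y) (s y) (sg y) (v y) (q y, p y)).
Proof.
move=> rc sg0 ss ssg sv sq sp; have [g00 Vg0 _ _] := rc.
have f5 := findim_mx R 1 5; have f55 := findim_mx R 5 5.
have s_g : smooth_at x (fun y => g0 y + dot (p y) (p y) : R^o).
  by apply: (@smooth_atD _ _ R^o) => //; exact: smooth_at_dot.
have Vg : sg x ^+ 2 < g0 x + dot (p x) (p x) by rewrite ltr_wpDr ?dot_ge0.
have gg : 0 < g0 x + dot (p x) (p x) by apply: le_lt_trans Vg; rewrite sqr_ge0.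
have sV : smooth_at x (fun y => sg y ^+ 2 : R^o) by exact: smooth_atX.
have k0 : 0 < 1 - sg x ^+ 2 / (g0 x + dot (p x) (p x)) by rewrite subr_gt0 ltr_pdivrMr // mul1r.
have sC : smooth_at x (fun y => Num.sqrt (1 - sg y ^+ 2 / (g0 y + dot (p y) (p y))) : R^o).
  apply: smooth_at_sqrt => //; apply: (@smooth_atB _ _ R^o); first exact: smooth_at_cst.
  by apply: smooth_atM => //; apply: smooth_atV => //; rewrite gt_eqF.
have sS : smooth_at x (fun y => sg y / Num.sqrt (g0 y + dot (p y) (p y)) : R^o).
  apply: smooth_atM => //; apply: smooth_atV; first by rewrite gt_eqF // sqrtr_gt0.
  exact: smooth_at_sqrt.
have sCV : smooth_at x (fun y => (Num.sqrt (1 - sg y ^+ 2 / (g0 y + dot (p y) (p y))))^-1 : R^o).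
  by apply: smooth_atV => //; rewrite gt_eqF // sqrtr_gt0.
apply: smooth_at_pair => //; first exact: smooth_at_xof.
apply: smooth_at_Amat => //; first exact: smooth_atM.
apply: smooth_atZ => //; apply: smooth_atM => //; apply: smooth_at_sqrt.
  by apply: hfun_gt0 rc _ _; rewrite ?sqr_ge0.
by apply: smooth_at_hfun => //; rewrite gt_eqF.
Qed.

Lemma smooth_at_gfun (E : normedModType R) (x : E) (p : E -> amb R) : Mc c (p x) -> smooth_at x p ->
  smooth_at x (fun y => gfun (p y) : R^o).
Proof.
move=> [_ h] sp; apply: smooth_at_sqrt => //; apply: (@smooth_atD _ _ R^o); first exact: smooth_at_cst.
by apply: smooth_at_rad2; apply: smooth_at_snd => //; exact: findim_mx.
Qed.

Lemma smooth_at_inv1 (E : normedModType R) (x : E) (g0 sg : E -> R^o) (v : E -> 'rV[R]_2)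
    (p : E -> amb R) s :
  root_cond s (sg x ^+ 2) (g0 x) -> Mc c (p x) -> xl (p x).1 != 0 -> sg x ^+ 2 < gfun (p x) ->
  smooth_at x g0 -> smooth_at x sg -> smooth_at x v -> smooth_at x p ->
  smooth_at x (fun y => inv1 (g0 y) (sg y) (v y) (p y)).
Proof.
move=> rc Mp x0 Vg sg0 ssg sv sp; have [g00 _ _ _] := rc.
have f5 := findim_mx R 1 5; have f55 := findim_mx R 5 5; have f3 := findim_mx R 1 3.
have s1 : smooth_at x (fun y => xl (p y).1) by apply: smooth_at_xl; exact: smooth_at_fst.
have sd := smooth_at_dot s1 s1.
apply: smooth_at_pair => //.
  apply: smooth_atZ => //; apply: smooth_atV; first by rewrite gt_eqF // sqrtr_gt0 dot_gt0.
  by apply: smooth_at_sqrt => //; rewrite dot_gt0.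
have H0 : 0 < hfun (g0 x) (sg x ^+ 2) (gfun (p x)).
  by apply: hfun_gt0 rc _ _ => //; rewrite sqr_ge0.
apply: smooth_atZ; last by apply: smooth_at_brow => //; exact: smooth_at_snd.
apply: smooth_atV; first by rewrite gt_eqF // sqrtr_gt0.
apply: smooth_at_sqrt => //; apply: smooth_at_hfun => //.
- by rewrite gt_eqF //; apply: le_lt_trans Vg; rewrite sqr_ge0.
- by rewrite gt_eqF.
- exact: smooth_atX.
- exact: smooth_at_gfun.
Qed.

Lemma fib_diffeo1 s sg v g0 : dot v v = 1 -> root_cond s (sg ^+ 2) g0 ->
  diffeo (fib (base s (sg *: v))) (@TstarS2 R) (inv1 g0 sg v) (phi1 g0 s sg v).
Proof.
move=> vv rc; split; first split.
- by move=> p /(inv1_phi vv rc)[].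
- by move=> z; exact: phi1_inv.
- apply: smooth_at_on => p Fp; have [x0 Vg _ _] := inv1_phi vv rc Fp.
  apply: (smooth_at_inv1 (g0 := fun=> g0) (sg := fun=> sg) (v := fun=> v) (p := id) rc) => //;
    try exact: smooth_at_cst; first by case: Fp.
  by apply: smooth_at_id; exact: findim_amb.
- apply: smooth_at_on => z Tz; have f3 := findim_mx R 1 3.
  have -> : phi1 g0 s sg v = (fun z => phi1 g0 s sg v (z.1, z.2)) by apply/funext => -[].
  have sid : smooth_at z (fun z => z) by apply: smooth_at_id; exact: findim_TS.
  apply: (smooth_at_phi1 (g0 := fun=> g0) (s := fun=> s) (sg := fun=> sg) (v := fun=> v) rc);
    try exact: smooth_at_cst; [exact: smooth_at_fst|exact: smooth_at_snd].
Qed.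

End Fibres.

(** * Fibres of vanishing height *)

Section Height0.
Variable R : realType.
Variable c : R.
Hypothesis c0 : 0 <= c.
Implicit Types (S sg g : R) (v : 'rV[R]_2) (p : amb R) (z : 'rV[R]_3 * 'rV[R]_3) (x Q : 'rV[R]_3).

(* The elements of the fibres of M at [row5 x (S *: v)] with vanishing height. *)
Definition Cmat S x v Q : 'M[R]_5 :=
  let B := Q^T *m prp v + (crs Q x)^T *m v in block5 (- (S *: star Q)) (- B) B^T 0.

(** Height 0 means a C = 0. The vector Q and x' = C u then determine the form without any division
    by C, so the description persists where x' vanishes. *)
Lemma Amat_Cmat C S (u w : 'rV[R]_3) v a : C ^+ 2 + S ^+ 2 = 1 -> dot u u = 1 -> dot u w = 0 ->
  a * C = 0 -> let Q := (a * S) *: u + crs u w in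
  [/\ Amat C S u v a w = Cmat S (C *: u) v Q, dot Q (C *: u) = 0 & dot Q Q = a ^+ 2 + dot w w].
Proof.
move=> CS uu uw aC Q.
have aS : a = a * S * S.
  by rewrite -[LHS]mulr1 -CS mulrDr expr2 mulrA aC mul0r add0r expr2 mulrA.
have cu : crs Q (C *: u) = C *: w.
  rewrite crsZr; congr (_ *: _); rewrite crsC /Q crsDr crsZr !crs_crs uw uu scale0r scale1r sub0r.
  by rewrite (_ : crs u u = 0) ?scaler0 ?add0r ?opprK //; apply: row3P; rewrite crsE mxE; ring.
split.
- rewrite /Amat /Cmat cu /Bmat scalemxAl -trmx_scale aC scale0r; congr (block5 (- _) _ _ _).
  rewrite -starZ /Q scalerDr scalerA; congr (star (_ *: _ + _)).
  by rewrite {1}aS mulrC.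
- rewrite /Q dotZr dotDl dotZl uu mulr1 (dotC (crs u w)) dot_crsl addr0.
  by have -> : C * (a * S) = a * C * S; [ring|rewrite aC mul0r].
- rewrite /Q !(dotDl, dotDr, dotZl, dotZr) uu (dotC (crs u w) u) dot_crsl crs_eq0 //.
  by have -> : a ^+ 2 = (a * S) ^+ 2; [rewrite expr2 {2}aS; ring|ring].
Qed.

Lemma Cmat_brow S x v Q : dot v v = 1 -> brow (prp v) (Cmat S x v Q) = Q.
Proof.
move=> vv; rewrite /brow row5M xl_row5 mul0mx add0r linearD /=.
rewrite !trmx_mul !trmxK mulmxDr !mulmxA !dotE dot_prp2 vv (dotC (prp v)) dot_prp.
by rewrite mul1mx mul_scalar_mx scale0r addr0.
Qed.

Lemma Cmat_intro S x v Q g sg : dot x x + S ^+ 2 = 1 -> dot v v = 1 -> dot Q x = 0 ->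
  0 < g -> g ^+ 2 = c + dot Q Q -> S * Num.sqrt g = sg ->
  let p := (row5 x (S *: v), Cmat S x v Q) in
  [/\ fib c (base 0 (sg *: v)) p, gfun c p = g & rad2 p.2 = dot Q Q].
Proof.
move=> xS vv Qx g0 g2 Sg.
(* For x = 0 the direction [u] is free and is taken orthogonal to [Q]. *)
have [C [u [uu uQ xE]]] : exists C u, [/\ dot u u = 1, dot u Q = 0 & x = C *: u].
  have [x0|x0] := eqVneq x 0.
    have [n nn QE] := normalize_any Q; have [u uu nu] := orth_exists nn.
    by exists 0, u; rewrite QE dotZr dotC nu mulr0 scale0r.
  have [u uu uE] := normalize x0; exists (Num.sqrt (dot x x)), u; split=> //.
  have s0 : Num.sqrt (dot x x) != 0 by rewrite gt_eqF // sqrtr_gt0 dot_gt0.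
  by apply: (mulfI s0); rewrite -dotZl -uE dotC Qx mulr0.
have CS : C ^+ 2 + S ^+ 2 = 1 by rewrite -xS xE dotZl dotZr uu mulr1 expr2.
pose w := crs Q u.
have uw : dot u w = 0 by rewrite dot_crsr.
have cuw : crs u w = Q by rewrite /w crs_crs uu uQ scale1r scale0r subr0.
have ww : dot w w = dot Q Q by rewrite dot_crs2 uu (dotC Q u) uQ; ring.
have g2' : g ^+ 2 = c + (0 ^+ 2 + dot w w) by rewrite ww expr0n add0r.
have [h1 h2 h3] := fib_intro CS uu vv uw g0 g2' Sg.
have [AE _ _] := Amat_Cmat v CS uu uw (mul0r C).
rewrite mul0r scale0r add0r cuw in AE; rewrite mul0r in h1.
by move: h1 h2 h3; rewrite /xof -/w AE -xE expr0n add0r ww.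
Qed.

Lemma Cmat_elim sg v p : dot v v = 1 -> fib c (base 0 (sg *: v)) p ->
  let g := gfun c p in let x := xl p.1 in let Q := brow (prp v) p.2 in
  [/\ 0 < g, g ^+ 2 = c + rad2 p.2, dot x x = 1 - sg ^+ 2 / g, dot Q x = 0 & rad2 p.2 = dot Q Q] /\
  p = (row5 x ((sg / Num.sqrt g) *: v), Cmat (sg / Num.sqrt g) x v Q).
Proof.
move=> vv Fp g x Q.
have [C [u [a [w [[g0 C0 uu uw C2] [pE AE aC g2 r2]]]]]] := fib_elim vv Fp.
rewrite -/g in g0 C2 pE AE g2; set S := sg / _ in pE AE *.
have CS : C ^+ 2 + S ^+ 2 = 1 by rewrite C2 /S expr_div_n sqr_sqrtr ?(ltW g0) // subrK.
have xE : x = C *: u by rewrite /x pE /xof xl_row5.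
have [E1 E2 E3] := Amat_Cmat v CS uu uw aC.
have QE : Q = (a * S) *: u + crs u w by rewrite /Q AE E1 Cmat_brow.
split; last by rewrite [LHS]surjective_pairing pE AE xE QE E1.
split=> //; first by rewrite xE dotZl dotZr uu mulr1 -expr2.
- by rewrite QE xE.
- by rewrite QE E3.
Qed.

(** Here [z] is Q together with x' scaled by sqrt g, so that |x'|^2 = 1 - V / g reads g = V +
    |z.2|^2. As Q is not normalized, the map is smooth at (0, 0) too when [sg] is nonzero. *)
Definition hor2 sg v z : amb R :=
  let g := sg ^+ 2 + dot z.2 z.2 in let S := sg / Num.sqrt g in
  let x := (Num.sqrt g)^-1 *: z.2 in (row5 x (S *: v), Cmat S x v z.1).

Definition phi2 sg v z : amb R :=
  hor2 sg v (Num.sqrt ((sg ^+ 2 + dot z.2 z.2) ^+ 2 - c) *: z.1, z.2).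

Definition inv2 v p : 'rV[R]_3 * 'rV[R]_3 :=
  ((Num.sqrt (rad2 p.2))^-1 *: brow (prp v) p.2, Num.sqrt (gfun c p) *: xl p.1).

Lemma hor2_fib sg v z : dot v v = 1 -> dot z.1 z.2 = 0 -> 0 < sg ^+ 2 + dot z.2 z.2 ->
  (sg ^+ 2 + dot z.2 z.2) ^+ 2 = c + dot z.1 z.1 ->
  [/\ fib c (base 0 (sg *: v)) (hor2 sg v z), gfun c (hor2 sg v z) = sg ^+ 2 + dot z.2 z.2 &
      rad2 (hor2 sg v z).2 = dot z.1 z.1].
Proof.
move=> vv z12 g0 g2; rewrite /hor2 /=; set g := sg ^+ 2 + _ in g0 g2 *.
have s0 : 0 < Num.sqrt g by rewrite sqrtr_gt0.
have s2 : Num.sqrt g ^+ 2 = g by rewrite sqr_sqrtr // ltW.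
apply: Cmat_intro => //.
- have -> : dot ((Num.sqrt g)^-1 *: z.2) ((Num.sqrt g)^-1 *: z.2) + (sg / Num.sqrt g) ^+ 2 =
     g / Num.sqrt g ^+ 2.
    rewrite dotZl dotZr; have -> : dot z.2 z.2 = g - sg ^+ 2 by rewrite /g addrAC subrr add0r.
    by field; rewrite gt_eqF.
  by rewrite s2 mulfV // gt_eqF.
- by rewrite dotZr z12 mulr0.
- by rewrite divfK // gt_eqF.
Qed.

(** The inequality says r > 0, so that Q has a direction. *)
Definition outer sg : set ('rV[R]_3 * 'rV[R]_3) :=
  @TstarS2 R `&` [set z | c < (sg ^+ 2 + dot z.2 z.2) ^+ 2].

Lemma outer_pos sg z : outer sg z -> 0 < sg ^+ 2 + dot z.2 z.2.
Proof.
move=> [_ /= h]; rewrite lt_def addr_ge0 ?sqr_ge0 ?dot_ge0 // andbT.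
by apply: contraTneq h => ->; rewrite expr0n -leNgt.
Qed.

Lemma phi2_inv sg v z : dot v v = 1 -> outer sg z ->
  [/\ fib c (base 0 (sg *: v)) (phi2 sg v z), 0 < rad2 (phi2 sg v z).2 & inv2 v (phi2 sg v z) = z].
Proof.
case: z => q p vv /[dup] /outer_pos g0 [/TstarS2E[qq qp] /= cg].
rewrite /= in g0; rewrite /phi2 /=; set g := sg ^+ 2 + dot p p in g0 cg *.
have k0 : 0 < g ^+ 2 - c by rewrite subr_gt0.
set r := Num.sqrt (g ^+ 2 - c).
have r0 : 0 < r by rewrite sqrtr_gt0.
have r2 : r ^+ 2 = g ^+ 2 - c by rewrite sqr_sqrtr // ltW.
have QQ : dot (r *: q) (r *: q) = r ^+ 2 by rewrite dotZl dotZr qq mulr1.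
have [||h1 h2 h3] := @hor2_fib sg v (r *: q, p) vv _ g0; rewrite /= ?dotZl ?qp ?mulr0 //.
  by rewrite dotZr qq mulr1 -expr2 r2 [RHS]addrC subrK.
rewrite /= QQ in h3; split=> //; first by rewrite h3 exprn_gt0.
rewrite /inv2 h2 h3 sqrtr_sqr gtr0_norm // /hor2 /= Cmat_brow // xl_row5 !scalerA.
by rewrite mulVf ?gt_eqF // mulfV ?gt_eqF ?sqrtr_gt0 // !scale1r.
Qed.

Lemma inv2_phi sg v p : dot v v = 1 -> fib c (base 0 (sg *: v)) p -> 0 < rad2 p.2 ->
  outer sg (inv2 v p) /\ phi2 sg v (inv2 v p) = p.
Proof.
move=> vv Fp r0; have [[g0 g2 xx Qx r2] pE] := Cmat_elim vv Fp.
rewrite /inv2; set g := gfun c p in g0 g2 xx pE *; set x := xl p.1 in xx Qx pE *.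
set Q := brow _ _ in Qx r2 pE *; set r := Num.sqrt (rad2 p.2).
have rp : 0 < r by rewrite sqrtr_gt0.
have rr : r ^+ 2 = rad2 p.2 by rewrite sqr_sqrtr // ltW.
have s2 : Num.sqrt g ^+ 2 = g by rewrite sqr_sqrtr // ltW.
have gE : sg ^+ 2 + dot (Num.sqrt g *: x) (Num.sqrt g *: x) = g.
  rewrite dotZl dotZr mulrA -expr2 s2 xx; field; exact: lt0r_neq0.
split; first split.
- apply/TstarS2E; rewrite !(dotZl, dotZr) Qx !mulr0; split=> //.
  by rewrite mulrA -r2 -rr; field; rewrite gt_eqF.
- by rewrite /= gE g2 ltrDl.
rewrite /phi2 /hor2 /= gE g2 (addrC c) addrK -/r [RHS]pE !scalerA.
have s0 : 0 < Num.sqrt g by rewrite sqrtr_gt0.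
by rewrite (mulVf (lt0r_neq0 s0)) (mulfV (lt0r_neq0 rp)) !scale1r.
Qed.

Lemma smooth_at_Cmat (E : normedModType R) (y : E) (S : E -> R^o) (x Q : E -> 'rV[R]_3) v :
  smooth_at y S -> smooth_at y x -> smooth_at y Q -> smooth_at y (fun t => Cmat (S t) (x t) v (Q t)).
Proof.
move=> sS sx sQ.
have sB : smooth_at y (fun t => (Q t)^T *m prp v + (crs (Q t) (x t))^T *m v).
  apply: smooth_atD; apply: smooth_at_mulmx; try exact: smooth_at_cst; apply: smooth_at_trmx => //.
  exact: smooth_at_crs.
apply: smooth_at_block5.
- by apply: smooth_atN; apply: smooth_atZ => //; exact: smooth_at_star.
- exact: smooth_atN.
- exact: smooth_at_trmx.
- exact: smooth_at_cst.
Qed.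

Lemma smooth_at_hor2 (E : normedModType R) (y : E) (Q p : E -> 'rV[R]_3) sg v :
  0 < sg ^+ 2 + dot (p y) (p y) -> smooth_at y Q -> smooth_at y p ->
  smooth_at y (fun t => hor2 sg v (Q t, p t)).
Proof.
move=> g0 sQ sp; have f5 := findim_mx R 1 5; have f55 := findim_mx R 5 5.
have s_g : smooth_at y (fun t => Num.sqrt (sg ^+ 2 + dot (p t) (p t)) : R^o).
  apply: smooth_at_sqrt => //; apply: (@smooth_atD _ _ R^o); first exact: smooth_at_cst.
  exact: smooth_at_dot.
have si : smooth_at y (fun t => (Num.sqrt (sg ^+ 2 + dot (p t) (p t)))^-1 : R^o).
  by apply: smooth_atV => //; rewrite gt_eqF // sqrtr_gt0.
have sS : smooth_at y (fun t => sg / Num.sqrt (sg ^+ 2 + dot (p t) (p t)) : R^o).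
  by apply: smooth_atM => //; exact: smooth_at_cst.
have sx : smooth_at y (fun t => (Num.sqrt (sg ^+ 2 + dot (p t) (p t)))^-1 *: p t) by exact: smooth_atZ.
apply: smooth_at_pair => //; last exact: smooth_at_Cmat.
by apply: smooth_at_row5 => //; apply: smooth_atZ => //; exact: smooth_at_cst.
Qed.

Lemma smooth_at_inv2 v p : Mc c p -> 0 < rad2 p.2 -> smooth_at p (inv2 v).
Proof.
move=> Mp r0; have f5 := findim_mx R 1 5; have f55 := findim_mx R 5 5; have f3 := findim_mx R 1 3.
have sid : smooth_at p (fun p => p) by apply: smooth_at_id; exact: findim_amb.
have s2 : smooth_at p (fun p : amb R => p.2) by exact: smooth_at_snd.
have s1 : smooth_at p (fun p : amb R => p.1) by exact: smooth_at_fst.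
apply: smooth_at_pair => //.
  apply: smooth_atZ; last by apply: smooth_at_brow => //; exact: smooth_at_cst.
  apply: smooth_atV; first by rewrite gt_eqF // sqrtr_gt0.
  by apply: smooth_at_sqrt => //; exact: smooth_at_rad2.
apply: smooth_atZ; last exact: smooth_at_xl.
apply: smooth_at_sqrt; last exact: smooth_at_gfun.
by have [] := gfunP Mp.
Qed.

Lemma smooth_at_phi2 sg v z : outer sg z -> smooth_at z (phi2 sg v).
Proof.
move=> /[dup] /outer_pos g0 [_ /= cg]; have f3 := findim_mx R 1 3.
have sid : smooth_at z (fun z => z) by apply: smooth_at_id; exact: findim_TS.
have s1 : smooth_at z (@fst 'rV[R]_3 'rV[R]_3) by exact: smooth_at_fst.
have s2 : smooth_at z (@snd 'rV[R]_3 'rV[R]_3) by exact: smooth_at_snd.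
apply: smooth_at_hor2 => //; apply: smooth_atZ => //.
apply: smooth_at_sqrt; first by rewrite subr_gt0.
apply: (@smooth_atB _ _ R^o); last exact: smooth_at_cst.
apply: smooth_atX; apply: (@smooth_atD _ _ R^o); [exact: smooth_at_cst|exact: smooth_at_dot].
Qed.

Lemma fib_diffeo2 sg v : dot v v = 1 ->
  diffeo (fib c (base 0 (sg *: v)) `&` [set p | 0 < rad2 p.2]) (outer sg) (inv2 v) (phi2 sg v).
Proof.
move=> vv; split; first split.
- by move=> p [Fp r0]; exact: inv2_phi.
- by move=> z /(phi2_inv vv)[].
- by apply: smooth_at_on => p [[Mp _] r0]; exact: smooth_at_inv2.
- by apply: smooth_at_on => z; exact: smooth_at_phi2.
Qed.

Lemma gfun_ge sg v p : dot v v = 1 -> fib c (base 0 (sg *: v)) p -> sg ^+ 2 <= gfun c p.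
Proof.
move=> vv Fp; have [[g0 _ xx _ _] _] := Cmat_elim vv Fp.
by have := dot_ge0 (xl p.1); rewrite xx subr_ge0 ler_pdivrMr // mul1r.
Qed.

Lemma fib_outside sg v : dot v v = 1 -> c < (sg ^+ 2) ^+ 2 ->
  fib c (base 0 (sg *: v)) `&` [set p | 0 < rad2 p.2] = fib c (base 0 (sg *: v)) /\ outer sg = @TstarS2 R.
Proof.
move=> vv cV; split; apply/seteqP; split=> [x []//|].
- move=> p Fp; split=> //=; have gV := gfun_ge vv Fp; have [[g0 g2 _ _ _] _] := Cmat_elim vv Fp.
  rewrite -(ltrD2l c) addr0 -g2; apply: lt_le_trans cV _.
  by rewrite ler_pXn2r ?nnegrE ?sqr_ge0 // ltW.
- move=> z Tz; split=> //=; apply: lt_le_trans cV _.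
  by rewrite ler_pXn2r ?nnegrE ?addr_ge0 ?sqr_ge0 ?dot_ge0 // lerDl dot_ge0.
Qed.

Lemma outer_eq sg : c = (sg ^+ 2) ^+ 2 -> outer sg = @TstarS2 R `&` [set z | z.2 != 0].
Proof.
move=> cV; rewrite /outer; congr (_ `&` _); apply/seteqP; split=> z /=; rewrite cV.
  by move=> h; apply: contraTneq h => ->; rewrite dot0l addr0 ltxx.
move=> z0; rewrite ltr_pXn2r ?nnegrE ?addr_ge0 ?sqr_ge0 ?dot_ge0 //.
by rewrite ltrDl dot_gt0.
Qed.

End Height0.

(** * The vertex of a singular fibre *)

Section SecondOrder.
Variable R : realType.
Implicit Types E F : normedModType R.

Lemma ck_local E F k (V : set E) (f : E -> F) :
  (forall x, V x -> exists W, W x /\ ck k W f) -> ck k V f.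
Proof.
elim: k f => [|k IH] f H; (split; first by move=> x /H[W [Wx [h _]]]; exact: h) => //.
split=> [x v /H[W [Wx [_ [h _]]]]|v]; first exact: h.
by apply: IH => x /H[W [Wx [_ [_ h]]]]; exists W; split=> //; exact: h.
Qed.

Lemma smooth_at_local E F (V : set E) (f : E -> F) :
  (forall x, V x -> smooth_at x f) -> smooth_open V f.
Proof. by move=> H k; apply: ck_local => x /H[W [_ Wx sf]]; exists W; split. Qed.

Lemma continuous_line E F (B : E -> F) x v : {for x, continuous B} ->
  (fun h : R => B (h *: v + x)) @ 0^' --> B x.
Proof.
move=> cB.
have cl : {for (0 : R^o), continuous (fun h : R^o => h *: v + x)}.
  apply: smooth_at_continuous; apply: smooth_atD; last exact: smooth_at_cst.
  by apply: smooth_atZ; [exact: smooth_at_id (findim_R R)|exact: smooth_at_cst].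
have : {for (0 : R^o), continuous (fun h : R^o => B (h *: v + x))}.
  by apply: continuous_comp cl _; rewrite scale0r add0r.
by move/continuous_withinNx; rewrite scale0r add0r.
Qed.

(** At a zero of [N] the continuity of [B] suffices. For the root of the cubic, [B] will contain the
    very function whose derivative is sought. *)
Lemma is_derive_scale0 E F (N : E -> R^o) (B : E -> F) x v d : N x = 0 ->
  is_derive x v N d -> {for x, continuous B} -> is_derive x v (fun y => N y *: B y) (d *: B x).
Proof.
move=> N0 /derivable_cvg dN /continuous_line-/(_ v) cB; apply: cvg_is_derive.
have FF : Filter (0 : R)^' by exact: dnbhs_filter.
apply: cvg_trans (@cvgZ _ _ _ _ FF _ _ _ _ dN cB).
apply: near_eq_cvg; near=> h => /=.
by rewrite N0 scale0r !subr0 [RHS]scalerA.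
Unshelve. all: by end_near. Qed.

(** Both curves start at 0, so their inner product divided by t^2 tends to the inner product of the
    velocities. *)
Lemma dot_derive0 n (I : set R^o) (f h : R^o -> 'rV[R]_n) df dh :
  open I -> I 0 -> is_derive (0 : R^o) (1 : R^o) f df -> is_derive (0 : R^o) (1 : R^o) h dh ->
  f 0 = 0 -> h 0 = 0 -> (forall t, I t -> dot (f t) (h t) = 0) -> dot df dh = 0.
Proof.
move=> oI I0 /derivable_cvg cf /derivable_cvg ch f0 h0 fh.
have FF : ProperFilter (0 : R)^' by exact: Proper_dnbhs_numFieldType.
have fn := findim_mx R 1 n.
have cd : {for (df, dh), continuous (fun z : 'rV[R]_n * 'rV[R]_n => dot z.1 z.2 : R^o)}.
  have sid : smooth_at (df, dh) (fun z : 'rV[R]_n * 'rV[R]_n => z) by apply: smooth_at_id; exact: findim_prod.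
  by apply: smooth_at_continuous; apply: smooth_at_dot; [exact: smooth_at_fst|exact: smooth_at_snd].
have c1 := cvg_comp _ _ (cvg_pair (FF := FF) (FG := nbhs_filter _) (FH := nbhs_filter _) cf ch) cd.
apply: (@cvg_unique _ (@norm_hausdorff _ R^o) _ _ _ _ c1).
apply: cvg_near_cst; near=> t.
rewrite /= f0 h0 !subr0 !addr0 dotZl dotZr fh ?mulr0 //.
have -> : t *: (1 : R^o) = t by rewrite /GRing.scale /= mulr1.
near: t; apply: nbhs_dnbhs; exact: open_nbhs_nbhs.
Unshelve. all: by end_near. Qed.

Lemma mx_norm_le m n (A : 'M[R]_(m, n)) (r : R) : 0 <= r -> (forall i j, `|A i j| <= r) -> `|A| <= r.
Proof.
move=> r0 H; rewrite /Num.norm /=.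
have [->//|/mx_norm_neq0[i ->]] := eqVneq (mx_norm A) 0; exact: H.
Qed.

Lemma cvg_within_le E F (S : set E) (f : E -> F) (h : E -> R^o) x : {for x, continuous h} ->
  h x = 0 -> (forall y, S y -> `|f y| <= h y) -> f @ within S (nbhs x) --> (0 : F).
Proof.
move=> ch hx fh; apply/cvgr0Pnorm_lt => eps eps0.
have : \forall y \near x, `|h y| < eps.
  have c0 : h @ x --> (0 : R^o) by rewrite -hx; exact: ch.
  exact: cvgr0_norm_lt c0 _ eps0.
move=> H; rewrite near_withinE; near=> y => Sy.
apply: le_lt_trans (fh y Sy) _; apply: le_lt_trans (ler_norm _) _; near: y; exact: H.
Unshelve. all: by end_near. Qed.

End SecondOrder.

(** * The singular point and the cone over RP^3 *)

Section Vertex.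
Variable R : realType.
Variables (c sg : R) (v : 'rV[R]_2).
Hypotheses (cp : 0 < c) (cV : c = (sg ^+ 2) ^+ 2) (vv : dot v v = 1).

Let V := sg ^+ 2.
Let N := fib c (base 0 (sg *: v)).

Definition vertex : amb R := hor2 sg v (0, 0).

Let V0 : 0 < V.
Proof.
rewrite lt_def sqr_ge0 andbT; apply/eqP => h.
by move: cp; rewrite cV -/V h expr0n ltxx.
Qed.

Let c0 : 0 <= c. Proof. exact: ltW. Qed.

Lemma vertex_fib : N vertex /\ rad2 vertex.2 = 0.
Proof.
have [|||h1 _ h3] := @hor2_fib R c sg v (0, 0) vv; rewrite ?dot0l ?addr0 //.
by rewrite h3 dot0l.
Qed.

(** From r = 0 follow Q = 0 and g^2 = c = V^2; then g = V forces x' = 0. *)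
Lemma vertex_unique p : N p -> rad2 p.2 = 0 -> p = vertex.
Proof.
move=> Fp r0; have [[g0 g2 xx _ r2] pE] := Cmat_elim vv Fp.
have gV : gfun c p = V.
  by apply/eqP; rewrite -(@eqrXn2 _ 2) ?(ltW g0) ?(ltW V0) // g2 r0 addr0 [X in X == _]cV.
have x0 : xl p.1 = 0 by apply/eqP; rewrite -dot_eq0 xx gV -/V mulfV ?subrr // gt_eqF.
have Q0 : brow (prp v) p.2 = 0 by apply/eqP; rewrite -dot_eq0 -r2 r0.
by rewrite pE gV x0 Q0 /vertex /hor2 /= dot0l addr0 scaler0.
Qed.

Lemma vertex_xl p : N p -> (xl p.1 = 0 /\ rad2 p.2 = 0) <-> p = vertex.
Proof.
move=> Np; split=> [[_ /(vertex_unique Np)]//|->].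
by split; [rewrite /vertex /hor2 /= xl_row5 scaler0|case: vertex_fib].
Qed.

Section Curve.
Variables q e : 'rV[R]_3.
Hypotheses (qq : dot q q = 1) (ee : dot e e = 1) (qe : dot q e = 0).

(* For t < 0 the curve continues through the vertex along the opposite ray. *)
Definition vcurve (t : R^o) : amb R := hor2 sg v (t *: (Num.sqrt (2 * V + t ^+ 2) *: q), t *: e).

(** Here g = V + t^2 and c = V^2, so r^2 = g^2 - c = t^2 (2 V + t^2); this is the origin of the
    square root in [vcurve]. *)
Lemma vcurve_fib t : N (vcurve t) /\ rad2 (vcurve t).2 = t ^+ 2 * (2 * V + t ^+ 2).
Proof.
set k := 2 * V + t ^+ 2.
have k0 : 0 < k by rewrite ltr_wpDr ?sqr_ge0 // mulr_gt0.
have k2 : Num.sqrt k ^+ 2 = k by rewrite sqr_sqrtr // ltW.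
have dq : dot (t *: (Num.sqrt k *: q)) (t *: (Num.sqrt k *: q)) = t ^+ 2 * k.
  rewrite !(dotZl, dotZr) qq; transitivity (t ^+ 2 * Num.sqrt k ^+ 2); last by rewrite k2.
  by move: (Num.sqrt k) => a; ring.
have dd : dot (t *: e) (t *: e) = t ^+ 2 by rewrite !(dotZl, dotZr) ee; ring.
have [|||h1 _ h3] := @hor2_fib R c sg v (t *: (Num.sqrt k *: q), t *: e) vv.
- by rewrite /= !(dotZl, dotZr) qe !mulr0.
- by rewrite /= dd ltr_wpDr ?sqr_ge0.
- by rewrite /= dq dd /k cV -/V; ring.
rewrite /vcurve -/k; split; [exact: h1|exact: etrans h3 dq].
Qed.

Lemma vcurve0 : vcurve 0 = vertex.
Proof. by rewrite /vcurve !scale0r. Qed.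

Lemma smooth_vcurve t : smooth_at t vcurve.
Proof.
have sid : smooth_at t (fun t : R^o => t) by exact: smooth_at_id (findim_R R).
apply: smooth_at_hor2.
- by rewrite ltr_wpDr ?dot_ge0.
- apply: smooth_atZ => //; apply: smooth_atZ; last exact: smooth_at_cst.
  apply: smooth_at_sqrt; first by rewrite ltr_wpDr ?sqr_ge0 // mulr_gt0.
  by apply: (@smooth_atD _ _ R^o); [exact: smooth_at_cst|exact: smooth_atX].
- by apply: smooth_atZ => //; exact: smooth_at_cst.
Qed.

(** Both components carry the factor t, so the velocity is read off the cofactors at t = 0. Every
    orthonormal pair (q, e) occurs. *)
Lemma vcurve_tangent : exists2 u, tangent N vertex u &
  xl u.1 = (Num.sqrt V)^-1 *: e /\ brow (prp v) u.2 = Num.sqrt (2 * V) *: q.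
Proof.
have f5 := findim_mx R 1 5; have f55 := findim_mx R 5 5; have fa := findim_amb R.
have sid : smooth_at (0 : R^o) (fun t : R^o => t) by exact: smooth_at_id (findim_R R).
have dg := smooth_at_is_derive (1 : R^o) (smooth_vcurve 0).
set u := 'D_ _ _ _ in dg; exists u.
  exists setT, vcurve; split; [exact: openT|exact: Logic.I| | |split].
  - by apply: smooth_at_local => t _; exact: smooth_vcurve.
  - by move=> t _; case: (vcurve_fib t).
  - exact: vcurve0.
  - exact: dg.
have d1 : is_derive (0 : R^o) (1 : R^o) (fun t => (vcurve t).1) u.1 by apply: (is_derive_linear (l := fst)) dg.
have d2 : is_derive (0 : R^o) (1 : R^o) (fun t => (vcurve t).2) u.2 by apply: (is_derive_linear (l := snd)) dg.
have dt : is_derive (0 : R^o) (1 : R^o) (fun t : R^o => t : R^o) (1 : R^o) by exact: is_derive_id.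
split.
- have lxl : linear (@xl R) by move=> a x y; rewrite /xl linearP.
  apply: is_derive_unique (is_derive_linear f5 lxl d1) _.
  pose B (t : R^o) : 'rV[R]_3 := (Num.sqrt (sg ^+ 2 + dot (t *: e) (t *: e)))^-1 *: e.
  have -> : (fun t => xl (vcurve t).1) = (fun t : R^o => t *: B t).
    by apply/funext => t; rewrite /vcurve /hor2 /= xl_row5 /B !scalerA mulrC.
  have -> : (Num.sqrt V)^-1 *: e = (1 : R^o) *: B 0 by rewrite scale1r /B scale0r dot0l addr0.
  apply: (is_derive_scale0 (N := fun t : R^o => t : R^o) (erefl _) dt).
  apply: smooth_at_continuous; apply: smooth_atZ; last exact: smooth_at_cst.
  have s0 : 0 < sg ^+ 2 + dot ((0 : R^o) *: e) ((0 : R^o) *: e) by rewrite scale0r dot0l addr0.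
  apply: smooth_atV; first by rewrite gt_eqF // sqrtr_gt0.
  apply: smooth_at_sqrt => //; apply: (@smooth_atD _ _ R^o); first exact: smooth_at_cst.
  by apply: smooth_at_dot; apply: smooth_atZ => //; exact: smooth_at_cst.
- have lb : linear (@brow R (prp v)).
    by move=> a A A'; rewrite /brow mulmxDr -scalemxAr /xl linearP.
  apply: is_derive_unique (is_derive_linear f55 lb d2) _.
  pose B (t : R^o) : 'rV[R]_3 := Num.sqrt (2 * V + t ^+ 2) *: q.
  have -> : (fun t => brow (prp v) (vcurve t).2) = (fun t : R^o => t *: B t).
    by apply/funext => t; rewrite /vcurve /hor2 /= Cmat_brow.
  have -> : Num.sqrt (2 * V) *: q = (1 : R^o) *: B 0 by rewrite scale1r /B expr0n addr0.
  apply: (is_derive_scale0 (N := fun t : R^o => t : R^o) (erefl _) dt).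
  apply: smooth_at_continuous; apply: smooth_atZ; last exact: smooth_at_cst.
  apply: smooth_at_sqrt; first by rewrite expr0n addr0 mulr_gt0.
  by apply: (@smooth_atD _ _ R^o); [exact: smooth_at_cst|exact: smooth_atX].
Qed.

End Curve.

(* The cone over RP^3 is not smooth at its vertex: on N the vectors [xl] and
   [brow (prp v)] are orthogonal, so their velocities at the vertex are too,
   and this quadratic condition is not preserved by sums. *)
Lemma vertex_singular : ~ smooth_points 4 N vertex.
Proof.
move=> sm; have f5 := findim_mx R 1 5; have f55 := findim_mx R 5 5; have fa := findim_amb R.
have [e1 e11] : exists2 e1 : 'rV[R]_3, dot e1 e1 = 1 & True.
  by have [u uu _] := normalize_any (0 : 'rV[R]_3); exists u.
have [e2 e22 e12] := orth_exists e11 => _; set e3 := crs e1 e2.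
have e33 : dot e3 e3 = 1 by rewrite crs_eq0.
have e13 : dot e1 e3 = 0 by exact: dot_crsl.
have e23 : dot e2 e3 = 0 by exact: dot_crsr.
have e21 : dot e2 e1 = 0 by rewrite dotC.
have e32 : dot e3 e2 = 0 by rewrite dotC.
(* In the sum of the two velocities x' is along e1 + e2 and Q along e2 + e3, so e2 is a common part
   and the inner product is positive. *)
have [u1 t1 [x1 b1]] := vcurve_tangent e22 e11 e21.
have [u2 t2 [x2 b2]] := vcurve_tangent e33 e22 e32.
have [I [gam [oI I0 sg' Ng [g0 dg]]]] := tangentD fa sm t1 t2.
have d1 : is_derive (0 : R^o) (1 : R^o) (fun t => (gam t).1) (u1 + u2).1.
  by apply: (is_derive_linear (l := fst)) dg.
have d2 : is_derive (0 : R^o) (1 : R^o) (fun t => (gam t).2) (u1 + u2).2.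
  by apply: (is_derive_linear (l := snd)) dg.
have lxl : linear (@xl R) by move=> a x y; rewrite /xl linearP.
have lb : linear (@brow R (prp v)).
  by move=> a A A'; rewrite /brow mulmxDr -scalemxAr /xl linearP.
have xD (x y : 'rV[R]_5) : xl (x + y) = xl x + xl y by have := lxl 1 x y; rewrite !scale1r.
have bD (A B : 'M[R]_5) : brow (prp v) (A + B) = brow (prp v) A + brow (prp v) B.
  by have := lb 1 A B; rewrite !scale1r.
have [x0 _] := (vertex_xl vertex_fib.1).2 erefl.
have b0 : brow (prp v) vertex.2 = 0.
  have [[_ _ _ _ r2] _] := Cmat_elim vv vertex_fib.1.
  by apply/eqP; rewrite -dot_eq0 -r2 vertex_fib.2.
have orth t : I t -> dot (brow (prp v) (gam t).2) (xl (gam t).1) = 0.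
  by move=> It; have [[_ _ _ h _] _] := Cmat_elim vv (Ng t It).
have := dot_derive0 oI I0 (is_derive_linear f55 lb d2) (is_derive_linear f5 lxl d1).
rewrite /= g0 x0 b0 => /(_ erefl erefl); rewrite xD bD x1 x2 b1 b2.
rewrite -!scalerDr dotZl dotZr !(dotDl, dotDr) e21 e22 (dotC e3 e1) e13 e32 add0r !addr0 mulr1.
move=> /(_ orth)/eqP; apply/negP; rewrite mulf_eq0 invr_eq0 negb_or.
by rewrite !gt_eqF // sqrtr_gt0 // mulr_gt0.
Qed.

Definition cone_of_fib p := cone_chart (inv2 c v p).
Definition fib_of_cone Q := phi2 c sg v (cone_chart_inv Q).

Lemma cone_of_vertex : cone_of_fib vertex = 0.
Proof.
have [x0 r0] := (vertex_xl vertex_fib.1).2 erefl.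
(* At the vertex r = 0, and 0^-1 = 0 makes both components of [inv2] vanish. *)
rewrite /cone_of_fib /inv2 r0 x0 sqrtr0 invr0 scale0r scaler0 /cone_chart /= dot0l sqrtr0 scale0r.
have -> : crs 0 0 = 0 :> 'rV[R]_3 by rewrite -[X in crs X _](scale0r 0) crsZl scale0r.
by have := conematZ 0 0 (0 : 'rV[R]_3) 0 0; rewrite mul0r !scale0r.
Qed.

Lemma fib_of_cone0 : fib_of_cone 0 = vertex.
Proof.
rewrite /fib_of_cone /cone_chart_inv mxtrace0 invr0 scale0r.
have -> : cone_b 0 = 0 :> 'rV[R]_3 by rewrite -(scale0r 0) cone_bZ scale0r.
by rewrite /phi2 /= scaler0.
Qed.

Lemma fib_rad2 p : N p -> (p != vertex) = (0 < rad2 p.2).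
Proof.
move=> Np; have [[_ _ _ _ r2] _] := Cmat_elim vv Np.
have r0 : 0 <= rad2 p.2 by rewrite r2 dot_ge0.
apply/idP/idP => [pv|]; last by apply: contraTneq => ->; rewrite vertex_fib.2 ltxx.
by rewrite lt_def r0 andbT; apply: contra pv => /eqP/(vertex_unique Np)->.
Qed.

Lemma fib_punctured_diffeo :
  diffeo (N `&` [set p | 0 < rad2 p.2]) (@coneRP3 R `\ 0) cone_of_fib fib_of_cone.
Proof.
have D := fib_diffeo2 c0 sg vv; rewrite (outer_eq cV) in D.
apply: diffeo_comp D (@cone_diffeo R); [exact: findim_amb|exact: findim_TS|exact: findim_mx].
Qed.

(** The trace bounds the norm on the cone, and here it is a continuous function that vanishes at the
    vertex. *)
Lemma tr_cone_of_fib p : N p -> \tr (cone_of_fib p) = Num.sqrt (gfun c p * dot (xl p.1) (xl p.1)).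
Proof.
move=> Np; have [[g0 _ _ _ _] _] := Cmat_elim vv Np.
have [trE _ _ _] := conemat_inv (Num.sqrt (dot (inv2 c v p).2 (inv2 c v p).2))
  (Num.sqrt (dot (inv2 c v p).2 (inv2 c v p).2) *: (inv2 c v p).1) (inv2 c v p).2 (crs (inv2 c v p).1 (inv2 c v p).2).
rewrite /cone_of_fib /cone_chart trE /= dotZl dotZr mulrA -expr2 sqr_sqrtr //.
exact: ltW.
Qed.

(** The squares in a row of a symmetric projection sum to its diagonal entry, which is at most the
    trace 1. *)
Lemma coneRP3_norm Q : @coneRP3 R Q -> (forall i j, `|Q i j| <= \tr Q) /\ `|Q| <= \tr Q.
Proof.
move=> [t [P [t0 [PT PP tr1] ->]]].
have H i j : `|(t *: P) i j| <= t.
  rewrite mxE normrM ger0_norm // ler_piMr //.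
  have d k : 0 <= P k k.
    rewrite -PP mxE sumr_ge0 // => l _.
    by have -> : P l k = P k l; [rewrite -{1}PT mxE|rewrite -expr2 sqr_ge0].
  have le1 : P i i <= 1.
    by rewrite -tr1 /mxtrace (bigD1 i) //= lerDl sumr_ge0.
  rewrite -(@ler_pXn2r _ 2) ?nnegrE // expr1n real_normK ?num_real //; apply: le_trans le1.
  apply: (@le_trans _ _ ((P *m P) i i)); last by rewrite PP.
  rewrite mxE (bigD1 j) //=.
  have -> : P j i = P i j by rewrite -{1}PT mxE.
  rewrite expr2 lerDl sumr_ge0 // => l _.
  by have -> : P l i = P i l; [rewrite -{1}PT mxE|rewrite -expr2 sqr_ge0].
by rewrite linearZ /= tr1 mulr1; split=> //; exact: mx_norm_le.
Qed.

Lemma cone0 : @coneRP3 R 0.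
Proof.
have [n nn _] := normalize_any (0 : 'rV[R]_4).
by exists 0, (n^T *m n); split; [exact: lexx|exact: RP3_unit|rewrite scale0r].
Qed.

Lemma cone_of_fib_continuous : {within N, continuous cone_of_fib}.
Proof.
apply/subspace_continuousP => p Np; rewrite /from_subspace.
have [->|pv] := eqVneq p vertex.
  rewrite cone_of_vertex.
  apply: (@cvg_within_le _ _ _ _ _ (fun p => Num.sqrt (gfun c p * dot (xl p.1) (xl p.1)) : R^o)).
  - have [[Mp _] _] := vertex_fib; have fa := findim_amb R; have f5 := findim_mx R 1 5.
    have sid : smooth_at vertex (fun p => p) by exact: smooth_at_id.
    apply: (@continuous_comp _ _ R^o (fun p => gfun c p * dot (xl p.1) (xl p.1) : R^o) (@Num.sqrt R)).
      apply: smooth_at_continuous; apply: smooth_atM; first exact: smooth_at_gfun.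
      have sx : smooth_at vertex (fun p => xl p.1).
        by apply: smooth_at_xl; apply: smooth_at_fst => //; exact: findim_mx.
      exact: smooth_at_dot.
    exact: sqrt_continuous.
  - by have [-> _] := (vertex_xl vertex_fib.1).2 erefl; rewrite dot0l mulr0 sqrtr0.
  - move=> y Ny; rewrite -tr_cone_of_fib //.
    have cy : coneRP3 (cone_of_fib y).
      have [->|yv] := eqVneq y vertex; first by rewrite cone_of_vertex; exact: cone0.
      have [[h _] _ _] := fib_punctured_diffeo.
      by have [[]] := h y (conj Ny (etrans (esym (fib_rad2 Ny)) yv)).
    by have [_] := coneRP3_norm cy.
rewrite fib_rad2 // in pv.
have [[h _] _ _] := fib_diffeo2 c0 sg vv; have [+ _] := h p (conj Np pv).
rewrite (outer_eq cV) => -[_ p0].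
have [Mp _] := Np.
have s1 := smooth_at_inv2 v Mp pv.
have s2 := smooth_at_comp (findim_TS R) (findim_mx R 4 4) s1 (smooth_at_cone_chart p0).
apply: cvg_within_filter; exact: smooth_at_continuous s2.
Qed.

Lemma fib_of_cone_continuous : {within @coneRP3 R, continuous fib_of_cone}.
Proof.
have f3 := findim_mx R 1 3; have f4 := findim_mx R 4 4.
apply/subspace_continuousP => Q cQ; rewrite /from_subspace.
have [->|Q0] := eqVneq Q 0; last first.
  have hQ : (@coneRP3 R `\ 0) Q by split=> //; exact/eqP.
  have [t [P [t0 _ _ trQ]]] := cone_RP3 hQ.
  have [[_ h] _ _] := @cone_diffeo R; have [+ _] := h Q hQ; rewrite -(outer_eq cV) => oQ.
  have tn : \tr Q != 0 by rewrite trQ gt_eqF.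
  have s2 := smooth_at_comp (findim_TS R) (findim_amb R) (smooth_at_cone_chart_inv tn) (smooth_at_phi2 c0 v oQ).
  apply: cvg_within_filter; exact: smooth_at_continuous s2.
pose r (Q : 'M[R]_4) : R^o := Num.sqrt ((sg ^+ 2 + dot (cone_b Q) (cone_b Q)) ^+ 2 - c).
have sb (X : 'M[R]_4) : smooth_at X (@cone_b R) by apply: smooth_at_lin => //; exact: linear_cone_b.
have b0 : cone_b 0 = 0 :> 'rV[R]_3 by rewrite -(scale0r 0) cone_bZ scale0r.
have cr : {for 0, continuous r}.
  apply: (@continuous_comp _ _ R^o
    (fun Q : 'M[R]_4 => (sg ^+ 2 + dot (cone_b Q) (cone_b Q)) ^+ 2 - c : R^o) (@Num.sqrt R)).
    apply: smooth_at_continuous; apply: (@smooth_atB _ _ R^o); last exact: smooth_at_cst.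
    apply: smooth_atX; apply: (@smooth_atD _ _ R^o); [exact: smooth_at_cst|exact: smooth_at_dot].
  exact: sqrt_continuous.
(* The quotient of [cone_a Q] by the trace has no limit at 0, but it stays bounded on the cone while
   its factor [r Q] tends to 0. *)
have c1 : (fun Q => r Q *: ((\tr Q)^-1 *: cone_a Q)) @ within (@coneRP3 R) (nbhs (0 : 'M[R]_4)) --> (0 : 'rV[R]_3).
  apply: (@cvg_within_le _ _ _ _ _ (fun Q => 4 * r Q : R^o)).
  - by apply: (@continuousM _ _ (fun=> 4) r 0) => //; exact: cst_continuous.
  - by rewrite /r b0 dot0l addr0 -cV subrr sqrtr0 mulr0.
  - move=> X /coneRP3_norm[hX _]; have t0 : 0 <= \tr X by apply: le_trans (hX 0 0).
    apply: mx_norm_le => [|i j]; first by rewrite mulr_ge0 // sqrtr_ge0.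
    rewrite 2!mxE normrM ger0_norm ?sqrtr_ge0 // mulrC ler_wpM2r ?sqrtr_ge0 // normrM normfV (ger0_norm t0).
    have [->|tn] := eqVneq (\tr X) 0; first by rewrite invr0 mul0r.
    rewrite ler_pdivrMl ?lt_def ?tn //.
    have := hX 0 0; have := hX 1 1; have := hX 2%:R 2%:R; have := hX 3%:R 3%:R.
    have := hX 1 2%:R; have := hX 0 3%:R; have := hX 1 3%:R; have := hX 0 2%:R.
    rewrite !ler_norml (ord1 i) => /andP[? ?] /andP[? ?] /andP[? ?] /andP[? ?] /andP[? ?] /andP[? ?] /andP[? ?] /andP[? ?].
    by have [->|->|->] := row3E j; rewrite mxE /=; lra.
have c2 : @cone_b R @ within (@coneRP3 R) (nbhs (0 : 'M[R]_4)) --> (0 : 'rV[R]_3).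
  by apply: cvg_within_filter; rewrite -b0; exact: (smooth_at_continuous (sb 0)).
have ch : {for (0, 0), continuous (hor2 sg v)}.
  apply: smooth_at_continuous.
  have -> : hor2 sg v = (fun z => hor2 sg v (z.1, z.2)) by apply/funext => -[].
  have sid : smooth_at ((0, 0) : 'rV[R]_3 * 'rV[R]_3) (fun z => z) by apply: smooth_at_id; exact: findim_TS.
  apply: smooth_at_hor2; [by rewrite /= dot0l addr0|exact: smooth_at_fst|exact: smooth_at_snd].
rewrite fib_of_cone0.
exact: cvg_comp _ _ (cvg_pair c1 c2) ch.
Qed.

Lemma fib_iso_cone : iso_coneRP3 N.
Proof.
have D := fib_punctured_diffeo; have [[h1 h2] _ _] := D.
exists cone_of_fib, fib_of_cone; split.
- split=> [p Np|Q cQ].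
    have [->|pv] := eqVneq p vertex.
      by rewrite cone_of_vertex fib_of_cone0; split=> //; exact: cone0.
    by have [[]] := h1 p (conj Np (etrans (esym (fib_rad2 Np)) pv)).
  have [->|Q0] := eqVneq Q 0.
    by rewrite fib_of_cone0 cone_of_vertex; split=> //; case: vertex_fib.
  by have [|[]] := h2 Q; first by split=> //; exact/eqP.
- exact: cone_of_fib_continuous.
- exact: fib_of_cone_continuous.
- rewrite fib_of_cone0.
  have -> : N `\ vertex = N `&` [set p | 0 < rad2 p.2]; last exact: D.
  by apply/seteqP; split=> p [Np /= pv]; split=> //=; move: pv; rewrite -fib_rad2 // => /eqP.
Qed.

Lemma vertex_closure : closure (N `&` [set p | 0 < rad2 p.2]) vertex.
Proof.
have [q qq _] := normalize_any (0 : 'rV[R]_3); have [e ee qe] := orth_exists qq.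
rewrite -(vcurve0 q e); apply: closure_path.
  by apply: smooth_at_continuous; exact: smooth_vcurve.
move=> t t0; have [Nt rt] := vcurve_fib qq ee qe t; split=> //=.
by rewrite rt mulr_gt0 ?exprn_gt0 // ltr_wpDr ?sqr_ge0 // mulr_gt0.
Qed.

End Vertex.

(** * Smooth dependence of the cubic root *)

Section Root.
Variable R : realType.
Implicit Types (c s V g : R) (E : normedModType R).

(** For s != 0 the cubic is negative at the maximum of V and sqrt c, unless this is 0, and
    nonnegative far out. For s = 0 the root is sqrt c, which exceeds V by the hypothesis. *)
Lemma root_exists c s V : 0 <= c -> 0 <= V -> s != 0 \/ V ^+ 2 < c -> exists g, root_cond c s V g.
Proof.
move=> c0 V0 H.
have q0 : 0 <= Num.sqrt c by exact: sqrtr_ge0.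
have q2 : Num.sqrt c ^+ 2 = c by rewrite sqr_sqrtr.
have [s0|s0] := eqVneq s 0.
  case: H => [|Vc]; first by rewrite s0 eqxx.
  have cp : 0 < c by apply: le_lt_trans Vc; exact: sqr_ge0.
  exists (Num.sqrt c); split; rewrite ?sqrtr_gt0 // ?q2 ?lexx //.
    by rewrite -(@ltr_pXn2r _ 2) ?nnegrE // q2.
  by rewrite s0 expr0n mul0r subrr mul0r.
have K0 : 0 < s ^+ 2 by rewrite lt_def sqr_ge0 sqrf_eq0 s0.
set lo := Num.max V (Num.sqrt c).
have Vlo : V <= lo by rewrite le_max lexx.
have qlo : Num.sqrt c <= lo by rewrite le_max lexx orbT.
have [lo0|lo0] := eqVneq lo 0.
  have Ve : V = 0 by apply/eqP; rewrite eq_le V0 -lo0 Vlo.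
  have ce : c = 0.
    by rewrite -q2 (_ : Num.sqrt c = 0) ?expr0n //; apply/eqP; rewrite eq_le q0 -lo0 qlo.
  exists `|s|; rewrite Ve ce; split; rewrite ?normr_gt0 // ?sqr_ge0 //.
  by rewrite !subr0 real_normK // num_real.
have lop : 0 < lo by rewrite lt_def lo0; exact: le_trans Vlo.
pose p : {poly R} := ('X ^+ 2 - c%:P) * ('X - V%:P) - (s ^+ 2)%:P * 'X.
have pE x : p.[x] = (x ^+ 2 - c) * (x - V) - s ^+ 2 * x by rewrite /p !hornerE.
(* Large enough for both hi^2 - c >= hi and hi - V >= s^2. *)
set hi := V + Num.sqrt c + s ^+ 2 + 1.
have lohi : lo <= hi.
  by rewrite /hi /lo ge_max; apply/andP; split; lra.
have plo : p.[lo] < 0.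
  rewrite pE.
  have -> : (lo ^+ 2 - c) * (lo - V) = 0.
    rewrite /lo; case: (leP V (Num.sqrt c)) => _; first by rewrite q2 subrr mul0r.
    by rewrite subrr mulr0.
  by rewrite sub0r oppr_lt0 mulr_gt0.
have phi : 0 <= p.[hi].
  rewrite pE subr_ge0.
  have h1 : hi <= hi ^+ 2 - c.
    have -> : hi ^+ 2 - c = (hi - Num.sqrt c) * (hi + Num.sqrt c) by rewrite -{1}q2; ring.
    have a1 : 1 <= hi - Num.sqrt c by rewrite /hi; lra.
    have hp : 0 <= hi by rewrite /hi; lra.
    rewrite -[X in X <= _]mul1r; apply: ler_pM => //; lra.
  have h2 : s ^+ 2 <= hi - V by rewrite /hi; lra.
  rewrite mulrC; apply: ler_pM => //; first by rewrite /hi; lra.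
  exact: ltW.
have [|g /andP[g1 g2] /rootP] := @poly_ivt _ p lo hi lohi; first by rewrite (ltW plo).
rewrite pE => /eqP; rewrite subr_eq0 => /eqP E.
have lg : lo < g.
  rewrite lt_def g1 andbT; apply/eqP => e.
  by move: plo; rewrite pE -e E subrr ltxx.
exists g; split=> //.
- exact: lt_trans lg.
- exact: le_lt_trans lg.
- by rewrite -q2 ler_pXn2r ?nnegrE // ?(le_trans qlo) // ltW // (lt_trans lop).
Qed.

Definition rootf c s V : R := xget 0 [set g | root_cond c s V g].

Lemma rootfP c s V : 0 <= c -> 0 <= V -> s != 0 -> root_cond c s V (rootf c s V).
Proof.
move=> c0 V0 s0; have h := root_exists c0 V0 (or_introl s0).
exact: (@xgetPex _ 0 [set g | root_cond c s V g] h).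
Qed.

(** The divided difference of the cubic with parameters (s, V) between [g] and [h]; for g = h it is
    the derivative. *)
Definition root_slope c s V g h : R := h ^+ 2 + h * g + g ^+ 2 - V * (h + g) - (c + s ^+ 2).

(* The difference of the cubic equations of two roots, divided by [g' - g]. *)
Lemma root_diff c s V g s' V' g' : 0 <= c -> 0 <= V' -> root_cond c s V g -> root_cond c s' V' g' ->
  (V' - V) * (g ^+ 2 - c) + (s' ^+ 2 - s ^+ 2) * g = (g' - g) * root_slope c s' V' g g' /\
  g ^+ 2 - c <= root_slope c s' V' g g'.
Proof.
move=> c0 V0 [g0 Vg cg E] [g0' Vg' cg' E']; split.
  apply/eqP; rewrite -subr_eq0; apply/eqP.
  transitivity (((g ^+ 2 - c) * (g - V) - s ^+ 2 * g) - ((g' ^+ 2 - c) * (g' - V') - s' ^+ 2 * g')).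
    by rewrite /root_slope; ring.
  by rewrite E E' !subrr.
have gn : g' != 0 by rewrite gt_eqF.
(* Eliminating s'^2 by the equation of g' leaves terms of known sign. The resulting bound does not
   involve g', so the slope stays away from 0. *)
have Ks : s' ^+ 2 = (g' ^+ 2 - c) * (g' - V') / g' by rewrite E' mulfK.
have -> : root_slope c s' V' g g' = g * (g' - V') + g ^+ 2 - c * (V' / g').
  by rewrite /root_slope Ks; field.
have h1 : 0 <= g * (g' - V') by rewrite mulr_ge0 ?(ltW g0) // subr_ge0 ltW.
have h2 : c * (V' / g') <= c.
  by rewrite ler_piMr // ler_pdivrMr // mul1r ltW.
lra.
Qed.

Lemma root_sq c s V g : root_cond c s V g -> s != 0 -> c < g ^+ 2.
Proof.
move=> [g0 Vg cg E] s0; rewrite lt_def cg andbT -subr_eq0.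
apply: contra_neq s0 => h; apply/eqP; rewrite -sqrf_eq0; apply/eqP.
by apply: (mulIf (lt0r_neq0 g0)); rewrite -E h !mul0r.
Qed.

Section SmoothRoot.
Variables (E : normedModType R) (W : set E) (c : R) (s V : E -> R^o).
Hypotheses (c0 : 0 <= c) (oW : open W) (ss : smooth_open W s) (sV : smooth_open W V).
Hypotheses (s0 : forall x, W x -> s x != 0) (V0 : forall x, W x -> 0 <= V x).

Let G x : R^o := rootf c (s x) (V x).
Let GP x : W x -> root_cond c (s x) (V x) (G x).
Proof. by move=> Wx; apply: rootfP; [exact: c0|exact: V0|exact: s0]. Qed.

Let num x y : R^o := (V y - V x) * (G x ^+ 2 - c) + (s y ^+ 2 - s x ^+ 2) * G x.
Let den x y : R^o := root_slope c (s y) (V y) (G x) (G y).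

Let num_smooth x : smooth_open W (num x).
Proof.
apply: (@smoothD _ _ R^o) => //; apply: smoothM => //; try exact: smooth_cst.
  by apply: (@smoothB _ _ R^o) => //; exact: smooth_cst.
by apply: (@smoothB _ _ R^o) => //; [exact: smoothX|exact: smooth_cst].
Qed.

Let num0 x : num x x = 0. Proof. by rewrite /num !subrr !mul0r addr0. Qed.

Let den_gt0 x y : W x -> W y -> 0 < G x ^+ 2 - c /\ G x ^+ 2 - c <= den x y.
Proof.
move=> Wx Wy; split; first by rewrite subr_gt0; apply: root_sq (GP Wx) (s0 Wx).
by have [] := root_diff c0 (V0 Wy) (GP Wx) (GP Wy).
Qed.

(** The increment of the root is explicit, with a denominator bounded below by G x^2 - c. This gives
    continuity, and then the derivative by [is_derive_scale0], as [num x] vanishes at x. *)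
Let GE x y : W x -> W y -> G y = num x y * (den x y)^-1 + G x.
Proof.
move=> Wx Wy; have [d1 d2] := den_gt0 Wx Wy.
have [e _] := root_diff c0 (V0 Wy) (GP Wx) (GP Wy).
rewrite /num e mulfK ?subrK //; rewrite gt_eqF //; exact: lt_le_trans d2.
Qed.

Let G_cont x : W x -> {for x, continuous G}.
Proof.
move=> Wx; rewrite /continuous_at /prop_for.
have [d1 _] := den_gt0 Wx Wx.
have cn : {for x, continuous (fun y => `|num x y| * (G x ^+ 2 - c)^-1 : R^o)}.
  apply: (@continuousM _ _ (fun y => `|num x y|) (fun=> (G x ^+ 2 - c)^-1) x); last exact: cst_continuous.
  apply: (@continuous_comp _ _ R^o (num x) (fun t : R^o => `|t|)); last exact: norm_continuous.
  exact: smooth_continuous (num_smooth x) Wx.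
have := @cvg_within_le R E R^o W (fun y => G y - G x) _ x cn.
rewrite num0 normr0 mul0r => /(_ erefl) H.
have {}H : (fun y => G y - G x) @ within W (nbhs x) --> (0 : R^o).
  apply: H => y Wy; have [_ d2] := den_gt0 Wx Wy.
  rewrite (GE Wx Wy) addrK normrM ler_wpM2l // gtr0_norm ?invr_gt0 ?(lt_le_trans d1 d2) //.
  by rewrite lef_pV2 // posrE ?(lt_le_trans d1 d2).
have Wn : nbhs x W by exact: open_nbhs_nbhs.
rewrite (within_interior (A := W) Wn) in H.
have FF : Filter (nbhs x) by exact: nbhs_filter.
have := @cvgD _ _ _ _ FF _ _ _ _ H (@cvg_cst _ (G x : R^o) _ _ FF); rewrite add0r.
by apply: cvg_trans; apply: near_eq_cvg; near=> y; rewrite /= fctE subrK.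
Unshelve. all: by end_near. Qed.

Let dG v x : R^o := ('D_v V x * (G x * G x + - c) + (2 * s x * 'D_v s x) * G x) *
   (3 * G x * G x + (- 2) * V x * G x + - (c + s x * s x))^-1.

Let G_derive x v : W x -> is_derive x v G (dG v x).
Proof.
move=> Wx; have [d1 d2] := den_gt0 Wx Wx.
have cB : {for x, continuous (fun y => (den x y)^-1 : R^o)}.
  have cG := G_cont Wx; have cV := smooth_continuous sV Wx; have cs := smooth_continuous ss Wx.
  apply: (@continuousV R E (den x) x); first by rewrite gt_eqF //; exact: lt_le_trans d2.
  have ck (a : R) : {for x, continuous (fun=> a : R^o)} by exact: cst_continuous.
  have cM (f h : E -> R^o) : {for x, continuous f} -> {for x, continuous h} ->
    {for x, continuous (fun y => f y * h y : R^o)} by move=> a b; exact: (@continuousM _ _ f h x a b).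
  have cD (f h : E -> R^o) : {for x, continuous f} -> {for x, continuous h} ->
    {for x, continuous (fun y => f y + h y : R^o)} by move=> a b; exact: (@continuousD _ _ _ f h x a b).
  have cN (f : E -> R^o) : {for x, continuous f} ->
    {for x, continuous (fun y => - f y : R^o)} by move=> a; exact: (@continuousN _ _ _ f x a).
  apply: (cD); [apply: (cD); [apply: (cD); [apply: (cD)|]|]|].
  - exact: cM.
  - exact: cM.
  - exact: ck.
  - by apply: (cN); apply: cM => //; exact: cD.
  - by apply: (cN); apply: (cD) => //; exact: cM.
have dV := smooth_is_derive v sV Wx; have ds := smooth_is_derive v ss Wx.
have dn : is_derive x v (num x) ('D_v V x * (G x ^+ 2 - c) + (2 * s x * 'D_v s x) * G x).
  have h1 := is_derive_scale (is_derive_add dV (is_derive_cst (- V x : R^o) x v)) (is_derive_cst (G x ^+ 2 - c : R^o) x v).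
  have h2 := is_derive_scale (is_derive_add (is_derive_scale ds ds) (is_derive_cst (- (s x ^+ 2) : R^o) x v)) (is_derive_cst (G x : R^o) x v).
  have := is_derive_add h1 h2; set e := (X in is_derive _ _ _ X) => h.
  have -> : 'D_v V x * (G x ^+ 2 - c) + (2 * s x * 'D_v s x) * G x = e.
    rewrite /e /GRing.scale /=; ring.
  exact: h.
have h := is_derive_add (is_derive_scale0 (num0 x) dn cB) (is_derive_cst (G x : R^o) x v).
have -> : dG v x = ('D_v V x * (G x ^+ 2 - c) + (2 * s x * 'D_v s x) * G x) *: (den x x)^-1 + 0.
  rewrite addr0 /dG /GRing.scale /= expr2; congr (_ * _^-1).
  by rewrite /den /root_slope; ring.
by apply: (near_is_derive oW Wx _ h) => y Wy; rewrite (GE Wx Wy).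
Qed.

(** Bootstrapping: the derivative is a rational expression in the root, the parameters and their
    derivatives, hence as smooth as the root is already known to be. *)
Lemma smooth_rootf : smooth_open W (fun x => rootf c (s x) (V x) : R^o).
Proof.
move=> k; elim: k => [|k IH]; first by split=> // x; exact: G_cont.
apply: (@ck_step _ _ _ _ _ _ dG) => //; try by move=> x v; exact: G_derive.
move=> v.
have kM (f h : E -> R^o) : ck k W f -> ck k W h -> ck k W (fun y => f y * h y : R^o).
  by move=> a b; exact: ckZ.
have kD (f h : E -> R^o) : ck k W f -> ck k W h -> ck k W (fun y => f y + h y : R^o).
  by move=> a b; exact: ckD.
have kc (a : R) : ck k W (fun=> a : R^o) by exact: ck_cst.
have kG : ck k W G by exact: IH.
have kV := sV k; have ks := ss k.
have kdV := ck_derive v (sV k.+1); have kds := ck_derive v (ss k.+1).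
have kss : ck k W (fun y => - (c + s y * s y) : R^o).
  have -> : (fun y => - (c + s y * s y) : R^o) = (fun y => - c + (-1) * (s y * s y) : R^o).
    by apply/funext => y; ring.
  by apply: (kD (fun=> - c)) => //; apply: (kM (fun=> -1)) => //; exact: kM.
apply: (kM).
  apply: (kD); first by apply: (kM) => //; apply: (kD) => //; exact: kM.
  by apply: (kM) => //; apply: (kM) => //; exact: (kM (fun=> 2)).
apply: ckV => //.
  move=> x Wx; have [d1 d2] := den_gt0 Wx Wx.
  have -> : 3 * G x * G x + - 2 * V x * G x + - (c + s x * s x) = den x x.
    by rewrite /den /root_slope; ring.
  by rewrite gt_eqF //; exact: lt_le_trans d2.
apply: (kD (fun y => 3 * G y * G y + - 2 * V y * G y)) => //.
apply: (kD (fun y => 3 * G y * G y)); first by apply: (kM) => //; exact: (kM (fun=> 3)).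
by apply: (kM) => //; exact: (kM (fun=> - 2)).
Qed.

End SmoothRoot.
End Root.

(** * The fibration *)

Section Total.
Variable R : realType.
Implicit Types (b : 'rV[R]_3) (p : amb R).

Definition hs b : R := (@lsubmx R 1 1 2 b) 0 0.
Definition hy b : 'rV[R]_2 := @rsubmx R 1 1 2 b.

Lemma hs_base s (y : 'rV[R]_2) : hs (base s y) = s.
Proof. by rewrite /hs /base (@row_mxKl R 1 1 2) mxE eqxx mulr1n. Qed.

Lemma hy_base s (y : 'rV[R]_2) : hy (base s y) = y.
Proof. by rewrite /hy /base (@row_mxKr R 1 1 2). Qed.

Lemma base_eta b : base (hs b) (hy b) = b.
Proof. by rewrite /base -[in RHS](@hsubmxK R 1 1 2 b) /hs -mx11_scalar. Qed.

Lemma bspiE c p : bspi c p = base (height p.2) (Num.sqrt (gfun c p) *: xr p.1).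
Proof. by []. Qed.

Lemma baseP b : exists2 v, dot v v = 1 &
  hy b = Num.sqrt (dot (hy b) (hy b)) *: v /\ b = base (hs b) (Num.sqrt (dot (hy b) (hy b)) *: v).
Proof.
by have [v vv vE] := normalize_any (hy b); exists v => //; split=> //; rewrite -vE base_eta.
Qed.

Lemma sq_sqrt_dot n (y : 'rV[R]_n) : Num.sqrt (dot y y) ^+ 2 = dot y y.
Proof. by rewrite sqr_sqrtr ?dot_ge0. Qed.

Lemma rad2_ge0 (A : 'M[R]_5) : 0 <= rad2 A.
Proof.
rewrite divr_ge0 // mxtrace_mul_tr sumr_ge0 // => i _.
by rewrite sumr_ge0 // => j _; rewrite -expr2 sqr_ge0.
Qed.

Lemma rad2_eq0 (A : 'M[R]_5) : (rad2 A == 0) = (A == 0).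
Proof.
apply/idP/eqP => [|->]; last by rewrite /rad2 mul0mx mxtrace0 mul0r.
rewrite mulf_eq0 invr_eq0 pnatr_eq0 orbF mxtrace_mul_tr psumr_eq0 => [/allP h|i _]; last first.
  by apply: sumr_ge0 => j _; rewrite -expr2 sqr_ge0.
apply/matrixP => k l; rewrite [RHS]mxE; have := h k; rewrite mem_index_enum => /(_ isT).
rewrite psumr_eq0 => [/allP h2|j _]; last by rewrite -expr2 sqr_ge0.
by have := h2 l; rewrite mem_index_enum -expr2 sqrf_eq0 => /(_ isT)/eqP.
Qed.

Lemma TstarS2_ex : exists z, @TstarS2 R z.
Proof.
have [q qq _] := normalize_any (0 : 'rV[R]_3).
by exists (q, 0); apply/TstarS2E; rewrite dotC dot0l.
Qed.

(** For c > 0 this is the image of the points with x' = 0 and A = 0, a circle. For c = 0 such points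
    are missing from [Mc c], and the set is the origin. *)
Definition vertex_base c b := hs b = 0 /\ dot (hy b) (hy b) ^+ 2 = c.

(** * Fibres, density and local triviality for fixed c *)

Section Fibration.
Variable c : R.
Hypothesis c0 : 0 <= c.

(** The first parametrization covers s != 0 and also s = 0 with V^2 < c, the second s = 0 with V^2 >
    c; equality is the excluded case. *)
Lemma fib_smooth b : ~ vertex_base c b -> diffeomorphic (fib c b) (@TstarS2 R).
Proof.
move=> nv; have [v vv [_ bE]] := baseP b; set sg := Num.sqrt _ in bE.
have sg2 : sg ^+ 2 = dot (hy b) (hy b) by rewrite sq_sqrt_dot.
have V0 : 0 <= sg ^+ 2 by rewrite sqr_ge0.
have [s0|s0] := eqVneq (hs b) 0; last first.
  have [g0 rc] := root_exists c0 V0 (or_introl s0).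
  by rewrite bE; exists (inv1 c g0 sg v), (phi1 c g0 (hs b) sg v); exact: fib_diffeo1.
have [Vc|cV|Ve] := ltgtP ((sg ^+ 2) ^+ 2) c.
- have [|g0 rc] := @root_exists R c (hs b) (sg ^+ 2) c0 V0; first by right.
  by rewrite bE; exists (inv1 c g0 sg v), (phi1 c g0 (hs b) sg v); exact: fib_diffeo1.
- rewrite bE s0; exists (inv2 c v), (phi2 c sg v).
  by have := fib_diffeo2 c0 sg vv; have [-> ->] := fib_outside vv cV.
- by case: nv; split=> //; rewrite -sg2.
Qed.

Lemma fib_submanifold b : ~ vertex_base c b -> submanifold 4 (fib c b).
Proof.
move=> /fib_smooth[f [g D]].
exact: submanifold_diffeo (findim_amb R) (findim_TS R) D (@TstarS2_submanifold R).
Qed.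

Lemma vertex_baseP b : vertex_base c b -> exists sg v,
  [/\ dot v v = 1, c = (sg ^+ 2) ^+ 2 & b = base 0 (sg *: v)].
Proof.
move=> [s0 Ve]; have [v vv [_ bE]] := baseP b; exists (Num.sqrt (dot (hy b) (hy b))), v.
by rewrite sq_sqrt_dot Ve; split=> //; rewrite {1}bE s0.
Qed.

Lemma open_rad2 : open [set p : amb R | 0 < rad2 p.2].
Proof.
rewrite -[X in open X]setTI; apply: (open_pos (f := fun p : amb R => rad2 p.2 : R^o)); first exact: openT.
apply: smooth_at_local => p _; apply: smooth_at_rad2.
by apply: smooth_at_snd; [exact: findim_mx|exact: findim_mx|exact: smooth_at_id (findim_amb R)].
Qed.

Lemma fib_punctured_submanifold b : vertex_base c b -> submanifold 4 (fib c b `&` [set p | 0 < rad2 p.2]).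
Proof.
move=> /vertex_baseP[sg [v [vv cV ->]]].
have D := fib_diffeo2 c0 sg vv; rewrite (outer_eq cV) in D.
apply: submanifold_diffeo (findim_amb R) (findim_TS R) D _.
apply: submanifold_open; [exact: findim_TS| |exact: TstarS2_submanifold].
have -> : [set z : 'rV[R]_3 * 'rV[R]_3 | z.2 != 0] = setT `&` [set z | 0 < dot z.2 z.2].
  by apply/seteqP; split=> z /=; rewrite dot_gt0 => // -[].
apply: (open_pos (f := fun z : 'rV[R]_3 * 'rV[R]_3 => dot z.2 z.2 : R^o)); first exact: openT.
have f3 := findim_mx R 1 3.
apply: smooth_at_local => z _; apply: smooth_at_dot; apply: smooth_at_snd => //;
  exact: smooth_at_id (findim_TS R).
Qed.

Lemma fib_vertex b : 0 < c -> vertex_base c b -> exists2 x, fib c b x &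
  [/\ forall p, fib c b p -> (xl p.1 = 0 /\ rad2 p.2 = 0) <-> p = x,
      ~ smooth_points 4 (fib c b) x, closure (fib c b `&` [set p | 0 < rad2 p.2]) x &
      iso_coneRP3 (fib c b)].
Proof.
move=> cp /vertex_baseP[sg [v [vv cV ->]]].
exists (vertex sg v); first by case: (vertex_fib cp cV vv).
split; first by move=> p; exact: vertex_xl.
- exact: vertex_singular.
- exact: vertex_closure.
- exact: fib_iso_cone.
Qed.

Lemma fib_vertex_rad2 b p : fib c b p -> vertex_base c b -> 0 < rad2 p.2 \/
  [/\ 0 < c, xl p.1 = 0 & rad2 p.2 = 0].
Proof.
move=> Fp vb; have [[_ r0] _] := Fp.
have := rad2_ge0 p.2; rewrite le_eqVlt => /orP[/eqP r00|->]; last by left.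
rewrite -r00 addr0 in r0; right; split=> //.
have [sg [v [vv cV bE]]] := vertex_baseP vb.
rewrite bE in Fp.
by have [+ _] := (vertex_xl r0 cV vv Fp).2 (vertex_unique r0 cV vv Fp (esym r00)).
Qed.

Lemma degenerate_base b p : fib c b p -> xl p.1 = 0 -> rad2 p.2 = 0 -> vertex_base c b.
Proof.
move=> [[Mp r0] /= bE] x0 r00.
have A0 : p.2 = 0 by apply/eqP; rewrite -rad2_eq0 r00.
rewrite -bE bspiE; split; first by rewrite hs_base A0 /height mxE.
have xx : dot (xr p.1) (xr p.1) = 1.
  have : dot p.1 p.1 = 1 by rewrite /dot (M_unit Mp) mxE.
  by rewrite dot5 x0 dot0l add0r.
rewrite hy_base dotZl dotZr xx mulr1 -expr2 /gfun r00 addr0.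
by rewrite !sqr_sqrtr ?sqrtr_ge0.
Qed.

Lemma fib_coassociative b (phi : amb R -> ('I_3 -> amb R) -> R) : bryant_salamon c (Mc c) phi ->
  coassociative (Mc c) phi (fib c b).
Proof.
move=> bs; split; first by move=> p [].
- have [vb|nv] := pselect (vertex_base c b); last first.
    move=> p Np; apply: subset_closure; split=> //; exists setT; split=> //; first exact: openT.
    by rewrite setIT; exact: fib_submanifold.
  have sub : fib c b `&` [set p | 0 < rad2 p.2] `<=` smooth_points 4 (fib c b).
    move=> p [Np rp]; split=> //; exists [set p | 0 < rad2 p.2]; split=> //; first exact: open_rad2.
    exact: fib_punctured_submanifold.
  move=> p Np; have [rp|[cp x0 r0]] := fib_vertex_rad2 Np vb.
    by apply: subset_closure; exact: sub.
  apply: closure_subset sub _ _; have [x Nx [xE _ cx _]] := fib_vertex cp vb.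
  by have -> : p = x by apply/(xE p Np).
(* A point with x' = 0 and A = 0 would be the vertex, which is not a smooth point. *)
- move=> p [Np sp]; apply: coassoc_point => // -[x0 r0].
  have vb := degenerate_base Np x0 r0.
  have [[_ cr] _] := Np; rewrite r0 addr0 in cr.
  have [x Nx [xE ns _ _]] := fib_vertex cr vb.
  by apply: ns; have <- : p = x by apply/(xE p Np).
Qed.

Lemma fib_nonempty b : exists p, fib c b p.
Proof.
have [vb|nv] := pselect (vertex_base c b); last first.
  have [f [g [[_ h] _ _]]] := fib_smooth nv; have [z Tz] := TstarS2_ex.
  by exists (g z); case: (h z Tz).
have [cp|] := ltP 0 c; first by have [x Nx _] := fib_vertex cp vb; exists x.
(* For c = 0 the fibre is the cone without its vertex, and any orthonormal pair gives a point of
   it. *)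
move=> cle; have ce : c = 0 by apply/eqP; rewrite eq_le cle.
have [sg [v [vv cV ->]]] := vertex_baseP vb.
have [[_ h] _ _] := fib_diffeo2 c0 sg vv.
have [q qq _] := normalize_any (0 : 'rV[R]_3); have [e ee qe] := orth_exists qq.
have oz : outer c sg (q, e).
  rewrite (outer_eq cV); split; first exact/TstarS2E.
  by rewrite /= -dot_gt0 ee.
by have [[]] := h _ oz; exists (phi2 c sg v (q, e)).
Qed.

Lemma smooth_at_base (E : normedModType R) (x : E) (s : E -> R^o) (y : E -> 'rV[R]_2) :
  smooth_at x s -> smooth_at x y -> smooth_at x (fun t => base (s t) (y t)).
Proof.
move=> hs' hy'.
have bD (a a' : R) (u u' : 'rV[R]_2) : base a u + base a' u' = base (a + a') (u + u').
  have e : (a + a')%:M = a%:M + a'%:M :> 'M[R]_1 by rewrite raddfD.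
  by rewrite /base e; exact: (add_row_mx a%:M u a'%:M u').
have bZ (k a : R) (u : 'rV[R]_2) : k *: base a u = base (k * a) (k *: u).
  rewrite /base -scale_scalar_mx; exact: (scale_row_mx k a%:M u).
have -> : (fun t => base (s t) (y t)) = (fun t => base (s t) 0 + base 0 (y t)).
  by apply/funext => t; rewrite bD addr0 add0r.
apply: smooth_atD.
  apply: (smooth_at_comp_lin (F := R^o) (f := fun a : R^o => base a 0)) => //; first exact: findim_R.
  by move=> k a a'; rewrite bZ bD scaler0 addr0.
apply: (smooth_at_comp_lin (f := fun u : 'rV[R]_2 => base 0 u)) => //; first exact: findim_mx.
by move=> k a a'; rewrite bZ bD mulr0 addr0.
Qed.

Lemma smooth_at_bspi p : Mc c p -> smooth_at p (bspi c).
Proof.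
move=> Mp; have f5 := findim_mx R 1 5; have f55 := findim_mx R 5 5.
have sid : smooth_at p (fun p => p) by exact: smooth_at_id (findim_amb R).
apply: smooth_at_base; first by apply: smooth_at_entry; exact: smooth_at_snd.
apply: smooth_atZ; last by apply: smooth_at_xr; exact: smooth_at_fst.
by apply: smooth_at_sqrt; [case: (gfunP Mp)|exact: smooth_at_gfun].
Qed.

Lemma bspi_surj b : exists2 p, Mc c p & bspi c p = b.
Proof. by have [p [Mp pb]] := fib_nonempty b; exists p. Qed.

Lemma bspi_invariant : SO3_invariant (Mc c) (bspi c).
Proof.
move=> g p [gg _] _; rewrite /SO3_act.
set G : 'M[R]_5 := block_mx g 0 0 1%:M.
have GE : G = block5 g 0 0 1%:M by [].
have GG : G^T *m G = 1%:M.
  by apply: mulmx1C; apply: (@block_orth R 3 2 g 1%:M gg); rewrite trmx1 mulmx1.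
have r2 : rad2 (G *m p.2 *m G^T) = rad2 p.2.
  by rewrite /rad2 !trmx_mul trmxK -!mulmxA (mulmxA G^T) GG mul1mx mxtrace_mulC -!mulmxA GG mulmx1.
apply/bspiP; rewrite /quartic /= r2; split.
  have AE : p.2 = block5 (@ulsubmx R 3 2 3 2 p.2) (@ursubmx R 3 2 3 2 p.2)
     (@dlsubmx R 3 2 3 2 p.2) (@drsubmx R 3 2 3 2 p.2).
    exact: (esym (@submxK R 3 2 3 2 p.2)).
  rewrite {1}AE GE block5T !block5M !trmx0 trmx1 !mul0mx !mulmx0 !add0r !mul1mx !mulmx1.
  by rewrite /height [LHS]block_mxEdr !mxE.
congr (_ *: _); rewrite {1}(row5_eta p.1) GE block5T row5M xr_row5 !trmx0 trmx1 mulmx0 add0r.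
by rewrite mulmx1.
Qed.

Definition regular : set 'rV[R]_3 := [set b | hs b != 0 /\ hy b != 0].

Lemma linear_hs : linear (hs : 'rV[R]_3 -> R^o).
Proof. by move=> a x y; rewrite /hs linearP !mxE. Qed.

Lemma linear_hy : linear hy.
Proof. by move=> a x y; rewrite /hy linearP. Qed.

Lemma smooth_hs (V : set 'rV[R]_3) : smooth_open V (hs : 'rV[R]_3 -> R^o).
Proof. by apply: smooth_lin; [exact: findim_mx|exact: linear_hs]. Qed.

Lemma smooth_hy (V : set 'rV[R]_3) : smooth_open V hy.
Proof. by apply: smooth_lin; [exact: findim_mx|exact: linear_hy]. Qed.

Lemma open_regular : open regular.
Proof.
have -> : regular = (setT `&` [set b | 0 < hs b * hs b]) `&` [set b | 0 < dot (hy b) (hy b)].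
  apply/seteqP; split=> b /=.
    by move=> [s0 y0]; rewrite dot_gt0 y0 -expr2 lt_def sqr_ge0 sqrf_eq0 s0.
  by move=> [[_ s0]]; rewrite dot_gt0; split=> //; apply: contraTneq s0 => ->; rewrite mul0r ltxx.
have oT : open [set: 'rV[R]_3] := openT.
have o1 : open (setT `&` [set b : 'rV[R]_3 | 0 < hs b * hs b]).
  by apply: (open_pos (f := fun b => hs b * hs b : R^o)) => //; apply: smoothM => //; exact: smooth_hs.
apply: (open_pos (f := fun b => dot (hy b) (hy b) : R^o)) => //.
by apply: smooth_dot => //; exact: smooth_hy.
Qed.

Lemma regular_smooth b : regular b -> ~ vertex_base c b.
Proof. by move=> [/eqP s0 _] [/s0]. Qed.

(** The value at 0 is 1, so that a + t sign a is nonzero for t > 0, and its size is at least that of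
    a; the latter keeps c + r^2 positive along the path in [regular_part_dense]. *)
Let sign (a : R) : R := if 0 <= a then 1 else -1.

Let signD (a t : R) : 0 < t -> a + t * sign a != 0 /\ a ^+ 2 <= (a + t * sign a) ^+ 2.
Proof.
move=> t0; rewrite /sign; case: ifPn => [a0|]; last rewrite -ltNge => a0.
  by rewrite mulr1 gt_eqF ?ltr_wpDl // ler_pXn2r ?nnegrE ?addr_ge0 ?(ltW t0) // lerDl ltW.
rewrite mulrN1 lt_eqF; last by lra.
split=> //; rewrite -subr_ge0 (_ : _ - _ = t * (t - 2 * a)); last by ring.
by rewrite mulr_ge0 ?(ltW t0) //; lra.
Qed.

Lemma regular_dense : [set: 'rV[R]_3] `<=` closure regular.
Proof.
move=> b _; have [v vv [yE bE]] := baseP b; set sg := Num.sqrt _ in yE bE.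
have sg0 : 0 <= sg by exact: sqrtr_ge0.
pose gam (t : R^o) : 'rV[R]_3 := base (hs b + t * sign (hs b)) ((sg + t) *: v).
have g0 : gam 0 = b by rewrite /gam mul0r !addr0 -bE.
rewrite -g0; apply: closure_path => [|t t0].
  have sid : smooth_at (0 : R^o) (fun t : R^o => t) by exact: smooth_at_id (findim_R R).
  apply: smooth_at_continuous; apply: smooth_at_base.
    apply: (@smooth_atD _ _ R^o); first exact: smooth_at_cst.
    by apply: smooth_atM => //; exact: smooth_at_cst.
  apply: smooth_atZ; last exact: smooth_at_cst.
  by apply: (@smooth_atD _ _ R^o) => //; exact: smooth_at_cst.
split; rewrite ?hs_base ?hy_base; first by case: (signD (hs b) t0).
by rewrite -dot_gt0 dotZl dotZr vv mulr1 -expr2 exprn_gt0 // ltr_wpDl.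
Qed.

Definition regular_part : set (amb R) := Mc c `&` bspi c @^-1` regular.

Lemma regular_partP p : Mc c p -> regular_part p <-> height p.2 != 0 /\ xr p.1 != 0.
Proof.
move=> Mp; have [g0 _] := gfunP Mp.
rewrite /regular_part /= /regular /= bspiE hs_base hy_base scaler_eq0 negb_or [Num.sqrt _ == 0]gt_eqF ?sqrtr_gt0 //; last by case: Mp.
by split=> [[]|].
Qed.

Lemma regular_part_dense : dense_open_in (Mc c) regular_part.
Proof.
split.
  exists [set p | height p.2 != 0 /\ xr p.1 != 0].
    have -> : [set p : amb R | height p.2 != 0 /\ xr p.1 != 0] =
      (setT `&` [set p | 0 < height p.2 * height p.2]) `&` [set p | 0 < dot (xr p.1) (xr p.1)].
      apply/seteqP; split=> p /=.
        by move=> [s0 y0]; rewrite dot_gt0 y0 -expr2 lt_def sqr_ge0 sqrf_eq0 s0.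
      by move=> [[_ s0]]; rewrite dot_gt0; split=> //; apply: contraTneq s0 => ->; rewrite mul0r ltxx.
    have f5 := findim_mx R 1 5; have f55 := findim_mx R 5 5.
    have sid p : smooth_at p (fun p : amb R => p) by exact: smooth_at_id (findim_amb R).
    have oT : open [set: amb R] := openT.
    have o1 : open (setT `&` [set p : amb R | 0 < height p.2 * height p.2]).
      apply: (open_pos (f := fun p : amb R => height p.2 * height p.2 : R^o)) => //.
      apply: smooth_at_local => p _.
      by apply: smooth_atM; apply: smooth_at_entry; exact: smooth_at_snd.
    apply: (open_pos (f := fun p : amb R => dot (xr p.1) (xr p.1) : R^o)) => //.
    by apply: smooth_at_local => p _; apply: smooth_at_dot; apply: smooth_at_xr; exact: smooth_at_fst.
  apply/seteqP; split=> p; first by move=> /[dup] -[Mp _] /(regular_partP Mp).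
  by move=> [Mp] /(regular_partP Mp).
move=> p [Mp r0]; have [C [S [u [v [C0 S0 uu vv [CS xE]]]]]] := unit_decomp (M_unit Mp).
have [a [w [uw AE]]] := M_decomp Mp xE CS uu vv.
(* The height is a C and x'' is S v: increasing C, S and |a| makes both nonzero, and [n t] restores
   C^2 + S^2 = 1. *)
pose n (t : R^o) : R^o := Num.sqrt ((C + t) ^+ 2 + (S + t) ^+ 2).
pose gam (t : R^o) : amb R := (xof ((C + t) / n t) ((S + t) / n t) u v,
   Amat ((C + t) / n t) ((S + t) / n t) u v (a + t * sign a) w).
have n0 : n 0 = 1 by rewrite /n !addr0 CS sqrtr1.
have g0 : gam 0 = p.
  by rewrite /gam n0 mul0r !addr0 !divr1 -xE -AE -surjective_pairing.
rewrite -g0; apply: closure_path => [|t t0].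
  have f5 := findim_mx R 1 5; have f55 := findim_mx R 5 5.
  have sid : smooth_at (0 : R^o) (fun t : R^o => t) by exact: smooth_at_id (findim_R R).
  have sc (k : R) : smooth_at (0 : R^o) (fun t : R^o => k + t : R^o).
    by apply: (@smooth_atD _ _ R^o) => //; exact: smooth_at_cst.
  have sn : smooth_at (0 : R^o) (fun t => (n t)^-1 : R^o).
    apply: smooth_atV; first by rewrite n0 oner_eq0.
    apply: smooth_at_sqrt; first by rewrite !addr0 CS.
    by apply: (@smooth_atD _ _ R^o); exact: smooth_atX.
  have s1 : smooth_at (0 : R^o) (fun t => (C + t) / n t : R^o) by exact: smooth_atM.
  have s2 : smooth_at (0 : R^o) (fun t => (S + t) / n t : R^o) by exact: smooth_atM.
  have k1 (m : nat) (y : 'rV[R]_m) : smooth_at (0 : R^o) (fun _ : R^o => y) by exact: smooth_at_cst.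
  apply: smooth_at_continuous; apply: smooth_at_pair => //.
    exact: smooth_at_xof.
  apply: smooth_at_Amat => //; apply: (@smooth_atD _ _ R^o); first exact: smooth_at_cst.
  by apply: smooth_atM => //; exact: smooth_at_cst.
have Ct : 0 < C + t by rewrite ltr_wpDl.
have St : 0 < S + t by rewrite ltr_wpDl.
have k0 : 0 < (C + t) ^+ 2 + (S + t) ^+ 2 by rewrite addr_gt0 // exprn_gt0.
have nt : 0 < n t by rewrite sqrtr_gt0.
have CSt : ((C + t) / n t) ^+ 2 + ((S + t) / n t) ^+ 2 = 1.
  by rewrite !expr_div_n -mulrDl /n sqr_sqrtr ?(ltW k0) // mulfV // gt_eqF.
have [Mt rt] := M_Amat (a + t * sign a) CSt uu vv uw.
have [an aq] := signD a t0.
have Mct : Mc c (gam t).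
  split; first exact: Mt.
  have [_ r2] := M_Amat a CS uu vv uw.
  by rewrite /gam /= rt; apply: lt_le_trans r0 _; rewrite AE r2 lerD2l lerD2r.
apply/(regular_partP Mct); rewrite /gam /=; split.
  by rewrite Amat_height mulf_neq0 // gt_eqF // divr_gt0.
by rewrite /xof xr_row5 -dot_gt0 dotZl dotZr vv mulr1 -expr2 exprn_gt0 // divr_gt0.
Qed.

Definition sgf b : R := Num.sqrt (dot (hy b) (hy b)).
Definition vf b : 'rV[R]_2 := (sgf b)^-1 *: hy b.
Definition g0f b : R := rootf c (hs b) (sgf b ^+ 2).

Lemma regular_data b : regular b ->
  [/\ dot (vf b) (vf b) = 1, b = base (hs b) (sgf b *: vf b) & root_cond c (hs b) (sgf b ^+ 2) (g0f b)].
Proof.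
move=> [s0 y0]; have sp : 0 < sgf b by rewrite sqrtr_gt0 dot_gt0.
split.
- by rewrite dotZl dotZr -(sq_sqrt_dot (hy b)) -/(sgf b) expr2 mulKf ?mulVf // gt_eqF.
- by rewrite scalerA mulfV ?gt_eqF // scale1r base_eta.
- by apply: rootfP => //; rewrite sqr_ge0.
Qed.

Lemma smooth_regular_data b : regular b ->
  [/\ smooth_at b (sgf : 'rV[R]_3 -> R^o), smooth_at b vf & smooth_at b (g0f : 'rV[R]_3 -> R^o)].
Proof.
move=> rb; have oW := open_regular.
have sh (x : 'rV[R]_3) : smooth_at x hy by apply: smooth_at_full; exact: smooth_hy.
have ss x : regular x -> smooth_at x (sgf : 'rV[R]_3 -> R^o).
  by move=> [_ y0]; apply: smooth_at_sqrt; [rewrite dot_gt0|exact: smooth_at_dot].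
split; first exact: ss.
  apply: smooth_atZ => //; apply: smooth_atV; last exact: ss.
  by have [_ y0] := rb; rewrite gt_eqF // sqrtr_gt0 dot_gt0.
exists regular; split=> //.
apply: (@smooth_rootf R _ regular c (hs : 'rV[R]_3 -> R^o) (fun b => sgf b ^+ 2 : R^o)) => //.
- exact: smooth_hs.
- by apply: smooth_at_local => x rx; apply: smooth_atX; exact: ss.
- by move=> x [].
- by move=> x _; rewrite sqr_ge0.
Qed.

Definition fibre_to b p := inv1 c (g0f b) (sgf b) (vf b) p.
Definition fibre_of b z := phi1 c (g0f b) (hs b) (sgf b) (vf b) z.

Lemma fibre_toP b p : regular b -> fib c b p -> @TstarS2 R (fibre_to b p) /\ fibre_of b (fibre_to b p) = p.
Proof.
move=> rb Fp; have [vv bE rc] := regular_data rb; rewrite bE in Fp.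
by have [_ _] := inv1_phi c0 vv rc Fp.
Qed.

Lemma fibre_ofP b z : regular b -> @TstarS2 R z -> fib c b (fibre_of b z) /\ fibre_to b (fibre_of b z) = z.
Proof.
move=> rb Tz; have [vv bE rc] := regular_data rb.
by have := phi1_inv c0 vv rc Tz; rewrite -bE.
Qed.

Lemma smooth_fibre_to (E : normedModType R) (x : E) (be : E -> 'rV[R]_3) (f : E -> amb R) :
  regular (be x) -> fib c (be x) (f x) -> smooth_at x be -> smooth_at x f ->
  smooth_at x (fun y => fibre_to (be y) (f y)).
Proof.
move=> rb Fp sb sf; have [vv bE rc] := regular_data rb; have [s1 s2 s3] := smooth_regular_data rb.
have Fp' := Fp; rewrite [be x]bE in Fp'.
have [x0 Vg _ _] := inv1_phi c0 vv rc Fp'.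
have f3 := findim_mx R 1 3.
apply: (smooth_at_inv1 (g0 := fun y => g0f (be y)) (sg := fun y => sgf (be y)) (v := fun y => vf (be y)) c0 rc) => //.
- by case: Fp.
- exact: smooth_at_comp (findim_R R) sb s3.
- exact: smooth_at_comp (findim_R R) sb s1.
- exact: smooth_at_comp (findim_mx R 1 2) sb s2.
Qed.

Lemma smooth_fibre_of (E : normedModType R) (x : E) (be : E -> 'rV[R]_3) (z : E -> 'rV[R]_3 * 'rV[R]_3) :
  regular (be x) -> smooth_at x be -> smooth_at x z ->
  smooth_at x (fun y => fibre_of (be y) (z y)).
Proof.
move=> rb sb sz; have [vv bE rc] := regular_data rb; have [s1 s2 s3] := smooth_regular_data rb.
have f3 := findim_mx R 1 3.
have -> : (fun y => fibre_of (be y) (z y)) = (fun y => phi1 c (g0f (be y)) (hs (be y)) (sgf (be y)) (vf (be y)) ((z y).1, (z y).2)).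
  by apply/funext => y; rewrite -surjective_pairing.
apply: (smooth_at_phi1 (g0 := fun y => g0f (be y)) (s := fun y => hs (be y)) (sg := fun y => sgf (be y))
  (v := fun y => vf (be y)) c0 rc).
- exact: smooth_at_comp (findim_R R) sb s3.
- by apply: (smooth_at_comp f3 (findim_R R) sb); apply: smooth_at_full; exact: smooth_hs.
- exact: smooth_at_comp (findim_R R) sb s1.
- exact: smooth_at_comp (findim_mx R 1 2) sb s2.
- exact: smooth_at_fst.
- exact: smooth_at_snd.
Qed.

Lemma bspi_locally_trivial : locally_trivial regular_part regular (bspi c).
Proof.
move=> b rb; exists regular; first by split=> //; exact: open_regular.
(* A point is moved to the fibre over [b] by keeping its parameter in T*S^2. This works over all
   regular values at once. *)
exists (fun p => (bspi c p, fibre_of b (fibre_to (bspi c p) p))).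
exists (fun x => fibre_of x.1 (fibre_to b x.2)).
have f3 := findim_mx R 1 3; have fa := findim_amb R.
have fF : findim ('rV[R]_3 * amb R)%type by exact: findim_prod.
split=> //; split; first split.
- move=> p [[Mp rp] _]; have Fp : fib c (bspi c p) p by [].
  have [Tz pE] := fibre_toP rp Fp; have [Fb zE] := fibre_ofP rb Tz.
  split; last by rewrite /= zE.
  split=> //=; split; last by case: Fb.
  by case: Fb => Mb /= bb; split=> //=; rewrite bb.
- move=> [b' q] [[/= rb' _] [[Mq rq] /= qb]].
  have Fq : fib c b q by [].
  have [Tz qE] := fibre_toP rb Fq; have [[Mb' bb'] zE] := fibre_ofP rb' Tz.
  have bb : bspi c (fibre_of b' (fibre_to b q)) = b' by exact: bb'.
  by split; [split; [split=> //=|]; rewrite /= bb|rewrite bb zE qE].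
- apply: smooth_at_on => p [[Mp rp] _]; have Fp : fib c (bspi c p) p by [].
  apply: smooth_at_pair => //; first exact: smooth_at_bspi.
  apply: smooth_fibre_of => //; first exact: smooth_at_cst.
  by apply: smooth_fibre_to => //; [exact: smooth_at_bspi|exact: smooth_at_id].
- apply: smooth_at_on => -[b' q] [[/= rb' _] [[Mq rq] /= qb]].
  have Fq : fib c b q by [].
  have sid : smooth_at (b', q) (fun x : 'rV[R]_3 * amb R => x) by exact: smooth_at_id.
  apply: smooth_fibre_of => //; first exact: smooth_at_fst.
  by apply: smooth_fibre_to => //; [exact: smooth_at_cst|exact: smooth_at_snd].
Qed.

Lemma bspi_fibration (phi : amb R -> ('I_3 -> amb R) -> R) : bryant_salamon c (Mc c) phi ->
  coassociative_fibration (Mc c) phi setT (fib c).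
Proof.
move=> bs; split.
- exact: submanifold_open_full openT.
- by move=> b _; exact: fib_coassociative.
- by move=> p Mp; exists (bspi c p).
- exists regular; last by move=> b /regular_smooth; exact: fib_submanifold.
  by split; [exists regular; [exact: open_regular|rewrite setTI]|exact: regular_dense].
exists regular_part, regular, (bspi c); split.
- exact: regular_part_dense.
- by split=> //; exists 3%N; exact: submanifold_open_full open_regular.
- split.
  + by apply: smooth_at_on => p [Mp _]; exact: smooth_at_bspi.
  + apply/seteqP; split=> [b [p [_ rp] <-]//|b rb].
    by have [p Mp pb] := bspi_surj b; exists p => //; split=> //=; rewrite pb.
  + exact: bspi_locally_trivial.
- move=> b rb; apply/seteqP; split=> [p [[Mp rp] /= pb]|p [[Mp pb] rp]]; split=> //.
(* Fibres of a map do not cross, and a fibre over a regular value lies in [regular_part] entirely,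
   so both clauses are vacuous. *)
- split=> [p [b1 [b2 [_ _ b12 [_ /= h1] [_ /= h2]]]]|b p rb [Mp pb] []]; first by case: b12; rewrite -h1.
  by split=> //=; rewrite pb.
Qed.

End Fibration.

Lemma circle_vertex (c : R) : 0 < c -> is_circle (vertex_base c).
Proof.
(* The circle |y|^4 = c has radius c^(1/4). *)
move=> cp; exists 0, 0, (Num.sqrt (Num.sqrt c)); split; first by rewrite !sqrtr_gt0.
have hsE b : hs b = b 0 0 by rewrite /hs mxE; congr (b _ _); apply: val_inj.
have hyE b : dot (hy b) (hy b) = b 0 1 ^+ 2 + b 0 2%:R ^+ 2.
  rewrite dot2E -!expr2 /hy !mxE; congr (b _ _ ^+ 2 + b _ _ ^+ 2); exact: val_inj.
rewrite /vertex_base; apply/seteqP; split=> b /=; rewrite hsE hyE !subr0 sqr_sqrtr ?sqrtr_ge0 //.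
  move=> [-> h]; split=> //; apply/eqP.
  by rewrite -(@eqrXn2 _ 2) ?sqrtr_ge0 ?addr_ge0 ?sqr_ge0 // h sqr_sqrtr // ltW.
by move=> [-> ->]; split=> //; rewrite sqr_sqrtr // ltW.
Qed.

Lemma vertex_base0 b : vertex_base 0 b -> b = 0.
Proof.
move=> [s0 /eqP]; rewrite sqrf_eq0 dot_eq0 => /eqP y0.
rewrite -(base_eta b) s0 y0 /base raddf0; exact: (row_mx0 R 1 1 2).
Qed.

(** All of M_0 has r > 0, so the fibre over 0 is T*S^2 without its zero section, that is, the cone
    without its vertex. *)
Lemma fib0_RpRP3 : diffeomorphic (fib 0 (0 : 'rV[R]_3)) (@RpRP3 R).
Proof.
have [v vv _] := normalize_any (0 : 'rV[R]_2).
have D := fib_diffeo2 (lexx 0) 0 vv.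
have e : 0 = (0 ^+ 2) ^+ 2 :> R by rewrite !expr0n.
rewrite (outer_eq e) scale0r in D.
have b0 : base 0 0 = 0 :> 'rV[R]_3 by rewrite /base raddf0; exact: (row_mx0 R 1 1 2).
rewrite b0 in D.
have NE : fib 0 (0 : 'rV[R]_3) `&` [set p | 0 < rad2 p.2] = fib 0 0.
  by apply/seteqP; split=> [p []//|p Fp]; split=> //=; have [[_ +] _] := Fp; rewrite add0r.
rewrite NE in D.
have f4 := findim_mx R 4 4.
have fR : findim (R^o * 'M[R]_4)%type by exact: findim_prod (findim_R R) f4.
have D2 := diffeo_comp (findim_amb R) (findim_TS R) f4 D (@cone_diffeo R).
by eexists; eexists; exact: diffeo_comp (findim_amb R) f4 fR D2 (@cone_RpRP3_diffeo R).
Qed.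

Lemma Mc_pos (c : R) : 0 < c -> Mc c = @M R.
Proof.
move=> cp; apply/seteqP; split=> [p []//|p Mp]; split=> //.
by rewrite ltr_wpDr // rad2_ge0.
Qed.

Lemma Mc_0 : Mc 0 = @M0 R.
Proof.
apply/seteqP; split=> p [Mp h]; split=> //=.
  by rewrite -rad2_eq0 gt_eqF // -[X in _ < X]add0r.
by rewrite add0r lt_def rad2_ge0 rad2_eq0 andbT.
Qed.

Lemma bspi_image (c : R) : 0 <= c -> smooth_on (Mc c) (bspi c) /\ bspi c @` (Mc c) = setT.
Proof.
move=> c0; split; first by apply: smooth_at_on => p; exact: smooth_at_bspi.
by apply/seteqP; split=> // b _; have [p Mp pb] := bspi_surj c0 b; exists p.
Qed.

End Total.

Theorem theorem5p1 (R : realType) :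
  (forall (c : R) (phi : amb R -> ('I_3 -> amb R) -> R),
     0 < c -> bryant_salamon c (@M R) phi ->
     exists pi : amb R -> 'rV[R]_3,
     let fib (x : 'rV[R]_3) := @M R `&` pi @^-1` [set x] in
     [/\ smooth_on (@M R) pi /\ pi @` (@M R) = setT,
         SO3_invariant (@M R) pi,
         forall x, coassociative (@M R) phi (fib x),
         exists2 C : set 'rV[R]_3, is_circle C &
           (forall x, ~ C x -> diffeomorphic (fib x) (@TstarS2 R)) /\
           (forall x, C x -> iso_coneRP3 (fib x))
       & coassociative_fibration (@M R) phi setT fib]) /\
  (forall phi : amb R -> ('I_3 -> amb R) -> R,
     bryant_salamon 0 (@M0 R) phi ->
     exists pi : amb R -> 'rV[R]_3,
     let fib (x : 'rV[R]_3) := @M0 R `&` pi @^-1` [set x] in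
     [/\ smooth_on (@M0 R) pi /\ pi @` (@M0 R) = setT,
         SO3_invariant (@M0 R) pi,
         forall x, coassociative (@M0 R) phi (fib x),
         (forall x, x <> 0 -> diffeomorphic (fib x) (@TstarS2 R)) /\
         diffeomorphic (fib 0) (@RpRP3 R)
       & coassociative_fibration (@M0 R) phi setT fib]).
Proof.
split=> [c phi cp|phi].
  rewrite -(Mc_pos cp) => bs; have c0 := ltW cp; exists (bspi c); split.
  - exact: bspi_image.
  - exact: bspi_invariant.
  - by move=> x; exact: fib_coassociative.
  - exists (vertex_base c); first exact: circle_vertex.
    split=> x; first exact: fib_smooth.
    by move=> vb; have [p _ [_ _ _]] := fib_vertex cp vb.
  - exact: bspi_fibration.
rewrite -Mc_0 => bs; have c0 := lexx (0 : R); exists (bspi 0); split.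
- exact: bspi_image.
- exact: bspi_invariant.
- by move=> x; exact: fib_coassociative.
- split; last exact: fib0_RpRP3.
  by move=> x x0; apply: fib_smooth => // /vertex_base0.
- exact: bspi_fibration.
Qed.
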